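(* Fix $v\in\{\mathrm{RR},\mathrm{VV},\mathrm{VN},\mathrm{AZ}\}$ and a contrast matrix $\mathbf H\in\mathbb R^{r\times k}$ (i.e. $\mathbf H\mathbf 1_{k\times1}=\mathbf 0_{r\times 1}$). In the $k$-sample setting of the context, suppose $n_i/n\to\kappa_i\in(0,1)$ for all $i$, and Assumptions 1 (for variant $v$) and 2 hold for every group $i$. Then, as $n\to\infty$: (i) if $\mathbf H\mathbf C^v=\mathbf 0$, then $S_{n,C^v}(\mathbf H)\xrightarrow{d}\chi^2_{\mathrm{rank}(\mathbf H)}$; (ii) if $\mathbf H\mathbf C^v\neq\mathbf 0$, then $S_{n,C^v}(\mathbf H)\xrightarrow{p}\infty$; (iii) if $\mathbf H\mathbf B^v=\mathbf 0$, then $S_{n,B^v}(\mathbf H)\xrightarrow{d}\chi^2_{\mathrm{rank}(\mathbf H)}$; (iv) if $\mathbf H\mathbf B^v\neq\mathbf 0$, then $S_{n,B^v}(\mathbf H)\xrightarrow{p}\infty$.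
   Context: Setting: for $i=1,\ldots,k$, $\mathbf X_{i1},\ldots,\mathbf X_{in_i}$ are i.i.d. $d$-dimensional random vectors with mean $\boldsymbol\mu_i$ and covariance $\boldsymbol\Sigma_i$; all observations are mutually independent; $n=\sum_in_i$. MCVs of group $i$: $C_i^{\mathrm{RR}}=\sqrt{(\det\boldsymbol\Sigma_i)^{1/d}/(\boldsymbol\mu_i^\top\boldsymbol\mu_i)}$, $C_i^{\mathrm{VV}}=\sqrt{\mathrm{tr}\boldsymbol\Sigma_i/(\boldsymbol\mu_i^\top\boldsymbol\mu_i)}$, $C_i^{\mathrm{VN}}=\sqrt{1/(\boldsymbol\mu_i^\top\boldsymbol\Sigma_i^{-1}\boldsymbol\mu_i)}$, $C_i^{\mathrm{AZ}}=\sqrt{\boldsymbol\mu_i^\top\boldsymbol\Sigma_i\boldsymbol\mu_i/(\boldsymbol\mu_i^\top\boldsymbol\mu_i)^2}$; $B_i^v=1/C_i^v$; $\mathbf C^v=(C_1^v,\ldots,C_k^v)^\top$, $\mathbf B^v=(B_1^v,\ldots,B_k^v)^\top$. $\widehat C_i^v,\widehat B_i^v$ are the plug-in estimators based on the sample mean and sample covariance of group $i$; $\widehat{\mathbf C}^v,\widehat{\mathbf B}^v$ the corresponding vectors. Assumption 1 (for a group with mean $\boldsymbol\mu$, covariance $\boldsymbol\Sigma$, variant $v$): $\boldsymbol\mu\neq\mathbf 0$, finite fourth moments of all coordinates; for $v\in\{\mathrm{RR},\mathrm{VN}\}$ $\boldsymbol\Sigma$ regular; for $v=\mathrm{VV}$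 $\boldsymbol\Sigma\neq\mathbf 0$; for $v=\mathrm{AZ}$ $\boldsymbol\mu^\top\boldsymbol\Sigma\boldsymbol\mu>0$. Assumption 2: no coordinate of $\mathbf X_{i1}$ is conditionally two-point distributed, i.e. no coordinate is, given the remaining coordinates, conditionally degenerate or conditionally taking only two values with positive probability. Variance estimators: for group $i$ with observations $\mathbf X_{ij}=(X_{ij1},\ldots,X_{ijd})^\top$, let $\widehat{\boldsymbol\mu}$, $\widehat{\boldsymbol\Sigma}$ be sample mean and covariance, $[\widehat{\boldsymbol\Psi}_3]_{(a-1)d+r,s}=\overline{X_aX_rX_s}-\overline{X_aX_r}\,\overline{X_s}$, $[\widehat{\boldsymbol\Psi}_4]_{(a-1)d+r,(b-1)d+s}=\overline{X_aX_rX_bX_s}-\overline{X_aX_r}\,\overline{X_bX_s}$ (bars: within-group empirical means $n_i^{-1}\sum_j$). With $[\widetilde{\mathbf D}(\mathbf x)]_{(a-1)d+r,s}=-x_r\mathbf 1\{s=a\neq r\}-2x_s\mathbf 1\{s=r=a\}-x_a\mathbf 1\{r=s\neq a\}$, column-stacking $\mathrm{vec}$, Kronecker product $\otimes$, and $\mathbf A_{\mathrm{RR}}(\boldsymbol\mu,\boldsymbol\Sigma)=\Big(-2d\det(\boldsymbol\Sigma)\frac{\boldsymbol\mu^\top}{(\boldsymbol\mu^\top\boldsymbol\mu)^{d+1}}+\frac{\det(\boldsymbol\Sigma)(\mathrm{vec}(\boldsymbol\Sigma^{-1}))^\top}{(\boldsymbol\mu^\top\boldsymbol\mu)^d}\widetilde{\mathbf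 D}(\boldsymbol\mu),\ \frac{\det(\boldsymbol\Sigma)(\mathrm{vec}(\boldsymbol\Sigma^{-1}))^\top}{(\boldsymbol\mu^\top\boldsymbol\mu)^d}\Big)$, $\mathbf A_{\mathrm{VV}}=\Big(-2\,\mathrm{tr}(\boldsymbol\Sigma)\frac{\boldsymbol\mu^\top}{(\boldsymbol\mu^\top\boldsymbol\mu)^2}+\frac{(\mathrm{vec}(\mathbf I_d))^\top\widetilde{\mathbf D}(\boldsymbol\mu)}{\boldsymbol\mu^\top\boldsymbol\mu},\ \frac{(\mathrm{vec}(\mathbf I_d))^\top}{\boldsymbol\mu^\top\boldsymbol\mu}\Big)$, $\mathbf A_{\mathrm{VN}}=\Big(2\boldsymbol\mu^\top\boldsymbol\Sigma^{-1}-[(\boldsymbol\mu^\top\boldsymbol\Sigma^{-1})\otimes(\boldsymbol\mu^\top\boldsymbol\Sigma^{-1})]\widetilde{\mathbf D}(\boldsymbol\mu),\ -(\boldsymbol\mu^\top\boldsymbol\Sigma^{-1})\otimes(\boldsymbol\mu^\top\boldsymbol\Sigma^{-1})\Big)$, $\mathbf A_{\mathrm{AZ}}=\Big(-4\boldsymbol\mu^\top\boldsymbol\Sigma\boldsymbol\mu\frac{\boldsymbol\mu^\top}{(\boldsymbol\mu^\top\boldsymbol\mu)^3}+2\frac{\boldsymbol\mu^\top\boldsymbol\Sigma}{(\boldsymbol\mu^\top\boldsymbol\mu)^2}+\frac{(\boldsymbol\mu^\top\otimes\boldsymbol\mu^\top)\widetilde{\mathbf D}(\boldsymbol\mu)}{(\boldsymbol\mu^\top\boldsymbol\mu)^2},\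 \frac{\boldsymbol\mu^\top\otimes\boldsymbol\mu^\top}{(\boldsymbol\mu^\top\boldsymbol\mu)^2}\Big)$, and $\widehat S_{\mathrm{RR}}=d^{-2}(\widehat C^{\mathrm{RR}})^{2-4d}$, $\widehat S_{\mathrm{VV}}=(\widehat C^{\mathrm{VV}})^{-2}$, $\widehat S_{\mathrm{VN}}=(\widehat C^{\mathrm{VN}})^{6}$, $\widehat S_{\mathrm{AZ}}=(\widehat C^{\mathrm{AZ}})^{-2}$ (all from group $i$), set $\widehat\sigma^2_{i,C^v}=\frac{\widehat S_v}{4}\mathbf A_v(\widehat{\boldsymbol\mu},\widehat{\boldsymbol\Sigma})\begin{pmatrix}\widehat{\boldsymbol\Sigma}&\widehat{\boldsymbol\Psi}_3^\top\\\widehat{\boldsymbol\Psi}_3&\widehat{\boldsymbol\Psi}_4\end{pmatrix}\mathbf A_v(\widehat{\boldsymbol\mu},\widehat{\boldsymbol\Sigma})^\top$ and $\widehat\sigma^2_{i,B^v}=(\widehat C_i^v)^{-4}\widehat\sigma^2_{i,C^v}$. Wald-type statistics: $\widehat{\boldsymbol\Sigma}_{C^v}=\mathrm{diag}((n/n_1)\widehat\sigma^2_{1,C^v},\ldots,(n/n_k)\widehat\sigma^2_{k,C^v})$, analogously $\widehat{\boldsymbol\Sigma}_{B^v}$; $S_{n,C^v}(\mathbf H)=n(\mathbf H\widehat{\mathbf C}^v)^\top(\mathbf H\widehat{\boldsymbol\Sigma}_{C^v}\mathbf H^\top)^+\mathbf H\widehat{\mathbf C}^v$ and $S_{n,B^v}(\mathbf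 H)=n(\mathbf H\widehat{\mathbf B}^v)^\top(\mathbf H\widehat{\boldsymbol\Sigma}_{B^v}\mathbf H^\top)^+\mathbf H\widehat{\mathbf B}^v$, where $^+$ is the Moore–Penrose inverse. *)

(* Defs.v *)
From HB Require Import structures.
From mathcomp Require Import all_boot all_order all_algebra.
From mathcomp Require Import all_classical all_reals all_analysis.
Set Implicit Arguments.
Unset Strict Implicit.
Unset Printing Implicit Defensive.
Import Order.TTheory GRing.Theory Num.Theory.
Import numFieldNormedType.Exports.
Local Open Scope classical_set_scope.
Local Open Scope ring_scope.

Inductive mcv_variant := RR | VV | VN | AZ.

(** * Indexing of R^(d*d): the 0-based index q = a*d + r stands for the
    paper's (a-1)d + r (column a, row r in column-stacking vec). *)
Lemma vec_lt_row (d : nat) (q : 'I_(d * d)) : (q %% d < d)%N.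
Proof.
case: d q => [|d] q; first by case: q; rewrite muln0.
by rewrite ltn_pmod.
Qed.

Lemma vec_lt_col (d : nat) (q : 'I_(d * d)) : (q %/ d < d)%N.
Proof.
case: d q => [|d] q; first by case: q; rewrite muln0.
by rewrite ltn_divLR.
Qed.

Definition vrow {d : nat} (q : 'I_(d * d)) : 'I_d := Ordinal (vec_lt_row q).
Definition vcol {d : nat} (q : 'I_(d * d)) : 'I_d := Ordinal (vec_lt_col q).

Definition vecmx {R : realType} {d : nat} (M : 'M[R]_d) : 'cV[R]_(d * d) :=
  \col_q M (vrow q) (vcol q).

Definition kron_row {R : realType} {d : nat} (u w : 'rV[R]_d) : 'rV[R]_(d * d) :=
  \row_q (u 0 (vcol q) * w 0 (vrow q)).

Definition Dtilde {R : realType} {d : nat} (x : 'cV[R]_d) : 'M[R]_(d * d, d) :=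
  \matrix_(q, s)
    (let a := vcol q in let r := vrow q in
     - (x r 0) * ((s == a) && (a != r))%:R
     - 2 * x s 0 * ((s == r) && (r == a))%:R
     - x a 0 * ((r == s) && (s != a))%:R).

Definition dotv {R : realType} {d : nat} (u w : 'cV[R]_d) : R := (u^T *m w) 0 0.

Definition MCV {R : realType} {d : nat} (v : mcv_variant)
    (mu : 'cV[R]_d) (S : 'M[R]_d) : R :=
  let m2 := dotv mu mu in
  match v with
  | RR => Num.sqrt (powR (\det S) (d%:R^-1) / m2)
  | VV => Num.sqrt (\tr S / m2)
  | VN => Num.sqrt ((dotv mu (invmx S *m mu))^-1)
  | AZ => Num.sqrt (dotv mu (S *m mu) / m2 ^+ 2)
  end.

(** The gradient row vectors A_v(mu, Sigma) (length d + d^2). *)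
Definition Amat {R : realType} {d : nat} (v : mcv_variant)
    (mu : 'cV[R]_d) (S : 'M[R]_d) : 'rV[R]_(d + d * d) :=
  let m2 := dotv mu mu in
  match v with
  | RR =>
      row_mx ((- 2 * d%:R * \det S / m2 ^+ d.+1) *: mu^T
              + (\det S / m2 ^+ d) *: ((vecmx (invmx S))^T *m Dtilde mu))
             ((\det S / m2 ^+ d) *: (vecmx (invmx S))^T)
  | VV =>
      row_mx ((- 2 * \tr S / m2 ^+ 2) *: mu^T
              + m2^-1 *: ((vecmx (1%:M : 'M[R]_d))^T *m Dtilde mu))
             (m2^-1 *: (vecmx (1%:M : 'M[R]_d))^T)
  | VN =>
      let u := mu^T *m invmx S in
      row_mx (2 *: u - kron_row u u *m Dtilde mu) (- kron_row u u)
  | AZ =>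
      row_mx ((- 4 * dotv mu (S *m mu) / m2 ^+ 3) *: mu^T
              + (2 / m2 ^+ 2) *: (mu^T *m S)
              + (m2 ^+ 2)^-1 *: (kron_row mu^T mu^T *m Dtilde mu))
             ((m2 ^+ 2)^-1 *: kron_row mu^T mu^T)
  end.

Definition Sfac {R : realType} (d : nat) (v : mcv_variant) (c : R) : R :=
  match v with
  | RR => (d%:R ^+ 2)^-1 * c ^ ((2 : int) - (4 * d)%:Z)
  | VV => c ^- 2
  | VN => c ^+ 6
  | AZ => c ^- 2
  end.

Definition smean {R : realType} {d : nat} (n : nat) (x : nat -> 'cV[R]_d) : 'cV[R]_d :=
  n%:R^-1 *: \sum_(j < n) x j.

Definition scov {R : realType} {d : nat} (n : nat) (x : nat -> 'cV[R]_d) : 'M[R]_d :=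
  (n.-1)%:R^-1 *: \sum_(j < n) ((x j - smean n x) *m (x j - smean n x)^T).

Definition emp {R : realType} (n : nat) (f : nat -> R) : R :=
  n%:R^-1 * \sum_(j < n) f j.

Definition Psi3 {R : realType} {d : nat} (n : nat) (x : nat -> 'cV[R]_d) :
    'M[R]_(d * d, d) :=
  \matrix_(q, s)
    (let a := vcol q in let r := vrow q in
     emp n (fun j => x j a 0 * x j r 0 * x j s 0)
     - emp n (fun j => x j a 0 * x j r 0) * emp n (fun j => x j s 0)).

Definition Psi4 {R : realType} {d : nat} (n : nat) (x : nat -> 'cV[R]_d) :
    'M[R]_(d * d, d * d) :=
  \matrix_(q, q')
    (let a := vcol q in let r := vrow q in
     let b := vcol q' in let s := vrow q' in
     emp n (fun j => x j a 0 * x j r 0 * x j b 0 * x j s 0)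
     - emp n (fun j => x j a 0 * x j r 0) * emp n (fun j => x j b 0 * x j s 0)).

Definition Omega {R : realType} {d : nat} (n : nat) (x : nat -> 'cV[R]_d) :
    'M[R]_(d + d * d) :=
  block_mx (scov n x) (Psi3 n x)^T (Psi3 n x) (Psi4 n x).

Definition Chat {R : realType} {d : nat} (v : mcv_variant) (n : nat)
    (x : nat -> 'cV[R]_d) : R :=
  MCV v (smean n x) (scov n x).

Definition sig2C {R : realType} {d : nat} (v : mcv_variant) (n : nat)
    (x : nat -> 'cV[R]_d) : R :=
  Sfac d v (Chat v n x) / 4 *
  (Amat v (smean n x) (scov n x) *m Omega n x *m (Amat v (smean n x) (scov n x))^T) 0 0.

Definition sig2B {R : realType} {d : nat} (v : mcv_variant) (n : nat)
    (x : nat -> 'cV[R]_d) : R :=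
  (Chat v n x) ^- 4 * sig2C v n x.

(** Moore-Penrose inverse (real matrices): the unique X with
    MXM = M, XMX = X, (MX)^T = MX, (XM)^T = XM. *)
Definition mpinv {R : realType} {p : nat} (M : 'M[R]_p) : 'M[R]_p :=
  xget 0 [set Y | M *m Y *m M = M /\ Y *m M *m Y = Y /\
                  (M *m Y)^T = M *m Y /\ (Y *m M)^T = Y *m M].

Definition wald {R : realType} {k r : nat} (H : 'M[R]_(r, k)) (n : nat)
    (nn : 'I_k -> nat) (est : 'cV[R]_k) (sig : 'I_k -> R) : R :=
  let Sig := diag_mx (\row_i (n%:R / (nn i)%:R * sig i)) in
  n%:R * ((H *m est)^T *m mpinv (H *m Sig *m H^T) *m (H *m est)) 0 0.

(** * Data: X i j t is the (j+1)-th observation of group i+1, a d-tuple. *)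
Definition obs {R : realType} {T : Type} {k d : nat}
    (X : 'I_k -> nat -> T -> d.-tuple R) (i : 'I_k) (t : T) : nat -> 'cV[R]_d :=
  fun j => \col_a tnth (X i j t) a.

Definition S_C {R : realType} {T : Type} {k d r : nat} (v : mcv_variant)
    (H : 'M[R]_(r, k)) (X : 'I_k -> nat -> T -> d.-tuple R)
    (nn : 'I_k -> nat -> nat) (m : nat) (t : T) : R :=
  wald H m (nn^~ m) (\col_i Chat v (nn i m) (obs X i t))
       (fun i => sig2C v (nn i m) (obs X i t)).

Definition S_B {R : realType} {T : Type} {k d r : nat} (v : mcv_variant)
    (H : 'M[R]_(r, k)) (X : 'I_k -> nat -> T -> d.-tuple R)
    (nn : 'I_k -> nat -> nat) (m : nat) (t : T) : R :=
  wald H m (nn^~ m) (\col_i (Chat v (nn i m) (obs X i t))^-1)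
       (fun i => sig2B v (nn i m) (obs X i t)).

Section Prob.
Context {R : realType} {dT : measure_display} {T : measurableType dT}.
Variable P : probability T R.

Definition Ex (f : T -> R) : R := fine (\int[P]_t (f t)%:E).

Definition mutually_independent {k d : nat} (X : 'I_k -> nat -> T -> d.-tuple R) :=
  forall (s : seq ('I_k * nat)) (B : 'I_k * nat -> set (d.-tuple R)),
    uniq s -> (forall p, measurable (B p)) ->
    P (\bigcap_(p in [set` s]) (X p.1 p.2 @^-1` B p)) =
    (\prod_(p <- s) P (X p.1 p.2 @^-1` B p))%E.

Definition mu_pop {k d : nat} (X : 'I_k -> nat -> T -> d.-tuple R) (i : 'I_k) :
    'cV[R]_d :=
  \col_a Ex (fun t => tnth (X i 0 t) a).

Definition Sigma_pop {k d : nat} (X : 'I_k -> nat -> T -> d.-tuple R) (i : 'I_k) :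
    'M[R]_d :=
  \matrix_(a, b) Ex (fun t => (tnth (X i 0 t) a - mu_pop X i a 0) *
                              (tnth (X i 0 t) b - mu_pop X i b 0)).

Definition assumption1 {k d : nat} (v : mcv_variant)
    (X : 'I_k -> nat -> T -> d.-tuple R) (i : 'I_k) : Prop :=
  [/\ mu_pop X i != 0,
      (forall a, P.-integrable setT (fun t => (tnth (X i 0 t) a ^+ 4)%:E)) &
      match v with
      | RR | VN => Sigma_pop X i \in unitmx
      | VV => Sigma_pop X i != 0
      | AZ => 0 < dotv (mu_pop X i) (Sigma_pop X i *m mu_pop X i)
      end].

(** Assumption 2 for group i: no coordinate a of X i 0 is, given the other
    coordinates, conditionally concentrated on (at most) two values, i.e.
    there are no measurable f, g of the remaining coordinates with
    X_a in {f(X_{-a}), g(X_{-a})} almost surely. *)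
Definition assumption2 {k d : nat} (X : 'I_k -> nat -> T -> d.-tuple R)
    (i : 'I_k) : Prop :=
  forall a : 'I_d,
    ~ exists f g : d.-tuple R -> R,
        [/\ measurable_fun setT f, measurable_fun setT g,
            (forall x y : d.-tuple R, (forall b, b != a -> tnth x b = tnth y b) ->
               f x = f y /\ g x = g y) &
            P [set t | tnth (X i 0 t) a = f (X i 0 t) \/
                       tnth (X i 0 t) a = g (X i 0 t)] = 1%E].

Definition cvg_in_distribution (S : nat -> T -> R) (F : R -> R) : Prop :=
  forall x : R, {for x, continuous F} ->
    (fun m => P [set t | S m t <= x]) @ \oo --> (F x)%:E.

Definition cvg_in_prob_infty (S : nat -> T -> R) : Prop :=
  forall M : R, (fun m => P [set t | S m t <= M]) @ \oo --> 0%E.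

End Prob.

Definition chi2_kernel {R : realType} (q : nat) (t : R) : R :=
  powR t (q%:R / 2 - 1) * expR (- t / 2).

Definition chi2_cdf {R : realType} (q : nat) (x : R) : R :=
  if q == 0%N then (if 0 <= x then 1 else 0)
  else if x <= 0 then 0
  else fine (\int[@lebesgue_measure R]_(t in [set t : R | 0 < t <= x]) (chi2_kernel q t)%:E)
       / fine (\int[@lebesgue_measure R]_(t in [set t : R | 0 < t]) (chi2_kernel q t)%:E).

(* Main.v *)
Require Import Defs.
From HB Require Import structures.
From mathcomp Require Import all_boot all_order all_algebra.
From mathcomp Require Import all_classical all_reals all_analysis.
From mathcomp Require Import measurable_realfun perm ring lra.
Set Implicit Arguments.
Unset Strict Implicit.
Unset Printing Implicit Defensive.
Import Order.TTheory GRing.Theory Num.Theory.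
Import numFieldNormedType.Exports.
Local Open Scope classical_set_scope.
Local Open Scope ring_scope.

(* Every plug-in estimator is a smooth function of the sample moments of a group, so sqrt n (est - C)
   is, up to o_P(1), a normalised sum of a centred quadratic score of the observations, whose variance
   the plug-in variance estimates consistently. This variance is positive: otherwise the observations
   would lie on a quadric, which Assumption 2 forbids. With H = B R a full-rank factorisation one has
   B^T (B G B^T)^+ B = G^-1, so the Wald statistic is n (R est)^T G^-1 (R est), where G is the estimated
   covariance of R est. Under the null hypothesis it differs by o_P(1) from |W|^2, with W a vector of
   normalised sums of limiting covariance 1; otherwise it grows like n.
   The cosine transforms of the linear combinations of W converge to Gaussian ones. Writing e^(-s x^2)
   as a Gaussian mixture of cosines, one coordinate at a time, gives the limit (1 + 2 s)^(-q/2) of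
   E e^(-s |W|^2), and the distribution functions follow by approximating their indicators with
   polynomials in e^(-x). *)

(** * Expectations *)

(** The pseudo-inverse is discontinuous, so convergence of the estimated covariance matrix says
    nothing about its Moore-Penrose inverse. Factoring the fixed matrix H, not the random product
    around it, leaves only the ordinary inverse of a matrix of size rank H, which is continuous at
    its nonsingular limit. Fourth moments give the summands of [Psi4] no more than a first moment,
    so the law of large numbers must hold without variances. It is obtained like the central limit
    theorem, from expansions of cosine and sine transforms; the sine transforms of centred variables
    are of smaller order and count as errors. Passing from transforms to laws uses no inversion
    formula: u = e^(-x) maps the half-line into [0, 1], where Laplace transforms at integers are
    moments and Bernstein polynomials approximate test functions uniformly. The same Laplace
    transforms yield tightness and convergence to 0 in probability, by Markov's inequality.
    Probabilities of events such as S <= x require measurable statistics; the pseudo-inverse is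
    measurable as a pointwise limit of regularised inverses. *)

Lemma Rintegral_dominated {R : realType} {dT} {T : measurableType dT}
    (mu : {measure set T -> \bar R}) (u : nat -> T -> R) (f g : T -> R) :
  (forall n, measurable_fun setT (u n)) -> measurable_fun setT f ->
  mu.-integrable setT (EFin \o g) ->
  (forall t, u ^~ t @ \oo --> f t) -> (forall n t, `|u n t| <= g t) ->
  (fun n => Rintegral mu setT (u n)) @ \oo --> Rintegral mu setT f.
Proof.
move=> mu_ mf Ig uf ug.
have [||||If _ H] := @dominated_convergence _ _ R mu setT measurableT
  (fun n t => (u n t)%:E) (fun t => (f t)%:E) (EFin \o g) _ _ _ Ig.
- by move=> n; exact/measurable_EFinP.
- exact/measurable_EFinP.
- by apply: aeW => t _; apply: cvg_EFin; [exact: nearW|exact: uf].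
- by apply: aeW => t n _; rewrite lee_fin.
by apply: fine_cvg; rewrite fineK //; apply: integrable_fin_num.
Qed.

Definition Intg {R : realType} {dT} {T : measurableType dT} (P : probability T R)
  (f : T -> R) := P.-integrable setT (EFin \o f).

Section expectation.
Context {R : realType} {dT : measure_display} {T : measurableType dT}.
Variable P : probability T R.
Implicit Types f g : T -> R.

Lemma Intg_measurable f : Intg P f -> measurable_fun setT f.
Proof. by move=> /measurable_int/measurable_EFinP. Qed.

Lemma IntgD f g : Intg P f -> Intg P g -> Intg P (fun t => f t + g t).
Proof. by move=> If Ig; have := integrableD measurableT If Ig. Qed.

Lemma IntgB f g : Intg P f -> Intg P g -> Intg P (fun t => f t - g t).
Proof. by move=> If Ig; have := integrableB measurableT If Ig. Qed.

Lemma IntgZ c f : Intg P f -> Intg P (fun t => c * f t).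
Proof.
move=> If; have := integrableZl measurableT c If.
by apply: eq_integrable => // x _; rewrite /= EFinM.
Qed.

Lemma Intg_le f g : measurable_fun setT f -> Intg P g ->
  (forall t, `|f t| <= g t) -> Intg P f.
Proof.
move=> mf Ig fg; apply: (le_integrable measurableT _ _ Ig).
  exact/measurable_EFinP.
move=> t _ /=; rewrite lee_fin (le_trans (fg t))//; exact: ler_norm.
Qed.

Lemma Intg_cst c : Intg P (cst c).
Proof. by apply: finite_measure_integrable_cst. Qed.

Lemma Intg_bounded f c : measurable_fun setT f -> (forall t, `|f t| <= c) ->
  Intg P f.
Proof. by move=> mf fc; apply: (Intg_le mf (Intg_cst c)). Qed.

Lemma Intg_norm f : Intg P f -> Intg P (fun t => `|f t|).
Proof.
move=> If; apply: (le_integrable measurableT _ _ If) => //.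
  by apply/measurable_EFinP/measurableT_comp => //; exact: Intg_measurable.
by move=> t _ /=; rewrite normr_id.
Qed.

Lemma Intg_sum (I : Type) (s : seq I) (F : I -> T -> R) :
  (forall i, Intg P (F i)) -> Intg P (fun t => \sum_(i <- s) F i t).
Proof.
move=> IF; elim: s => [|i s IH].
  by under eq_fun do rewrite big_nil; exact: Intg_cst.
by under eq_fun do rewrite big_cons; exact: IntgD.
Qed.

Lemma ExD f g : Intg P f -> Intg P g ->
  Ex P (fun t => f t + g t) = Ex P f + Ex P g.
Proof. by move=> If Ig; apply: (RintegralD measurableT If Ig). Qed.

Lemma ExB f g : Intg P f -> Intg P g ->
  Ex P (fun t => f t - g t) = Ex P f - Ex P g.
Proof. by move=> If Ig; apply: (RintegralB measurableT If Ig). Qed.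

Lemma ExZ c f : Intg P f -> Ex P (fun t => c * f t) = c * Ex P f.
Proof. by move=> If; apply: (RintegralZl c measurableT If). Qed.

Lemma Ex_cst c : Ex P (cst c) = c.
Proof.
rewrite -[LHS]/(Rintegral P setT (cst c)) Rintegral_cst//.
by rewrite -[RHS]mulr1; congr (c * _); rewrite (_ : 1 = fine 1%E)//; congr fine; exact: probability_setT.
Qed.

Lemma Ex_sum (I : Type) (s : seq I) (F : I -> T -> R) :
  (forall i, Intg P (F i)) ->
  Ex P (fun t => \sum_(i <- s) F i t) = \sum_(i <- s) Ex P (F i).
Proof.
move=> IF; elim: s => [|i s IH].
  by under eq_fun do rewrite big_nil; rewrite big_nil Ex_cst.
by under eq_fun do rewrite big_cons; rewrite big_cons ExD// ?IH//; exact: Intg_sum.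
Qed.

Lemma Ex_ge0 f : (forall t, 0 <= f t) -> 0 <= Ex P f.
Proof. by move=> f0; apply: Rintegral_ge0. Qed.

Lemma Ex_le f g : Intg P f -> Intg P g -> (forall t, f t <= g t) ->
  Ex P f <= Ex P g.
Proof. by move=> If Ig fg; apply: (le_Rintegral measurableT If Ig). Qed.

Lemma Ex_norm f : Intg P f -> `|Ex P f| <= Ex P (fun t => `|f t|).
Proof. by move=> If; apply: (le_normr_Rintegral measurableT If). Qed.

Lemma Ex_norm_le f g : measurable_fun setT f -> Intg P g ->
  (forall t, `|f t| <= g t) -> `|Ex P f| <= Ex P g.
Proof.
move=> mf Ig fg; have If := Intg_le mf Ig fg.
apply: (le_trans (Ex_norm If)); apply: Ex_le => //; exact: Intg_norm.
Qed.

Lemma Ex_norm_cst f c : measurable_fun setT f -> (forall t, `|f t| <= c) ->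
  `|Ex P f| <= c.
Proof. by move=> mf fc; rewrite -[leRHS]Ex_cst; apply: Ex_norm_le => //; apply: Intg_cst. Qed.

Lemma Ex_indic (A : set T) : measurable A -> Ex P \1_A = fine (P A).
Proof. by move=> mA; rewrite /Ex integral_indic// setIT. Qed.

Lemma Ex_dominated (u : nat -> T -> R) f g :
  (forall n, measurable_fun setT (u n)) -> measurable_fun setT f -> Intg P g ->
  (forall t, u ^~ t @ \oo --> f t) -> (forall n t, `|u n t| <= g t) ->
  (fun n => Ex P (u n)) @ \oo --> Ex P f.
Proof. exact: Rintegral_dominated. Qed.

Lemma Ex_markov f e : Intg P f -> 0 < e -> (forall t, 0 <= f t) ->
  fine (P [set t | e <= f t]) <= Ex P f / e.
Proof.
move=> If e0 f0.
have mA : measurable [set t | e <= f t].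
  rewrite [X in measurable X](_ : _ = setT `&` f @^-1` `[e, +oo[).
    by apply: Intg_measurable If _ _ _; [exact: measurableT|exact: measurable_itv].
  by rewrite setTI; apply/seteqP; split => t /=; rewrite in_itv/= andbT.
rewrite ler_pdivlMr// -Ex_indic// mulrC -ExZ; last first.
  by apply: (@Intg_bounded _ 1) => // t; rewrite indicE; case: (_ \in _); rewrite ?normr1 ?normr0.
apply: Ex_le => //.
  by apply: IntgZ; apply: (@Intg_bounded _ 1) => // t; rewrite indicE; case: (_ \in _); rewrite ?normr1 ?normr0.
move=> t; rewrite indicE; case: (boolP (t \in _)) => [|_]; last by rewrite mulr0.
by rewrite inE/= mulr1.
Qed.

End expectation.

(** The two push-forward measures coincide, which settles nonnegative integrands; the signed case
    follows from positive and negative parts. *)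
Lemma Ex_identically_distributed {R : realType} {dT dS : measure_display}
    {T : measurableType dT} {S : measurableType dS} (P : probability T R)
    (X Y : T -> S) (f : S -> R) :
  measurable_fun setT X -> measurable_fun setT Y ->
  (forall B, measurable B -> P (X @^-1` B) = P (Y @^-1` B)) ->
  measurable_fun setT f -> Intg P (f \o Y) ->
  Intg P (f \o X) /\ Ex P (f \o X) = Ex P (f \o Y).
Proof.
move=> mX mY XY mf IfY.
have ge0 (h : S -> \bar R) : measurable_fun setT h -> (forall x, 0 <= h x)%E ->
    (\int[P]_t h (X t) = \int[P]_t h (Y t))%E.
  move=> mh h0.
  rewrite -(@ge0_integral_pushforward _ _ _ _ _ X mX P setT h)//.
  rewrite -(@ge0_integral_pushforward _ _ _ _ _ Y mY P setT h)//.
  by apply: eq_measure_integral => A mA _; apply: XY.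
have mfE : measurable_fun setT (EFin \o f) by exact/measurable_EFinP.
split; last first.
  rewrite /Ex; congr fine; rewrite integralE [RHS]integralE; congr (_ - _)%E.
    have H := ge0 ((EFin \o f)^\+)%E (measurable_funepos mfE) (funepos_ge0 _).
    have E Z : (fun t : T => ((f \o Z) t)%:E)^\+%E = (EFin \o f)^\+%E \o Z.
      by apply/funext => t; rewrite /= !funeposE.
    by rewrite !E.
  have H := ge0 ((EFin \o f)^\-)%E (measurable_funeneg mfE) (funeneg_ge0 _).
    have E Z : (fun t : T => ((f \o Z) t)%:E)^\-%E = (EFin \o f)^\-%E \o Z.
      by apply/funext => t; rewrite /= !funenegE.
    by rewrite !E.
move: IfY => /integrableP[_ IfY]; apply/integrableP; split.
  by apply/measurable_EFinP; exact: measurableT_comp.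
rewrite (ge0 (fun x => `|(f x)%:E|%E))//.
by apply: measurableT_comp.
Qed.

(** The sum writes floor(n y) / n as a combination of indicators: exactly one index meets the
    condition, namely floor(n y) + n + 1. The shift makes indices natural, since floor(n y) lies
    between -n and n. *)
Lemma floor_step {R : realType} (y : R) (n : nat) : (0 < n)%N -> `|y| <= 1 ->
  `|y - \sum_(i < (n.+1).*2) ((i%:R - n.+1%:R) / n%:R) *
     (i%:R - n.+1%:R <= n%:R * y < i%:R - n%:R)%R%:R| <= n%:R^-1.
Proof.
move=> n0; rewrite ler_norml => /andP[f1a f1b].
have n0' : (0 : R) < n%:R by rewrite ltr0n.
have nfa : - n%:R <= n%:R * y by rewrite -mulrN1 ler_pM2l.
have nfb : n%:R * y <= n%:R by rewrite -[leRHS]mulr1 ler_pM2l.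
move Ez : (n%:R * y) nfa nfb => z nfa nfb.
have fl := floor_itv (z + n.+1%:R).
have k0 : (0 <= Num.floor (z + n.+1%:R))%R by rewrite floor_ge0; rewrite -natr1; lra.
case: (Num.floor (z + n.+1%:R)) k0 fl => // k _; rewrite intrD => /andP[k1 k2].
have k1' : k%:R <= z + n%:R + 1 by rewrite -addrA (natr1 n); exact: k1.
have k2' : z + n%:R + 1 < k%:R + 1 by rewrite -[ltLHS]addrA (natr1 n); exact: k2.
clear k1 k2.
have kl : (k < (n.+1).*2)%N.
  by rewrite -(ltr_nat R) -addnn natrD -natr1; lra.
rewrite (bigD1 (Ordinal kl) isT) big1 => [|i ik]; last first.
  case E : (_ <= _ < _); last by rewrite mulr0.
  move/andP: E => [i1 i2].
  exfalso; move/andP: ik => [_ /negP]; apply.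
  have h1 : (i < k.+1)%N by rewrite -(ltr_nat R) -!natr1; rewrite -natr1 in i1; lra.
  have h2 : (k < i.+1)%N by rewrite -(ltr_nat R) -!natr1; rewrite -natr1 in i1; lra.
  by apply/eqP/val_inj/anti_leq; rewrite -ltnS h1 -ltnS h2.
rewrite [Y in `|_ - Y|](_ : _ = (k%:R - n.+1%:R) / n%:R *
  (k%:R - n.+1%:R <= z < k%:R - n%:R)%R%:R); last exact: addr0.
rewrite (_ : (_ <= _ < _) = true) ?mulr1; last first.
  by rewrite -natr1; apply/andP; split; lra.
rewrite [X in `|X|](_ : _ = (z + n%:R + 1 - k%:R) / n%:R); last first.
  by rewrite -Ez -natr1; field; rewrite lt0r_neq0.
rewrite normrM [X in _ * X]ger0_norm ?invr_ge0// -[leRHS]mul1r ler_pM2r ?invr_gt0//.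
by rewrite ler_norml; apply/andP; split; lra.
Qed.

(** * Product rules for expectations of independent variables *)

Section product_rule.
Context {R : realType} {dT dS : measure_display}
  {T : measurableType dT} {S : measurableType dS} {I : choiceType}.
Variables (P : probability T R) (X : I -> T -> S).
Hypothesis mX : forall p, measurable_fun setT (X p).

Definition indep_family := forall (s : seq I) (B : I -> set S),
  uniq s -> (forall p, measurable (B p)) ->
  P (\bigcap_(p in [set` s]) (X p @^-1` B p)) =
  (\prod_(p <- s) P (X p @^-1` B p))%E.

Lemma measurable_preimage p (B : set S) : measurable B -> measurable (X p @^-1` B).
Proof. by move=> mB; rewrite -[X in measurable X]setTI; exact: mX. Qed.

Lemma measurable_prod_comp (s : seq I) (f : I -> S -> R) :
  (forall p, measurable_fun setT (f p)) ->
  measurable_fun setT (fun t => \prod_(p <- s) f p (X p t)).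
Proof.
move=> mf; elim: s => [|p s IH].
  by under eq_fun do rewrite big_nil; exact: measurable_cst.
under eq_fun do rewrite big_cons.
by apply: measurable_funM => //; exact: measurableT_comp.
Qed.

Lemma prod_norm_le1 (s : seq I) (f : I -> S -> R) t :
  (forall p x, `|f p x| <= 1) -> `|\prod_(p <- s) f p (X p t)| <= 1.
Proof.
move=> f1; elim: s => [|p s IH]; first by rewrite big_nil normr1.
by rewrite big_cons normrM mulr_ile1.
Qed.

(* A bounded function is a uniform limit of step functions [floor (n f) / n]. *)
Lemma Ex_mul_simple (Y : T -> S) (Z : T -> R) (f : S -> R) :
  measurable_fun setT Y -> measurable_fun setT Z -> (forall t, `|Z t| <= 1) ->
  (forall B, measurable B ->
     Ex P (fun t => \1_B (Y t) * Z t) = fine (P (Y @^-1` B)) * Ex P Z) ->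
  measurable_fun setT f -> (forall x, `|f x| <= 1) ->
  Ex P (fun t => f (Y t) * Z t) = Ex P (f \o Y) * Ex P Z.
Proof.
move=> mY mZ Z1 YZ mf f1.
have IZ : Intg P Z by apply: Intg_bounded Z1.
pose step (n : nat) (x : S) : R := \sum_(i < (n.+1).*2)
  ((i%:R - n.+1%:R) / n%:R) * \1_[set x | (i%:R - n.+1%:R <= n%:R * f x < i%:R - n%:R)] x.
have mstepi (n : nat) (i : nat) :
    measurable [set x | (i%:R - n.+1%:R <= n%:R * f x < i%:R - n%:R)].
  rewrite [X in measurable X](_ : _ = setT `&` (fun x => n%:R * f x) @^-1` `[i%:R - n.+1%:R, i%:R - n%:R[).
    have : measurable_fun setT (fun x => n%:R * f x) by exact: measurable_funM.
    by apply; [exact: measurableT|exact: measurable_itv].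
  by rewrite setTI; apply/seteqP; split => x /=; rewrite in_itv.
have mstep n : measurable_fun setT (step n).
  apply: measurable_sum => i; apply: measurable_funM; first exact: measurable_cst.
  by apply: measurable_indic; exact: mstepi.
have stepE n x : (0 < n)%N -> `|f x - step n x| <= n%:R^-1.
  move=> n0; rewrite (_ : step n x = \sum_(i < (n.+1).*2) ((i%:R - n.+1%:R) / n%:R) *
    (i%:R - n.+1%:R <= n%:R * f x < i%:R - n%:R)%R%:R); first exact: floor_step.
  apply: eq_bigr => i _; congr (_ * _); rewrite indicE; congr (_%:R).
  by apply: congr1; apply/idP/idP; rewrite inE.
have bstep n : (0 < n)%N -> forall x, `|step n x| <= 2.
  move=> n0 x; have := stepE n x n0; have := f1 x.
  have : (n%:R^-1 : R) <= 1 by rewrite invf_le1 ?ltr0n// ler1n.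
  rewrite [X in _ -> _ -> _ -> `|X| <= _](_ : step n x = f x - (f x - step n x)); last by ring.
  move=> a b c.
  by apply: le_trans (ler_normB _ _) _; lra.
have stepP n : (0 < n)%N ->
    Ex P (fun t => step n (Y t) * Z t) = Ex P (step n \o Y) * Ex P Z.
  move=> n0.
  have I1 i : Intg P (fun t => \1_[set x | (i%:R - n.+1%:R <= n%:R * f x < i%:R - n%:R)] (Y t) * Z t).
    apply: (@Intg_bounded _ _ _ _ _ 1) => [|t].
      by apply: measurable_funM => //; apply: measurableT_comp => //; apply: measurable_indic; exact: mstepi.
    by rewrite normrM mulr_ile1// indicE; case: (_ \in _); rewrite ?normr1 ?normr0.
  have I2 i : Intg P (fun t => \1_[set x | (i%:R - n.+1%:R <= n%:R * f x < i%:R - n%:R)] (Y t)).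
    apply: (@Intg_bounded _ _ _ _ _ 1) => [|t].
      by apply: measurableT_comp => //; apply: measurable_indic; exact: mstepi.
    by rewrite indicE; case: (_ \in _); rewrite ?normr1 ?normr0.
  under eq_fun do rewrite /step mulr_suml.
  under eq_fun do under eq_bigr do rewrite -(mulrA (_ / _)).
  rewrite Ex_sum; last by move=> i; exact: (IntgZ _ (I1 i)).
  rewrite (_ : step n \o Y = fun t => \sum_(i < (n.+1).*2) ((i%:R - n.+1%:R) / n%:R) *
    \1_[set x | (i%:R - n.+1%:R <= n%:R * f x < i%:R - n%:R)] (Y t))//.
  rewrite [X in _ = X * _]Ex_sum; last by move=> i; exact: (IntgZ _ (I2 i)).
  rewrite mulr_suml; apply: eq_bigr => i _.
  rewrite ExZ// YZ// [in RHS]ExZ// -mulrA; congr (_ * (_ * _)).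
  by rewrite -Ex_indic//; rewrite -[V in measurable V]setTI; exact: mY.
have If : Intg P (fun t => f (Y t) * Z t).
  apply: (@Intg_bounded _ _ _ _ _ 1) => [|t]; last by rewrite normrM mulr_ile1.
  by apply: measurable_funM => //; exact: measurableT_comp.
have If' : Intg P (f \o Y).
  by apply: (@Intg_bounded _ _ _ _ _ 1) => [|t]; [exact: measurableT_comp|exact: f1].
apply/eqP; rewrite -subr_eq0 -normr_le0; apply/ler_addgt0Pl => e e0.
rewrite addr0.
(* Replacing [f] by [step n] costs at most 1/n on each side of the identity, hence the 2. *)
pose n := (Num.truncn (2 / e)).+1.
have ne : 2 / n%:R < e.
  rewrite ltr_pdivrMr ?ltr0n// mulrC -ltr_pdivrMr//.
  by rewrite /n; apply: truncnS_gt.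
have n0 : (0 < n)%N by [].
apply: le_trans (ltW ne).
rewrite (_ : _ - _ = Ex P (fun t => (f (Y t) - step n (Y t)) * Z t)
   - Ex P (fun t => f (Y t) - step n (Y t)) * Ex P Z); last first.
  have J1 : Intg P (fun t => step n (Y t)).
    by apply: (@Intg_bounded _ _ _ _ _ 2) => [|t]; [exact: measurableT_comp|exact: bstep].
  have J2 : Intg P (fun t => step n (Y t) * Z t).
    apply: (@Intg_bounded _ _ _ _ _ (2 * 1)) => [|t].
      by apply: measurable_funM => //; exact: measurableT_comp.
    by rewrite normrM ler_pM// bstep.
  under [in RHS]eq_fun do rewrite mulrBl.
  by rewrite ExB// ExB// stepP//= mulrBl; ring.
apply: le_trans (ler_normB _ _) _.
rewrite (_ : 2 / n%:R = n%:R^-1 + n%:R^-1 * 1); last by ring.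
have mfs : measurable_fun setT (fun t => f (Y t) - step n (Y t)).
  by apply: measurable_funB; exact: measurableT_comp.
apply: lerD.
  apply: Ex_norm_cst => [|t]; first exact: measurable_funM.
  by rewrite normrM -[leRHS]mulr1 ler_pM// stepE.
rewrite normrM ler_pM//; first by apply: Ex_norm_cst => // t; exact: stepE.
exact: Ex_norm_cst.
Qed.

Hypothesis indepX : indep_family.

Lemma Ex_prod_indic (s : seq I) (B : I -> set S) :
  uniq s -> (forall p, measurable (B p)) ->
  Ex P (fun t => \prod_(p <- s) \1_(B p) (X p t)) =
  \prod_(p <- s) fine (P (X p @^-1` B p)).
Proof.
move=> us mB.
rewrite (_ : (fun t => _) = \1_(\bigcap_(p in [set` s]) (X p @^-1` B p))); last first.
  apply/funext => t; rewrite indicE; case: (boolP (t \in _)) => [|].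
    rewrite inE => tB; rewrite big_seq big1// => p ps.
    by rewrite indicE mem_set//; exact: tB.
  rewrite notin_setE => tB; apply/eqP; rewrite prodf_seq_eq0; apply: contrapT => /negP/hasPn H.
  apply: tB => p /= ps; have /= := H p ps; rewrite indicE pnatr_eq0 eqb0 negbK.
  by rewrite inE.
rewrite Ex_indic; last first.
  rewrite bigcap_seq; apply: bigsetI_measurable => p _; exact: measurable_preimage.
rewrite indepX//; elim: (s) => [|p l IH]; first by rewrite !big_nil.
have fP q : P (X q @^-1` B q) \is a fin_num by apply: (fin_num_measure P); exact: measurable_preimage.
rewrite !big_cons -IH fineM//.
elim: (l) => [|q l' IH']; first by rewrite big_nil.
by rewrite big_cons fin_numM.
Qed.

(** Induction on [s2], replacing indicators by bounded functions one index at a time. By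
    [Ex_mul_simple] the head of [s2] may itself be taken to be an indicator, and then it joins [s1];
    this is why indicators and functions are mixed and [B] is general. *)
Lemma Ex_prod_mixed (s2 s1 : seq I) (B : I -> set S) (f : I -> S -> R) :
  uniq (s1 ++ s2) -> (forall p, measurable (B p)) ->
  (forall p, measurable_fun setT (f p)) -> (forall p x, `|f p x| <= 1) ->
  Ex P (fun t => (\prod_(p <- s1) \1_(B p) (X p t)) * \prod_(p <- s2) f p (X p t)) =
  (\prod_(p <- s1) fine (P (X p @^-1` B p))) * \prod_(p <- s2) Ex P (f p \o X p).
Proof.
have i1 (A : set S) x : `|(\1_A x : R)| <= 1.
  by rewrite indicE; case: (_ \in _); rewrite ?normr1 ?normr0.
move=> + + mf f1; elim: s2 s1 B => [|p s2 IH] s1 B us mB.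
  rewrite cats0 in us; rewrite big_nil mulr1 -Ex_prod_indic//.
  by congr (Ex P _); apply/funext => t; rewrite big_nil mulr1.
have ps1 : p \notin s1.
  by move: us; rewrite cat_uniq/= => /and3P[_ /norP[] //].
have us12 : uniq (s1 ++ s2).
  by move: us; rewrite !cat_uniq/= => /and3P[-> /norP[_ ->] /andP[_ ->]].
pose Z t := (\prod_(q <- s1) \1_(B q) (X q t)) * \prod_(q <- s2) f q (X q t).
rewrite (_ : (fun t => _) = fun t => f p (X p t) * Z t); last first.
  by apply/funext => t; rewrite big_cons /Z mulrCA.
have m1 q : measurable_fun setT (\1_(B q) : S -> R) by exact: measurable_indic.
rewrite (Ex_mul_simple (mX p))//; first last.
- move=> C mC.
  pose B' q := if q == p then C else B q.
  have mB' q : measurable (B' q) by rewrite /B'; case: ifP.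
  have BB' : {in s1, B' =1 B}.
    by move=> q qs1; rewrite /B'; case: eqP => // qp; rewrite qp (negbTE ps1) in qs1.
  have := IH (p :: s1) B' _ mB'; rewrite cat_cons /= => H.
  rewrite [X in _ = _ * X]IH//.
  transitivity (Ex P (fun t => (\prod_(q <- p :: s1) \1_(B' q) (X q t)) * \prod_(q <- s2) f q (X q t))).
    congr (Ex P _); apply/funext => t; rewrite big_cons /Z mulrA {1}/B' eqxx.
    by congr (_ * _ * _); apply: eq_big_seq => q qs1; rewrite BB'.
  rewrite H; last first.
    by rewrite us12 andbT mem_cat negb_or ps1; move: us; rewrite cat_uniq/= => /and4P[].
  rewrite big_cons {1}/B' eqxx -mulrA; congr (_ * (_ * _)).
  by apply: eq_big_seq => q qs1; rewrite BB'.
- move=> t; rewrite normrM mulr_ile1//; last exact: prod_norm_le1.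
  exact: (@prod_norm_le1 s1 (fun q => \1_(B q))).
- apply: measurable_funM; last exact: measurable_prod_comp.
  exact: (@measurable_prod_comp s1 (fun q => \1_(B q))).
by rewrite /Z IH// big_cons mulrCA.
Qed.

Lemma Ex_prod (s : seq I) (f : I -> S -> R) :
  uniq s -> (forall p, measurable_fun setT (f p)) -> (forall p x, `|f p x| <= 1) ->
  Ex P (fun t => \prod_(p <- s) f p (X p t)) = \prod_(p <- s) Ex P (f p \o X p).
Proof.
move=> us mf f1; have := @Ex_prod_mixed s [::] (fun=> set0) f us (fun=> measurable0) mf f1.
by rewrite big_nil mul1r => <-; congr (Ex P _); apply/funext => t; rewrite big_nil mul1r.
Qed.

(** The addition formulas split off a factor cos or sin of [g p (X p t)], bounded by 1, which can be
    absorbed in the product over [l]. They exchange cosines and sines, so both statements are proved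
    together. *)
Lemma Ex_cos_sum_mul (s l : seq I) (g f : I -> S -> R) :
  uniq (s ++ l) -> (forall p, measurable_fun setT (g p)) ->
  (forall p, measurable_fun setT (f p)) -> (forall p x, `|f p x| <= 1) ->
  Ex P (fun t => cos (\sum_(p <- s) g p (X p t)) * \prod_(p <- l) f p (X p t)) =
  Ex P (fun t => cos (\sum_(p <- s) g p (X p t))) * \prod_(p <- l) Ex P (f p \o X p) /\
  Ex P (fun t => sin (\sum_(p <- s) g p (X p t)) * \prod_(p <- l) f p (X p t)) =
  Ex P (fun t => sin (\sum_(p <- s) g p (X p t))) * \prod_(p <- l) Ex P (f p \o X p).
Proof.
move=> + mg; elim: s l f => [|p s IH] l f us mf f1.
  rewrite (_ : (fun t => cos _ * _) = fun t => \prod_(p <- l) f p (X p t)); last first.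
    by apply/funext => t; rewrite big_nil cos0 mul1r.
  rewrite (_ : (fun t => cos _) = cst 1); last first.
    by apply/funext => t; rewrite big_nil cos0.
  rewrite (_ : (fun t => sin _ * _) = cst 0); last first.
    by apply/funext => t; rewrite big_nil sin0 mul0r.
  rewrite (_ : (fun t => sin _) = cst 0); last first.
    by apply/funext => t; rewrite big_nil sin0.
  by rewrite !Ex_cst mul1r mul0r Ex_prod.
have pl : p \notin l.
  by move: us; rewrite /= mem_cat negb_or => /andP[/andP[]].
have usl : uniq (s ++ p :: l).
  by rewrite (perm_uniq (_ : perm_eq _ (p :: s ++ l)))// perm_catC/= perm_cons perm_catC.
have usl0 : uniq (s ++ l) by move: us => /= /andP[].
have usp : uniq (s ++ [:: p]).
  by move: us; rewrite cats1 rcons_uniq /= mem_cat negb_or cat_uniq => /andP[/andP[-> _] /and3P[->]].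
pose h (k : R -> R) (f : I -> S -> R) q x := if q == p then k (g p x) else f q x.
have mh (k : R -> R) (f' : I -> S -> R) : measurable_fun setT k -> (forall q, measurable_fun setT (f' q)) ->
    forall q, measurable_fun setT (h k f' q).
  by move=> mk mf' q; rewrite /h; case: eqP => // _; exact: measurableT_comp.
have h1 (k : R -> R) (f' : I -> S -> R) : (forall x, `|k x| <= 1) -> (forall q x, `|f' q x| <= 1) ->
    forall q x, `|h k f' q x| <= 1.
  by move=> k1 f'1 q x; rewrite /h; case: eqP.
have hl k f' t : \prod_(q <- l) h k f' q (X q t) = \prod_(q <- l) f' q (X q t).
  by apply: eq_big_seq => q ql; rewrite /h; case: eqP => // qp; rewrite -qp ql in pl.
have hEl k f' : \prod_(q <- l) Ex P (h k f' q \o X q) = \prod_(q <- l) Ex P (f' q \o X q).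
  apply: eq_big_seq => q ql; congr (Ex P _); apply/funext => x /=; rewrite /h.
  by case: eqP => // qp; rewrite -qp ql in pl.
have hp k f' t : h k f' p (X p t) = k (g p (X p t)) by rewrite /h eqxx.
have hEp k f' : Ex P (h k f' p \o X p) = Ex P (fun t => k (g p (X p t))).
  by congr (Ex P _); apply/funext => t; exact: hp.
have mcos : measurable_fun setT (cos : R -> R) by apply: continuous_measurable_fun; exact: continuous_cos.
have msin : measurable_fun setT (sin : R -> R) by apply: continuous_measurable_fun; exact: continuous_sin.
(* The case [l' = [::]] serves to recognise the expansion obtained for [l] as the expectation of the
   cosine (sine) of the longer sum. *)
have key (k : R -> R) : measurable_fun setT k -> (forall x, `|k x| <= 1) ->
   forall (l' : seq I) , l' = l \/ l' = [::] ->
   Ex P (fun t => cos (\sum_(q <- s) g q (X q t)) * (k (g p (X p t)) * \prod_(q <- l') f q (X q t))) =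
   Ex P (fun t => cos (\sum_(q <- s) g q (X q t))) * (Ex P (fun t => k (g p (X p t))) * \prod_(q <- l') Ex P (f q \o X q)) /\
   Ex P (fun t => sin (\sum_(q <- s) g q (X q t)) * (k (g p (X p t)) * \prod_(q <- l') f q (X q t))) =
   Ex P (fun t => sin (\sum_(q <- s) g q (X q t))) * (Ex P (fun t => k (g p (X p t))) * \prod_(q <- l') Ex P (f q \o X q)).
  move=> mk k1 l' [->|->].
    have := IH (p :: l) (h k f) usl (mh k f mk mf) (h1 k f k1 f1).
    rewrite big_cons hEl hEp => -[<- <-]; split; congr (Ex P _); apply/funext => t;
    by rewrite big_cons hl hp.
  have := IH [:: p] (h k f) usp (mh k f mk mf) (h1 k f k1 f1).
  rewrite !big_cons !big_nil hEp => -[<- <-]; split; congr (Ex P _); apply/funext => t;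
  by rewrite big_cons !big_nil hp.
have cosP := key cos mcos (@cos_max _); have sinP := key sin msin (@sin_max _).
have mS : measurable_fun setT (fun t => \sum_(q <- s) g q (X q t)).
  by apply: measurable_sum => q; exact: measurableT_comp.
have Ib (k1 k2 : R -> R) (l' : seq I) : measurable_fun setT k1 -> measurable_fun setT k2 ->
   (forall x, `|k1 x| <= 1) -> (forall x, `|k2 x| <= 1) ->
   Intg P (fun t => k1 (\sum_(q <- s) g q (X q t)) * (k2 (g p (X p t)) * \prod_(q <- l') f q (X q t))).
  move=> mk1 mk2 k11 k21; apply: (@Intg_bounded _ _ _ _ _ 1) => [|t].
    apply: measurable_funM; first exact: measurableT_comp.
    apply: measurable_funM; last exact: measurable_prod_comp.
    by apply: measurableT_comp => //; exact: measurableT_comp.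
  by rewrite normrM mulr_ile1// normrM mulr_ile1//; exact: prod_norm_le1.
have expand (l' : seq I) : l' = l \/ l' = [::] ->
   Ex P (fun t => cos (\sum_(q <- p :: s) g q (X q t)) * \prod_(q <- l') f q (X q t)) =
   (Ex P (fun t => cos (\sum_(q <- s) g q (X q t))) * Ex P (fun t => cos (g p (X p t)))
   - Ex P (fun t => sin (\sum_(q <- s) g q (X q t))) * Ex P (fun t => sin (g p (X p t))))
     * \prod_(q <- l') Ex P (f q \o X q) /\
   Ex P (fun t => sin (\sum_(q <- p :: s) g q (X q t)) * \prod_(q <- l') f q (X q t)) =
   (Ex P (fun t => sin (\sum_(q <- s) g q (X q t))) * Ex P (fun t => cos (g p (X p t)))
   + Ex P (fun t => cos (\sum_(q <- s) g q (X q t))) * Ex P (fun t => sin (g p (X p t))))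
     * \prod_(q <- l') Ex P (f q \o X q).
  move=> l'l; have [c1 c2] := cosP _ l'l; have [s1 s2] := sinP _ l'l; split.
    rewrite mulrBl -!mulrA -c1 -s2 -ExB; [|exact: Ib (@cos_max _) (@cos_max _)|exact: Ib (@sin_max _) (@sin_max _)].
    by congr (Ex P _); apply/funext => t; rewrite big_cons cosD; ring.
  rewrite mulrDl -!mulrA -c2 -s1 -ExD; [|exact: Ib (@sin_max _) (@cos_max _)|exact: Ib (@cos_max _) (@sin_max _)].
  by congr (Ex P _); apply/funext => t; rewrite big_cons sinD; ring.
have [e1 e2] := expand l (or_introl erefl); have [d1 d2] := expand [::] (or_intror erefl).
rewrite e1 e2; split; congr (_ * _).
  transitivity (Ex P (fun t => cos (\sum_(q <- p :: s) g q (X q t)) * \prod_(q <- [::]) f q (X q t))).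
    by rewrite d1 big_nil mulr1.
  by congr (Ex P _); apply/funext => t; rewrite big_nil mulr1.
transitivity (Ex P (fun t => sin (\sum_(q <- p :: s) g q (X q t)) * \prod_(q <- [::]) f q (X q t))).
  by rewrite d2 big_nil mulr1.
by congr (Ex P _); apply/funext => t; rewrite big_nil mulr1.
Qed.

Lemma Ex_cos_sum_cons (p : I) (s : seq I) (g : I -> S -> R) :
  uniq (p :: s) -> (forall p, measurable_fun setT (g p)) ->
  Ex P (fun t => cos (\sum_(q <- p :: s) g q (X q t))) =
   Ex P (fun t => cos (\sum_(q <- s) g q (X q t))) * Ex P (fun t => cos (g p (X p t)))
   - Ex P (fun t => sin (\sum_(q <- s) g q (X q t))) * Ex P (fun t => sin (g p (X p t))).
Proof.
move=> us mg.
have usp : uniq (s ++ [:: p]) by rewrite cats1 rcons_uniq.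
have mcos : measurable_fun setT (cos : R -> R) by apply: continuous_measurable_fun; exact: continuous_cos.
have msin : measurable_fun setT (sin : R -> R) by apply: continuous_measurable_fun; exact: continuous_sin.
have mS : measurable_fun setT (fun t => \sum_(q <- s) g q (X q t)).
  by apply: measurable_sum => q; exact: measurableT_comp.
have mgp : measurable_fun setT (fun t => g p (X p t)) by exact: measurableT_comp.
have Ib (k1 k2 : R -> R) : measurable_fun setT k1 -> measurable_fun setT k2 ->
   (forall x, `|k1 x| <= 1) -> (forall x, `|k2 x| <= 1) ->
   Intg P (fun t => k1 (\sum_(q <- s) g q (X q t)) * k2 (g p (X p t))).
  move=> mk1 mk2 k11 k21; apply: (@Intg_bounded _ _ _ _ _ 1) => [|t].
    by apply: measurable_funM; exact: measurableT_comp.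
  by rewrite normrM mulr_ile1.
transitivity (Ex P (fun t => cos (\sum_(q <- s) g q (X q t)) * cos (g p (X p t)) -
    sin (\sum_(q <- s) g q (X q t)) * sin (g p (X p t)))).
  by congr (Ex P _); apply/funext => t; rewrite big_cons addrC cosD.
rewrite ExB; [|exact: Ib (@cos_max _) (@cos_max _)|exact: Ib (@sin_max _) (@sin_max _)]; congr (_ - _).
  have [+ _] := @Ex_cos_sum_mul s [:: p] g (fun q x => cos (g q x)) usp mg
    (fun q => measurableT_comp mcos (mg q)) (fun q x => cos_max _).
  rewrite big_seq1 => <-.
  by congr (Ex P _); apply/funext => t; rewrite big_seq1.
have [_] := @Ex_cos_sum_mul s [:: p] g (fun q x => sin (g q x)) usp mg
  (fun q => measurableT_comp msin (mg q)) (fun q x => sin_max _).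
rewrite big_seq1 => <-.
by congr (Ex P _); apply/funext => t; rewrite big_seq1.
Qed.

(** One variable is exchanged at a time. All cosine, sine and exponential factors have modulus at
    most 1, so the errors add up, and the sine terms are simply counted as errors. *)
Lemma Ex_cos_sum_exp (s : seq I) (g : I -> S -> R) (v a b : I -> R) :
  uniq s -> (forall p, measurable_fun setT (g p)) -> (forall p, 0 <= v p) ->
  (forall p, `|Ex P (fun t => cos (g p (X p t))) - expR (- v p)| <= a p) ->
  (forall p, `|Ex P (fun t => sin (g p (X p t)))| <= b p) ->
  `|Ex P (fun t => cos (\sum_(q <- s) g q (X q t))) - expR (- \sum_(q <- s) v q)|
     <= \sum_(q <- s) (a q + b q).
Proof.
move=> + mg v0 Ha Hb; elim: s => [_|p s IH us].
  under eq_fun do rewrite big_nil cos0.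
  by rewrite !big_nil oppr0 expR0 Ex_cst subrr normr0.
have us' : uniq s by case/andP: us.
rewrite Ex_cos_sum_cons// !big_cons opprD expRD.
have mS : measurable_fun setT (fun t => \sum_(q <- s) g q (X q t)).
  by apply: measurable_sum => q; exact: measurableT_comp.
set C := Ex P _; set c := Ex P _; set D := Ex P _; set d := Ex P _.
set V := \sum_(_ <- _) _.
have C1 : `|C| <= 1.
  apply: Ex_norm_cst => [|t]; last exact: cos_max.
  by apply: measurableT_comp => //; apply: continuous_measurable_fun; exact: continuous_cos.
have D1 : `|D| <= 1.
  apply: Ex_norm_cst => [|t]; last exact: sin_max.
  by apply: measurableT_comp => //; apply: continuous_measurable_fun; exact: continuous_sin.
rewrite (_ : _ - _ = C * (c - expR (- v p)) - D * d + expR (- v p) * (C - expR (- V))); last by ring.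
apply: le_trans (ler_normD _ _) _; apply: lerD.
  apply: le_trans (ler_normB _ _) _; apply: lerD.
    by rewrite normrM -[leRHS]mul1r; apply: ler_pM => //; exact: Ha.
  by rewrite normrM -[leRHS]mul1r; apply: ler_pM => //; exact: Hb.
rewrite normrM -[leRHS]mul1r; apply: ler_pM => //; last exact: IH.
by rewrite ger0_norm ?expR_ge0// expR_le1 oppr_le0.
Qed.

End product_rule.

(** * Characteristic functions of arrays of independent variables *)

Section trigonometric_bounds.
Context {R : realType}.
Implicit Types x : R.

Lemma ge0_from_derive (f df : R -> R) : (forall x, is_derive x 1 f (df x)) ->
  (forall x, 0 <= x -> 0 <= df x) -> f 0 = 0 -> forall x, 0 <= x -> 0 <= f x.
Proof.
move=> fdf df0 f0 x x0.
have cf : {within `[0, x], continuous f}.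
  apply: continuous_subspaceT => z; apply/differentiable_continuous/derivable1_diffP.
  exact: ex_derive.
have [c + E] := MVT_segment x0 (fun z _ => fdf z) cf.
rewrite in_itv/= => /andP[c0 _].
by move: E; rewrite f0 !subr0 => ->; rewrite mulr_ge0 ?df0.
Qed.

Lemma sin_le_id x : 0 <= x -> sin x <= x.
Proof.
move=> x0; rewrite -subr_ge0; move: x x0.
apply: (@ge0_from_derive (fun x => x - sin x) (fun x => 1 - cos x)).
- by move=> x _; rewrite subr_ge0 cos_le1.
- by rewrite sin0 subrr.
Qed.

Lemma cos_ge_quadratic x : 1 - x ^+ 2 / 2 <= cos x.
Proof.
wlog x0 : x / 0 <= x.
  move=> H; case: (leP 0 x) => [|/ltW x0]; first exact: H.
  by rewrite -cosN -sqrrN H// oppr_ge0.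
rewrite -subr_ge0; move: x x0.
apply: (@ge0_from_derive (fun x => cos x - (1 - x ^+ 2 / 2)) (fun x => x - sin x)).
- move=> x; apply: is_derive_eq.
  by rewrite /GRing.scale /= ; field.
- by move=> x x0; rewrite subr_ge0 sin_le_id.
- by rewrite cos0; ring.
Qed.

Lemma sin_ge_cubic x : 0 <= x -> x - x ^+ 3 <= sin x.
Proof.
move=> x0; rewrite -subr_ge0; move: x x0.
apply: (@ge0_from_derive (fun x => sin x - (x - x ^+ 3)) (fun x => cos x - (1 - 3 * x ^+ 2))).
- move=> x; apply: is_derive_eq.
  by rewrite /GRing.scale /=; ring.
- by move=> x x0; have := cos_ge_quadratic x; have := sqr_ge0 x; lra.
- by rewrite sin0; ring.
Qed.

Lemma norm_sin_le x : `|sin x| <= `|x|.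
Proof.
wlog x0 : x / 0 <= x.
  move=> H; case: (leP 0 x) => [|/ltW x0]; first exact: H.
  by rewrite -normrN -sinN -[leRHS]normrN H// oppr_ge0.
rewrite (ger0_norm x0) ler_norml sin_le_id// andbT.
have [x1|x1] := leP x 1.
  have := sin_ge_cubic x0; nra.
by have := sin_geN1 x; lra.
Qed.

(** The cubic bound serves small arguments; the linear one keeps expectations finite when few
    moments exist. [norm_cos_sub_le] has the same two regimes. *)
Lemma norm_sin_sub_le x : `|sin x - x| <= Num.min (`|x| ^+ 3) (2 * `|x|).
Proof.
rewrite le_min; apply/andP; split; last first.
  by apply: le_trans (ler_normB _ _) _; have := norm_sin_le x; lra.
wlog x0 : x / 0 <= x.
  move=> H; case: (leP 0 x) => [|/ltW x0]; first exact: H.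
  by have := H (- x); rewrite oppr_ge0 x0 sinN -opprD !normrN; apply.
rewrite (ger0_norm x0) distrC ger0_norm ?subr_ge0 ?sin_le_id//.
by have := sin_ge_cubic x0; lra.
Qed.

Lemma cosE_half x : cos x = 1 - 2 * sin (x / 2) ^+ 2.
Proof.
by rewrite [in LHS](_ : x = (x / 2) *+ 2) ?cos_mulr2n ?cos2sin2; rewrite mulr2n; [ring|field].
Qed.

Lemma norm_cos_sub_le x : `|cos x - 1 + x ^+ 2 / 2| <= Num.min (`|x| ^+ 3) (x ^+ 2).
Proof.
have c1 := cos_le1 x; have c2 := cos_ge_quadratic x; have x2 := sqr_ge0 x.
rewrite ger0_norm ?le_min; last by lra.
apply/andP; split; last by lra.
have [x1|x1] := leP `|x| 1; last first.
  by have : x ^+ 2 <= `|x| ^+ 3; [rewrite -real_normK ?num_real// ler_eXn2l//; lra|lra].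
rewrite cosE_half.
set u := x / 2; have xu : x = 2 * u by rewrite /u; field.
rewrite xu normrM (ger0_norm (ler0n _ 2)) in x1 *.
have := norm_sin_sub_le u; rewrite le_min => /andP[h1 _].
have h2 := norm_sin_le u.
rewrite (_ : _ + _ = 2 * ((u - sin u) * (u + sin u))); last by field.
have h3 : `|(u - sin u) * (u + sin u)| <= `|u| ^+ 3 * (2 * `|u|).
  rewrite normrM distrC ler_pM//; apply: le_trans (ler_normD _ _) _; lra.
have h4 := ler_norm ((u - sin u) * (u + sin u)).
have u0 : 0 <= `|u| by [].
have u3 : 0 <= `|u| ^+ 3 by rewrite exprn_ge0.
rewrite exprMn; nra.
Qed.

Lemma expRN_expansion x : 0 <= x -> `|expR (- x) - 1 + x| <= x ^+ 2.
Proof.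
move=> x0; have h1 := expR_ge1Dx (- x).
rewrite ger0_norm; last by lra.
have h2 : expR (- x) <= (1 + x)^-1.
  by rewrite expRN lef_pV2 ?posrE ?expR_gt0 ?expR_ge1Dx//; lra.
apply: (@le_trans _ _ ((1 + x)^-1 - 1 + x)); first by lra.
rewrite (_ : _ + x = x ^+ 2 / (1 + x)); last by field; lra.
by rewrite ler_pdivrMr ?ler_peMr ?sqr_ge0//; lra.
Qed.

End trigonometric_bounds.

Lemma measurable_cosine {R : realType} : measurable_fun setT (cos : R -> R).
Proof. by apply: continuous_measurable_fun; exact: continuous_cos. Qed.

Lemma measurable_sine {R : realType} : measurable_fun setT (sin : R -> R).
Proof. by apply: continuous_measurable_fun; exact: continuous_sin. Qed.


Section characteristic_expansion.
Context {R : realType} {dT : measure_display} {T : measurableType dT}.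
Variables (P : probability T R) (Y : T -> R).
Hypothesis mY : measurable_fun setT Y.

Let mcosY (c : R) : measurable_fun setT (fun t => cos (c * Y t)).
Proof.
by apply: measurableT_comp; [exact: measurable_cosine|exact: measurable_funM].
Qed.

Let msinY (c : R) : measurable_fun setT (fun t => sin (c * Y t)).
Proof.
by apply: measurableT_comp; [exact: measurable_sine|exact: measurable_funM].
Qed.

Let IcosY c : Intg P (fun t => cos (c * Y t)).
Proof. by apply: Intg_bounded => // t; exact: cos_max. Qed.

Let IsinY c : Intg P (fun t => sin (c * Y t)).
Proof. by apply: Intg_bounded => // t; exact: sin_max. Qed.

(** Plays the part of Lindeberg's truncation: the integrand tends to 0 with [c] and is dominated by
    the p-th power, so no moment of order p + 1 enters. *)
Lemma Ex_min_cvg0 (p : nat) : Intg P (fun t => `|Y t| ^+ p) ->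
  forall e, 0 < e -> exists2 d : R, 0 < d &
    forall c : R, `|c| < d -> Ex P (fun t => Num.min (`|Y t| ^+ p) (`|c| * `|Y t| ^+ p.+1)) <= e.
Proof.
move=> IY e e0.
have mmin (c : R) : measurable_fun setT (fun t => Num.min (`|Y t| ^+ p) (`|c| * `|Y t| ^+ p.+1)).
  have mp n : measurable_fun setT (fun t => `|Y t| ^+ n).
    by apply: measurable_funX; exact: measurableT_comp.
  by apply: measurable_minr => //; exact: measurable_funM.
have min0 (c : R) t : 0 <= Num.min (`|Y t| ^+ p) (`|c| * `|Y t| ^+ p.+1).
  by rewrite le_min exprn_ge0//= mulr_ge0// exprn_ge0.
have Imin (c : R) : Intg P (fun t => Num.min (`|Y t| ^+ p) (`|c| * `|Y t| ^+ p.+1)).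
  by apply: (Intg_le (mmin c) IY) => t; rewrite ger0_norm// ge_min lexx.
have : (fun n : nat => Ex P (fun t => Num.min (`|Y t| ^+ p) (`|(n.+1%:R^-1 : R)| * `|Y t| ^+ p.+1))) @ \oo --> Ex P (cst 0).
  apply: Ex_dominated IY _ _ => // [t|n t]; last by rewrite ger0_norm// ge_min lexx.
  apply: (@squeeze_cvgr _ _ _ _ (cst 0) (fun n => `|(n.+1%:R^-1 : R)| * `|Y t| ^+ p.+1)).
  - by apply: nearW => n; rewrite min0 ge_min lexx orbT.
  - exact: cvg_cst.
  - rewrite -(mul0r (`|Y t| ^+ p.+1)); apply: cvgMr_tmp; rewrite -[X in _ --> X](@normr0 _ R).
    by apply: cvg_norm; exact: cvg_harmonic.
rewrite Ex_cst => /cvgrPdist_le /(_ _ e0) [n _ /(_ n (leqnn _))].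
rewrite /= sub0r normrN ger0_norm; last exact: Ex_ge0.
(* The integrand is monotone in the modulus of [c], so a single value of the sequence 1/(n+1)
   controls all smaller ones. *)
move=> H; exists n.+1%:R^-1 => // c cn; apply: le_trans H; apply: Ex_le => // t.
rewrite le_min ge_min lexx/= ge_min; apply/orP; right.
by rewrite ler_wpM2r ?exprn_ge0// [leRHS]ger0_norm// ltW.
Qed.

Lemma cos_sin_expansion2 : Intg P Y -> Intg P (fun t => Y t ^+ 2) -> Ex P Y = 0 ->
  forall e, 0 < e -> exists2 d : R, 0 < d & forall c : R, `|c| < d ->
    `|Ex P (fun t => cos (c * Y t)) - expR (- (c ^+ 2 * Ex P (fun t => Y t ^+ 2) / 2))| <= e * c ^+ 2 /\
    `|Ex P (fun t => sin (c * Y t))| <= e * c ^+ 2.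
Proof.
move=> IY IY2 EY e e0.
set v := Ex P (fun t => Y t ^+ 2).
have v0 : 0 <= v by apply: Ex_ge0 => t; exact: sqr_ge0.
have IY2' : Intg P (fun t => `|Y t| ^+ 2).
  by under eq_fun do rewrite real_normK ?num_real//.
have e4 : 0 < e / 4 by rewrite divr_gt0.
have [d1 d10 H1] := Ex_min_cvg0 IY2' e4.
(* Forces c^2 v^2 <= e, which bounds the quadratic remainder of the exponential by a multiple of e
   c^2. *)
pose d2 := Num.min 1 (e / (v ^+ 2 + 1)).
exists (Num.min d1 d2).
  by rewrite lt_min d10/= /d2 lt_min ltr01/= divr_gt0// ltr_wpDl// sqr_ge0.
move=> c; rewrite !lt_min => /andP[cd1 /andP[c1 c2]].
have {H1} := H1 c cd1; set M := Ex P _ => HM.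
have mmin : measurable_fun setT (fun t => Num.min (`|Y t| ^+ 2) (`|c| * `|Y t| ^+ 3)).
  have mp n : measurable_fun setT (fun t => `|Y t| ^+ n).
    by apply: measurable_funX; exact: measurableT_comp.
  by apply: measurable_minr => //; exact: measurable_funM.
have Imin : Intg P (fun t => Num.min (`|Y t| ^+ 2) (`|c| * `|Y t| ^+ 3)).
  have min0 t : 0 <= Num.min (`|Y t| ^+ 2) (`|c| * `|Y t| ^+ 3).
    by rewrite le_min exprn_ge0//= mulr_ge0// exprn_ge0.
  by apply: (Intg_le mmin IY2') => t; rewrite ger0_norm// ge_min lexx.
have c20 : 0 <= c ^+ 2 by exact: sqr_ge0.
have Bc t : `|cos (c * Y t) - 1 + c ^+ 2 / 2 * Y t ^+ 2| <= c ^+ 2 * Num.min (`|Y t| ^+ 2) (`|c| * `|Y t| ^+ 3).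
  have := norm_cos_sub_le (c * Y t); rewrite le_min => /andP[h1 h2].
  rewrite (_ : c ^+ 2 / 2 * _ = (c * Y t) ^+ 2 / 2); last by rewrite exprMn; ring.
  have [_|_] := leP (`|Y t| ^+ 2) _.
    by rewrite real_normK ?num_real// -exprMn.
  by rewrite -(real_normK (num_real c)) mulrA -exprSr -exprMn -normrM.
have Bs t : `|sin (c * Y t) - c * Y t| <= 2 * (c ^+ 2 * Num.min (`|Y t| ^+ 2) (`|c| * `|Y t| ^+ 3)).
  have := norm_sin_sub_le (c * Y t); rewrite le_min => /andP[h1 h2].
  have z0 : 0 <= `|c * Y t| by [].
  rewrite -(real_normK (num_real c)); have [_|_] := leP (`|Y t| ^+ 2) _.
    rewrite -exprMn -normrM; have [z1|z1] := leP `|c * Y t| 1.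
      by apply: le_trans h1 _; rewrite exprSr; nra.
    by apply: le_trans h2 _; nra.
  rewrite (_ : `|c| ^+ 2 * (`|c| * `|Y t| ^+ 3) = `|c * Y t| ^+ 3); last by rewrite normrM exprMn; ring.
  apply: le_trans h1 _.
  by have : 0 <= `|c * Y t| ^+ 3 by [rewrite exprn_ge0]; lra.
split.
  have -> : Ex P (fun t => cos (c * Y t)) - expR (- (c ^+ 2 * v / 2)) =
     Ex P (fun t => cos (c * Y t) - 1 + c ^+ 2 / 2 * Y t ^+ 2) - (expR (- (c ^+ 2 * v / 2)) - 1 + c ^+ 2 * v / 2).
    rewrite ExD; [|exact: IntgB (Intg_cst _ _)|exact: IntgZ].
    rewrite ExB ?ExZ//; last exact: Intg_cst.
    by rewrite (Ex_cst _ 1) -/v; ring.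
  apply: le_trans (ler_normB _ _) _.
  have b1 : `|Ex P (fun t => cos (c * Y t) - 1 + c ^+ 2 / 2 * Y t ^+ 2)| <= c ^+ 2 * M.
    rewrite -ExZ//; apply: Ex_norm_le => //; last exact: IntgZ.
    apply: measurable_funD; first exact: measurable_funB.
    by apply: measurable_funM => //; exact: measurable_funX.
  have b2 := @expRN_expansion _ (c ^+ 2 * v / 2) _.
  have {}b2 := b2 ltac:(by rewrite divr_ge0// mulr_ge0).
  have b3 : c ^+ 2 * v ^+ 2 <= e.
    have v21 : 0 < v ^+ 2 + 1 by rewrite ltr_wpDl// sqr_ge0.
    rewrite ltr_pdivlMr// in c2.
    have : c ^+ 2 <= `|c| by rewrite -real_normK ?num_real// expr2 ler_piMr// ltW.
    by have := sqr_ge0 v; have : 0 <= `|c| by []; nra.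
  rewrite (_ : (c ^+ 2 * v / 2) ^+ 2 = c ^+ 2 * (c ^+ 2 * v ^+ 2) / 4) in b2; last by field.
  by nra.
have -> : Ex P (fun t => sin (c * Y t)) = Ex P (fun t => sin (c * Y t) - c * Y t).
  by rewrite ExB ?ExZ ?EY ?mulr0 ?subr0//; exact: IntgZ.
apply: (@le_trans _ _ (2 * (c ^+ 2 * M))); last by nra.
rewrite -ExZ// -ExZ; last exact: IntgZ.
apply: Ex_norm_le => //; last by apply: IntgZ; exact: IntgZ.
by apply: measurable_funB => //; exact: measurable_funM.
Qed.

(** The first-order analogue, for the law of large numbers: only a first moment is available, and
    the errors are o(|c|) instead of o(c^2). *)
Lemma cos_sin_expansion1 : Intg P Y -> Ex P Y = 0 ->
  forall e, 0 < e -> exists2 d : R, 0 < d & forall c : R, `|c| < d ->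
    `|Ex P (fun t => cos (c * Y t)) - 1| <= e * `|c| /\
    `|Ex P (fun t => sin (c * Y t))| <= e * `|c|.
Proof.
move=> IY EY e e0.
have IY' : Intg P (fun t => `|Y t| ^+ 1) by exact: Intg_norm.
have e2 : 0 < e / 2 by rewrite divr_gt0.
have [d d0 H] := Ex_min_cvg0 IY' e2.
exists d => // c cd; have {H} := H c cd; set M := Ex P _ => HM.
have mmin : measurable_fun setT (fun t => Num.min (`|Y t| ^+ 1) (`|c| * `|Y t| ^+ 2)).
  have mp n : measurable_fun setT (fun t => `|Y t| ^+ n).
    by apply: measurable_funX; exact: measurableT_comp.
  by apply: measurable_minr => //; exact: measurable_funM.
have Imin : Intg P (fun t => Num.min (`|Y t| ^+ 1) (`|c| * `|Y t| ^+ 2)).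
  have min0 t : 0 <= Num.min (`|Y t| ^+ 1) (`|c| * `|Y t| ^+ 2).
    by rewrite le_min exprn_ge0//= mulr_ge0// exprn_ge0.
  by apply: (Intg_le mmin IY') => t; rewrite ger0_norm// ge_min lexx.
have c0 : 0 <= `|c| by [].
have Bmin t : `|c| * Num.min (`|Y t| ^+ 1) (`|c| * `|Y t| ^+ 2) =
    Num.min `|c * Y t| (`|c * Y t| ^+ 2).
  by rewrite minr_pMr// expr1 -normrM mulrA -expr2 -exprMn -normrM.
have Bc t : `|cos (c * Y t) - 1| <= 2 * (`|c| * Num.min (`|Y t| ^+ 1) (`|c| * `|Y t| ^+ 2)).
  rewrite Bmin; have := cos_ge_quadratic (c * Y t); have := cos_le1 (c * Y t).
  have := cos_geN1 (c * Y t).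
  rewrite -[(c * Y t) ^+ 2]real_normK ?num_real//; move: (`|c * Y t|) (normr_ge0 (c * Y t)) => z z0.
  by have [z1|z1] := leP z (z ^+ 2) => h1 h2 h3; rewrite ler_norml; apply/andP; split; nra.
have Bs t : `|sin (c * Y t) - c * Y t| <= 2 * (`|c| * Num.min (`|Y t| ^+ 1) (`|c| * `|Y t| ^+ 2)).
  rewrite Bmin; have := norm_sin_sub_le (c * Y t); rewrite le_min => /andP[].
  move: (`|c * Y t|) (normr_ge0 (c * Y t)) => z z0.
  have [z1|z1] := leP z (z ^+ 2) => h1 h2; first by lra.
  apply: le_trans h1 _; have : z <= 1 by nra.
  by rewrite exprSr; have := sqr_ge0 z; nra.
have cM : 2 * (`|c| * M) <= e * `|c| by nra.
split; apply: le_trans cM.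
  have -> : Ex P (fun t => cos (c * Y t)) - 1 = Ex P (fun t => cos (c * Y t) - 1).
    by rewrite ExB// ?(Ex_cst _ 1)//; exact: Intg_cst.
  rewrite -ExZ// -ExZ; last exact: IntgZ.
  apply: Ex_norm_le => //; last by apply: IntgZ; exact: IntgZ.
  exact: measurable_funB.
have -> : Ex P (fun t => sin (c * Y t)) = Ex P (fun t => sin (c * Y t) - c * Y t).
  by rewrite ExB ?ExZ ?EY ?mulr0 ?subr0//; exact: IntgZ.
rewrite -ExZ// -ExZ; last exact: IntgZ.
apply: Ex_norm_le => //; last by apply: IntgZ; exact: IntgZ.
by apply: measurable_funB => //; exact: measurable_funM.
Qed.

End characteristic_expansion.

(** * Central limit theorem and law of large numbers for independent arrays *)

Section independent_arrays.
Context {R : realType} {dT dS : measure_display}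
  {T : measurableType dT} {S : measurableType dS} {k : nat}.
Variables (P : probability T R) (X : 'I_k * nat -> T -> S).
Hypothesis mX : forall p, measurable_fun setT (X p).
Hypothesis indepX : indep_family P X.
Hypothesis identX : forall p B, measurable B ->
  P (X p @^-1` B) = P (X (p.1, 0%N) @^-1` B).

Definition array_index (N : 'I_k -> nat) : seq ('I_k * nat) :=
  [seq (i, j) | i <- index_enum 'I_k, j <- iota 0 (N i)].

Lemma array_index_uniq N : uniq (array_index N).
Proof.
apply: allpairs_uniq_dep => [|i _|[i j] [i' j'] _ _ /= [-> ->]//].
  exact: index_enum_uniq.
exact: iota_uniq.
Qed.

Lemma sum_array_index N (F : 'I_k * nat -> R) :
  \sum_(p <- array_index N) F p = \sum_(i < k) \sum_(j < N i) F (i, nat_of_ord j).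
Proof.
rewrite big_allpairs_dep; apply: eq_bigr => i _.
by rewrite -(big_mkord xpredT (fun j => F (i, j))) /index_iota subn0.
Qed.

(** Common core of the two limit theorems. Each variable of group i contributes the exponent [w i]
    and an error that is small compared with [rho]; as N rho(c) converges, the total error
    vanishes. *)
Lemma Ex_cos_array_cvg (y : 'I_k -> S -> R) (N : 'I_k -> nat -> nat)
    (c : 'I_k -> nat -> R) (w : 'I_k -> R -> R) (rho : R -> R) (b : 'I_k -> R) (V : R) :
  (forall i, measurable_fun setT (y i)) ->
  (forall i z, 0 <= w i z) -> (forall z, 0 <= rho z) ->
  (forall i e, 0 < e -> exists2 d : R, 0 < d & forall z : R, `|z| < d ->
    `|Ex P (fun t => cos (z * y i (X (i, 0%N) t))) - expR (- w i z)| <= e * rho z /\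
    `|Ex P (fun t => sin (z * y i (X (i, 0%N) t)))| <= e * rho z) ->
  (forall i, c i @ \oo --> 0) ->
  (forall i, (fun m => (N i m)%:R * rho (c i m)) @ \oo --> b i) ->
  (fun m => \sum_(i < k) (N i m)%:R * w i (c i m)) @ \oo --> V ->
  (fun m => Ex P (fun t => cos (\sum_(i < k) \sum_(j < N i m) c i m * y i (X (i, nat_of_ord j) t))))
    @ \oo --> expR (- V).
Proof.
move=> my w0 rho0 H c0 Nb NV.
have expV : (fun m => expR (- \sum_(i < k) (N i m)%:R * w i (c i m))) @ \oo --> expR (- V).
  by apply: (@cvg_comp _ _ _ _ expR _ _ _ (cvgN NV)); exact: continuous_expR.
suff D0 : (fun m => Ex P (fun t => cos (\sum_(i < k) \sum_(j < N i m) c i m * y i (X (i, nat_of_ord j) t)))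
     - expR (- \sum_(i < k) (N i m)%:R * w i (c i m))) @ \oo --> 0.
  rewrite -[expR _]add0r; apply: cvg_trans (cvgD D0 expV).
  by apply: near_eq_cvg; apply: nearW => m; rewrite /= addrNK.
apply/cvgr0Pnorm_le => e0 e00.
pose Bd := \sum_(i < k) (`|b i| + 1).
have Bd0 : 0 <= Bd by apply: sumr_ge0 => i _; rewrite addr_ge0.
(* [Bd] eventually bounds the sum of N rho(c) over the groups; cosine and sine errors together then
   cost 2 e Bd <= e0. *)
pose e := e0 / (2 * (Bd + 1)).
have e_0 : 0 < e by rewrite divr_gt0// mulr_gt0// ltr_wpDl.
have Hi : \forall m \near \oo, forall i : 'I_k,
   [/\ `|Ex P (fun t => cos (c i m * y i (X (i, 0%N) t))) - expR (- w i (c i m))| <= e * rho (c i m),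
    `|Ex P (fun t => sin (c i m * y i (X (i, 0%N) t)))| <= e * rho (c i m) &
    (N i m)%:R * rho (c i m) <= `|b i| + 1].
  apply: filter_forall => i; have [d d0 Hd] := H i e e_0.
  have n1 : \forall m \near \oo, `|c i m| < d.
    by have /cvgr0Pnorm_lt/(_ _ d0) := c0 i.
  have n2 : \forall m \near \oo, (N i m)%:R * rho (c i m) <= `|b i| + 1.
    have /cvgrPdist_lt/(_ _ ltr01) := Nb i; apply: filterS => m.
    rewrite distrC => /ltW /(le_trans (ler_norm _)) h.
    by have := ler_norm (b i); lra.
  by apply: filterS2 n1 n2 => m m1 m2; have [] := Hd _ m1; split.
apply: filterS Hi => m Hm.
have E1 : Ex P (fun t => cos (\sum_(i < k) \sum_(j < N i m) c i m * y i (X (i, nat_of_ord j) t))) =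
  Ex P (fun t => cos (\sum_(p <- array_index (N^~ m)) c p.1 m * y p.1 (X p t))).
  by congr (Ex P _); apply/funext => t; rewrite sum_array_index.
have E2 : \sum_(i < k) (N i m)%:R * w i (c i m) = \sum_(p <- array_index (N^~ m)) w p.1 (c p.1 m).
  by rewrite sum_array_index; apply: eq_bigr => i _; rewrite /= sumr_const card_ord mulr_natl.
rewrite E1 E2.
have mcy p : measurable_fun setT (fun x : S => c p.1 m * y p.1 x) by exact: measurable_funM.
(* A function of a single observation has the expectation of the same function of the first
   observation of its group. *)
have id (h : R -> R) p : measurable_fun setT h -> (forall z, `|h z| <= 1) ->
    Ex P (fun t => h (c p.1 m * y p.1 (X p t))) =
    Ex P (fun t => h (c p.1 m * y p.1 (X (p.1, 0%N) t))).
  move=> mh h1.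
  have mhy : measurable_fun setT (fun x => h (c p.1 m * y p.1 x)) by exact: measurableT_comp.
  have [] := @Ex_identically_distributed _ _ _ _ _ P (X p) (X (p.1, 0%N)) _ (mX p) (mX _) (identX p) mhy _ => //.
  by apply: (@Intg_bounded _ _ _ _ _ 1) => [|t]; [exact: (measurableT_comp mhy (mX _))|exact: h1].
apply: (@le_trans _ _ (\sum_(p <- array_index (N^~ m)) (e * rho (c p.1 m) + e * rho (c p.1 m)))).
  apply: (@Ex_cos_sum_exp _ _ _ _ _ _ P X mX indepX (array_index (N^~ m))
    (fun p x => c p.1 m * y p.1 x) (fun p => w p.1 (c p.1 m))) => //.
  - exact: array_index_uniq.
  - by move=> p; rewrite (id cos); [have [] := Hm p.1|exact: measurable_cosine|exact: cos_max].
  - by move=> p; rewrite (id sin); [have [] := Hm p.1|exact: measurable_sine|exact: sin_max].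
rewrite sum_array_index.
apply: (@le_trans _ _ (\sum_(i < k) 2 * e * (`|b i| + 1))).
  apply: ler_sum => i _; rewrite /= sumr_const card_ord.
  rewrite [leLHS](_ : _ = 2 * e * ((N i m)%:R * rho (c i m))); last first.
    by rewrite -[LHS]mulr_natl; ring.
  by have [_ _ h] := Hm i; rewrite ler_pM2l// mulr_gt0.
rewrite -mulr_sumr -/Bd /e.
rewrite (_ : _ * Bd = e0 * (Bd / (Bd + 1))); last by field; lra.
by rewrite ler_piMr ?(ltW e00)// ler_pdivrMr; lra.
Qed.

Lemma cos_CLT (y : 'I_k -> S -> R) (N : 'I_k -> nat -> nat)
    (c : 'I_k -> nat -> R) (b : 'I_k -> R) :
  (forall i, measurable_fun setT (y i)) ->
  (forall i, Intg P (fun t => y i (X (i, 0%N) t))) ->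
  (forall i, Intg P (fun t => y i (X (i, 0%N) t) ^+ 2)) ->
  (forall i, Ex P (fun t => y i (X (i, 0%N) t)) = 0) ->
  (forall i, c i @ \oo --> 0) ->
  (forall i, (fun m => (N i m)%:R * c i m ^+ 2) @ \oo --> b i) ->
  (fun m => Ex P (fun t => cos (\sum_(i < k) \sum_(j < N i m) c i m * y i (X (i, nat_of_ord j) t))))
    @ \oo --> expR (- (\sum_(i < k) b i * Ex P (fun t => y i (X (i, 0%N) t) ^+ 2) / 2)).
Proof.
move=> my Iy Iy2 Ey c0 Nb.
apply: (@Ex_cos_array_cvg y N c (fun i z => z ^+ 2 * Ex P (fun t => y i (X (i, 0%N) t) ^+ 2) / 2)
  (fun z => z ^+ 2) b) => //.
- by move=> i z; rewrite divr_ge0// mulr_ge0 ?sqr_ge0//; apply: Ex_ge0 => t; exact: sqr_ge0.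
- by move=> z; exact: sqr_ge0.
- move=> i e e0; apply: cos_sin_expansion2 => //; exact: measurableT_comp.
- apply: cvg_big => [|i _]; first exact: add_continuous.
  rewrite (_ : (fun m => _) = fun m => ((N i m)%:R * c i m ^+ 2) * (Ex P (fun t => y i (X (i, 0%N) t) ^+ 2) / 2)); last first.
    by apply/funext => m; ring.
  by rewrite -mulrA; apply: cvgMr_tmp.
Qed.

Lemma cos_LLN (y : 'I_k -> S -> R) (N : 'I_k -> nat -> nat)
    (c : 'I_k -> nat -> R) (b : 'I_k -> R) :
  (forall i, measurable_fun setT (y i)) ->
  (forall i, Intg P (fun t => y i (X (i, 0%N) t))) ->
  (forall i, Ex P (fun t => y i (X (i, 0%N) t)) = 0) ->
  (forall i, c i @ \oo --> 0) ->
  (forall i, (fun m => (N i m)%:R * `|c i m|) @ \oo --> b i) ->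
  (fun m => Ex P (fun t => cos (\sum_(i < k) \sum_(j < N i m) c i m * y i (X (i, nat_of_ord j) t))))
    @ \oo --> (1 : R).
Proof.
move=> my Iy Ey c0 Nb.
have := @Ex_cos_array_cvg y N c (fun i z => 0) (fun z => `|z|) b 0.
rewrite oppr0 expR0; apply => //.
- by move=> i e e0; apply: cos_sin_expansion1 => //; exact: measurableT_comp.
- by under eq_fun do (under eq_bigr do rewrite mulr0; rewrite big1//); exact: cvg_cst.
Qed.

End independent_arrays.

(** * Gaussian mixtures and Laplace transforms *)

Section gaussian_density.
Context {R : realType}.
Local Notation lambda := (@lebesgue_measure R).
Implicit Types a b s x : R.

Definition gaussian x : R := normal_peak 1 * expR (- (x ^+ 2 / 2)).

Lemma gaussianE : normal_pdf 0 1 = gaussian.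
Proof.
apply/funext => x; rewrite normal_pdfE ?oner_neq0// /normal_fun /gaussian.
by congr (_ * expR _); rewrite subr0 expr1n mulNr.
Qed.

Lemma gaussian_ge0 x : 0 <= gaussian x.
Proof. by rewrite -gaussianE normal_pdf_ge0. Qed.

Lemma measurable_gaussian : measurable_fun setT gaussian.
Proof. by rewrite -gaussianE; exact: measurable_normal_pdf. Qed.

Lemma integrable_gaussian : lambda.-integrable setT (EFin \o gaussian).
Proof. by rewrite -gaussianE; exact: integrable_normal_pdf. Qed.

Lemma integral_gaussian : Rintegral lambda setT gaussian = 1.
Proof. by rewrite -gaussianE /Rintegral integral_normal_pdf. Qed.

(** Tilting the standard normal density gives a multiple of the centred normal density of variance
    1/(1 + 2s). Negative [s] is allowed: s = -1/4 provides the majorants of the next lemmas. *)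
Lemma gaussian_tilt s x : 0 < 1 + 2 * s ->
  expR (- (s * x ^+ 2)) * gaussian x =
  (Num.sqrt (1 + 2 * s))^-1 * normal_pdf 0 (Num.sqrt (1 + 2 * s))^-1 x.
Proof.
move=> s0; have q0 : 0 < Num.sqrt (1 + 2 * s) by rewrite sqrtr_gt0.
rewrite normal_pdfE; last by rewrite invr_neq0// lt0r_neq0.
rewrite /normal_fun /gaussian subr0 mulrCA -expRD mulrA; congr (_ * expR _).
  rewrite /normal_peak expr1n mul1r exprVn sqr_sqrtr ?ltW// -invfM -sqrtrM ?ltW//.
  by rewrite mulrnAr mulrA divff ?mul1r// lt0r_neq0.
rewrite exprVn sqr_sqrtr ?ltW//.
by field; rewrite lt0r_neq0.
Qed.

Lemma integrable_gaussian_tilt s : 0 < 1 + 2 * s ->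
  lambda.-integrable setT (EFin \o (fun x => expR (- (s * x ^+ 2)) * gaussian x)).
Proof.
move=> s0; apply: eq_integrable (integrableZl measurableT
  (Num.sqrt (1 + 2 * s))^-1 (integrable_normal_pdf 0 (Num.sqrt (1 + 2 * s))^-1)) => //.
by move=> x _ /=; rewrite gaussian_tilt.
Qed.

Lemma integral_gaussian_tilt s : 0 < 1 + 2 * s ->
  Rintegral lambda setT (fun x => expR (- (s * x ^+ 2)) * gaussian x) = (Num.sqrt (1 + 2 * s))^-1.
Proof.
move=> s0; under eq_Rintegral do rewrite gaussian_tilt//.
rewrite RintegralZl//; last exact: integrable_normal_pdf.
by rewrite /Rintegral integral_normal_pdf mulr1.
Qed.

(** Since 1 + x^2/4 <= e^(x^2/4), the tilted density with s = -1/4 dominates. *)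
Lemma integrable_mul_gaussian (h : R -> R) c : measurable_fun setT h ->
  (forall x, `|h x| <= c * (1 + x ^+ 2 / 4)) ->
  lambda.-integrable setT (EFin \o (fun x => h x * gaussian x)).
Proof.
move=> mh hc; have s0 : 0 < 1 + 2 * (- 4^-1 : R) by lra.
apply: (le_integrable measurableT _ _ (integrableZl measurableT c (integrable_gaussian_tilt s0))).
  by apply/measurable_EFinP/measurable_funM => //; exact: measurable_gaussian.
move=> x _; rewrite lee_fin; move: x.
suff key (x : R) : `|h x * gaussian x| <= `|c * (expR (- (- 4^-1 * x ^+ 2)) * gaussian x)| by [].
rewrite normrM [X in _ * X]ger0_norm ?gaussian_ge0//.
have c0 : 0 <= c by have := hc 0; have := normr_ge0 (h 0); rewrite expr0n/=; lra.
rewrite [leRHS]ger0_norm; last first.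
  by apply: mulr_ge0 => //; apply: mulr_ge0; [exact: expR_ge0|exact: gaussian_ge0].
rewrite mulrA ler_wpM2r ?gaussian_ge0//; apply: le_trans (hc x) _.
rewrite ler_wpM2l// (_ : - (- 4^-1 * x ^+ 2) = x ^+ 2 / 4); last by ring.
exact: expR_ge1Dx.
Qed.

Lemma is_derive_gaussian x : is_derive x 1 gaussian (- x * gaussian x).
Proof. by apply: is_derive_eq; rewrite /gaussian /GRing.scale/=; field. Qed.

Lemma continuous_gaussian : continuous gaussian.
Proof. by rewrite -gaussianE; apply: continuous_normal_pdf; rewrite oner_neq0. Qed.

Lemma gaussian_cvg0 : (fun n : nat => gaussian n%:R) @ \oo --> 0.
Proof.
apply: (@squeeze_cvgr _ _ _ _ (cst 0) (fun n => normal_peak 1 * 2 * harmonic n)).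
- apply: nearW => n; rewrite gaussian_ge0/= /gaussian -mulrA ler_wpM2l ?normal_peak_ge0//.
  rewrite expRN /harmonic -[leRHS]invrK lef_pV2 ?posrE ?expR_gt0 ?invr_gt0 ?mulr_gt0//.
  apply: le_trans (expR_ge1Dx _); rewrite invfM invrK -(natr1 n).
  have : (n%:R : R) <= n%:R ^+ 2 by rewrite -natrX ler_nat; case: (n) => [//|m]; rewrite expnS leq_pmulr.
  by have : (0 : R) <= n%:R by []; lra.
- exact: cvg_cst.
- by rewrite -(mulr0 (normal_peak 1 * 2)); apply: cvgMl_tmp; exact: cvg_harmonic.
Qed.

Lemma measurable_affine a b : measurable_fun setT (fun x : R => a * x + b).
Proof. by apply: measurable_funD => //; exact: measurable_funM. Qed.

Lemma measurable_cos_affine a b : measurable_fun setT (fun x => cos (a * x + b)).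
Proof. exact: measurableT_comp measurable_cosine (measurable_affine a b). Qed.

Lemma measurable_sin_affine a b : measurable_fun setT (fun x => sin (a * x + b)).
Proof. exact: measurableT_comp measurable_sine (measurable_affine a b). Qed.

Lemma integrable_cos_gaussian a b :
  lambda.-integrable setT (EFin \o (fun x => cos (a * x + b) * gaussian x)).
Proof.
apply: (@integrable_mul_gaussian _ 1); first exact: measurable_cos_affine.
by move=> x; have := cos_max (a * x + b); have := sqr_ge0 x; lra.
Qed.

Lemma integrable_xsin_gaussian a b :
  lambda.-integrable setT (EFin \o (fun x => x * sin (a * x + b) * gaussian x)).
Proof.
apply: (@integrable_mul_gaussian _ 1).
  by apply: measurable_funM => //; exact: measurable_sin_affine.
move=> x; rewrite normrM mul1r.
have h := sin_max (a * x + b); have h' := normr_ge0 (sin (a * x + b)).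
rewrite -(real_normK (num_real x)); have := normr_ge0 x; have := sqr_ge0 (`|x| - 2); nra.
Qed.

(* Integration by parts: the integrand is the derivative of [sin (a x + b) * gaussian x]. *)
Lemma gaussian_stein a b :
  Rintegral lambda setT (fun x => x * sin (a * x + b) * gaussian x) =
  a * Rintegral lambda setT (fun x => cos (a * x + b) * gaussian x).
Proof.
pose g x := a * (cos (a * x + b) * gaussian x) - x * sin (a * x + b) * gaussian x.
pose G x := sin (a * x + b) * gaussian x.
have dG x : is_derive x 1 G (g x).
  have := is_derive_gaussian x => ?.
  by apply: is_derive_eq; rewrite /g /GRing.scale/=; ring.
have icos := integrableZl measurableT a (integrable_cos_gaussian a b).
have isin := integrable_xsin_gaussian a b.
have ig : lambda.-integrable setT (EFin \o g).
  have := integrableB measurableT icos isin.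
  by apply: eq_integrable => // x _; rewrite /= /g EFinB EFinM.
have Eg : Rintegral lambda setT g = a * Rintegral lambda setT (fun x => cos (a * x + b) * gaussian x)
   - Rintegral lambda setT (fun x => x * sin (a * x + b) * gaussian x).
  by rewrite /g RintegralB// ?RintegralZl//; exact: integrable_cos_gaussian.
apply/eqP; rewrite eq_sym -subr_eq0 -Eg; apply/eqP.
have mg : measurable_fun setT g by apply/measurable_EFinP; exact: (measurable_int lambda ig).
have mgS (D : set R) : measurable_fun D g by exact: measurable_funTS.
have cG : continuous G.
  by move=> x; apply/differentiable_continuous/derivable1_diffP; exact: ex_derive.
have cg : continuous g.
  move=> x; apply: cvgB; [apply: cvgMl_tmp|]; apply: cvgM; try exact: continuous_gaussian.
    apply: (@cvg_comp _ _ _ (fun x => a * x + b) cos); last exact: continuous_cos.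
    by apply: cvgD; [apply: cvgMl_tmp; exact: cvg_id|exact: cvg_cst].
  apply: cvgM; first exact: cvg_id.
  apply: (@cvg_comp _ _ _ (fun x => a * x + b) sin); last exact: continuous_sin.
  by apply: cvgD; [apply: cvgMl_tmp; exact: cvg_id|exact: cvg_cst].
have FTC (n : nat) : Rintegral lambda setT (fun x => (g \_ `[- n.+1%:R, n.+1%:R]) x) = G n.+1%:R - G (- n.+1%:R).
  rewrite -Rintegral_mkcond /Rintegral (@continuous_FTC2 _ g G)//.
  - have : (0 : R) < n.+1%:R by []; lra.
  - exact: continuous_subspaceT.
  - split => [x _||]; first exact: ex_derive.
      by apply: cvg_at_right_filter; exact: cG.
    by apply: cvg_at_left_filter; exact: cG.
  - by move=> x _; rewrite derive1E derive_val.
have L1 : (fun n : nat => Rintegral lambda setT (fun x => (g \_ `[- n.+1%:R, n.+1%:R]) x)) @ \oo --> Rintegral lambda setT g.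
  apply: (@Rintegral_dominated R _ _ lambda
    (fun n : nat => g \_ `[- n.+1%:R, n.+1%:R]) g (fun x => `|g x|)); [|exact: mg| | |].
  - move=> n; apply/(measurable_restrict _ _ _) => //.
    exact: mgS.
  - apply: (le_integrable measurableT _ _ ig).
      by apply/measurable_EFinP; apply: measurableT_comp => //; exact: mgS.
    by move=> x _ /=; rewrite normr_id.
  - move=> x; apply: cvg_near_cst; near=> n; rewrite patchE mem_set//= in_itv/=.
    rewrite -ler_norml; near: n; exists (Num.truncn `|x|) => // n /= xn.
    apply: le_trans (ltW (truncnS_gt _)) _; by rewrite ler_nat.
  - by move=> n x; rewrite patchE; case: ifP => // _; rewrite normr0.
have L2 : (fun n : nat => Rintegral lambda setT (fun x => (g \_ `[- n.+1%:R, n.+1%:R]) x)) @ \oo --> 0.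
  under eq_fun do rewrite FTC.
  have gN x : gaussian (- x) = gaussian x by rewrite /gaussian sqrrN.
  apply/norm_cvg0P; apply: (@squeeze_cvgr _ _ _ _ (cst 0) (fun n : nat => 2 * gaussian n.+1%:R)).
  - apply: nearW => n; rewrite normr_ge0/=; apply: le_trans (ler_normB _ _) _.
    have Gg x : `|G x| <= gaussian x.
      by rewrite /G normrM [`|gaussian _|]ger0_norm ?gaussian_ge0// ler_piMl ?gaussian_ge0// sin_max.
    by rewrite mulr_natl mulr2n lerD// -gN.
  - exact: cvg_cst.
  - by rewrite -(mulr0 2); apply: cvgMl_tmp; have := gaussian_cvg0; rewrite -(cvg_shiftS (fun n : nat => gaussian n%:R)).
exact: (cvg_unique _ L1 L2).
Unshelve. all: by end_near. Qed.

(** Differentiation under the integral sign and [gaussian_stein] show that the left side F solves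
    F'(u) = -u F(u), so F(u) e^(u^2/2) is constant. *)
Lemma gaussian_fourier a b :
  Rintegral lambda setT (fun x => cos (a * x + b) * gaussian x) = expR (- (a ^+ 2 / 2)) * cos b.
Proof.
pose f (u x : R) := cos (u * x + b) * gaussian x.
pose F u := Rintegral lambda setT (f u).
have df (u x : R) : is_derive u 1 (f ^~ x) (- (x * sin (u * x + b) * gaussian x)).
  by apply: is_derive_eq; rewrite /GRing.scale/=; ring.
have d1f (u x : R) : partial1of2 f u x = - (x * sin (u * x + b) * gaussian x).
  by rewrite partial1of2E derive_val.
have iG : lambda.-integrable setT (EFin \o (fun x => `|x| * gaussian x)).
  apply: (@integrable_mul_gaussian (fun x => `|x|) 1); first exact: measurableT_comp.
  move=> x; rewrite normr_id mul1r -(real_normK (num_real x)).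
  by have := normr_ge0 x; have := sqr_ge0 (`|x| - 2); nra.
have dF (u : R) : is_derive u 1 F (- (u * F u)).
  have Iu : `]u - 1, u + 1[%classic u by rewrite /= in_itv/=; apply/andP; split; lra.
  have H1 x : `]u - 1, u + 1[%classic x -> lambda.-integrable setT (EFin \o f x).
    by move=> _; exact: integrable_cos_gaussian.
  have H2 x y : `]u - 1, u + 1[%classic x -> setT y -> derivable (f ^~ y) x 1.
    by move=> _ _; exact: ex_derive.
  have H3 y : 0 <= `|y| * gaussian y by rewrite mulr_ge0 ?gaussian_ge0.
  have H4 x y : `]u - 1, u + 1[%classic x -> setT y -> `|partial1of2 f x y| <= `|y| * gaussian y.
    move=> _ _; rewrite d1f normrN 2!normrM [`|gaussian _|]ger0_norm ?gaussian_ge0//.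
    by rewrite ler_wpM2r ?gaussian_ge0// ler_piMr// sin_max.
  have D := derivable_under_integral measurableT Iu H1 H2 H3 iG H4.
  have E := differentiation_under_integral measurableT Iu H1 H2 H3 iG H4.
  apply: (DeriveDef D); rewrite -derive1E E.
  rewrite (_ : - (u * F u) = - Rintegral lambda setT (fun x => x * sin (u * x + b) * gaussian x)); last by rewrite gaussian_stein.
  rewrite -mulN1r -RintegralZl//; last exact: integrable_xsin_gaussian.
  by apply: eq_Rintegral => x _; rewrite d1f mulN1r.
have H (u : R) : is_derive u 1 (fun u => F u * expR (u ^+ 2 / 2)) 0.
  by have ? := dF u; apply: is_derive_eq; rewrite /GRing.scale/=; field.
have := @is_derive_0_is_cst R (fun u : R => F u * expR (u ^+ 2 / 2)) a 0 H; rewrite expr0n/= mul0r expR0 mulr1.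
have -> : F 0 = cos b.
  rewrite /F; transitivity (cos b * Rintegral lambda setT gaussian).
    rewrite -RintegralZl//; last exact: integrable_gaussian.
    by apply: eq_Rintegral => x _; rewrite /f mul0r add0r.
  by rewrite integral_gaussian mulr1.
by move=> <-; rewrite expRN mulrCA mulVf ?mulr1// lt0r_neq0// expR_gt0.
Qed.

End gaussian_density.

Section gaussian_mixture.
Context {R : realType} {dT : measure_display} {T : measurableType dT}.
Variable P : probability T R.
Local Notation lambda := (@lebesgue_measure R).

(** The Fourier transform read backwards: the frequency in [w] becomes Gaussian, and the factor
    sqrt(2s) turns a^2/2 into s w^2. The phase [b] makes room for coordinates that are still inside
    the cosine. *)
Lemma gaussian_mixture (s w b : R) : 0 <= s ->
  Rintegral lambda setT (fun x => cos (Num.sqrt (2 * s) * w * x + b) * gaussian x) =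
  expR (- (s * w ^+ 2)) * cos b.
Proof.
move=> s0; rewrite gaussian_fourier exprMn sqr_sqrtr ?mulr_ge0//.
by congr (expR (- _) * _); field.
Qed.

(** Fubini's theorem, with the Gaussian density as majorant. [G] stands for the coordinates already
    converted to exponentials, [B] for those yet to be converted. *)
Lemma Ex_gaussian_mixture (G W B : T -> R) (s : R) : 0 <= s ->
  measurable_fun setT G -> measurable_fun setT W -> measurable_fun setT B ->
  (forall t, `|G t| <= 1) ->
  Ex P (fun t => G t * expR (- (s * W t ^+ 2)) * cos (B t)) =
  Rintegral lambda setT (fun x =>
    Ex P (fun t => G t * cos (Num.sqrt (2 * s) * x * W t + B t)) * gaussian x).
Proof.
move=> s0 mG mW mB G1; set q := Num.sqrt (2 * s).
pose f (z : T * R) : R := G z.1 * cos (q * W z.1 * z.2 + B z.1) * gaussian z.2.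
have fB t x : `|f (t, x)| <= gaussian x.
  rewrite /f normrM [`|gaussian _|]ger0_norm ?gaussian_ge0// ler_piMl ?gaussian_ge0//=.
  by rewrite normrM mulr_ile1// cos_max.
have mf : measurable_fun setT f.
  have m1 (h : T -> R) : measurable_fun setT h -> measurable_fun setT (fun z : T * R => h z.1).
    by move=> mh; exact: (measurableT_comp mh measurable_fst).
  have m2 (h : R -> R) : measurable_fun setT h -> measurable_fun setT (fun z : T * R => h z.2).
    by move=> mh; exact: (measurableT_comp mh measurable_snd).
  apply: measurable_funM; last by apply: m2; exact: measurable_gaussian.
  apply: measurable_funM; first exact: m1.
  apply: (measurableT_comp measurable_cosine); apply: measurable_funD; last exact: m1.
  apply: measurable_funM; last exact: measurable_snd.
  by apply: measurable_funM => //; exact: m1.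
have mfx t : measurable_fun setT (fun x => f (t, x)).
  by exact: (measurableT_comp mf (pair1_measurable t)).
have mft x : measurable_fun setT (fun t => f (t, x)).
  by exact: (measurableT_comp mf (pair2_measurable x)).
have mfE : measurable_fun [set: T * measurableTypeR R] (EFin \o f) by exact/measurable_EFinP.
have ifx t : lambda.-integrable setT (EFin \o (fun x => f (t, x))).
  apply: (le_integrable measurableT _ _ integrable_gaussian).
    by apply/measurable_EFinP; exact: mfx.
  by move=> x _ /=; rewrite lee_fin (le_trans (fB t x))// ler_norm.
have ift (x : R) : Intg P (fun t => f (t, x)).
  by apply: (@Intg_bounded _ _ _ P _ (gaussian x) (mft x)) => t; exact: fB.
have iprod : (P \x lambda)%E.-integrable setT (EFin \o f).
  apply: (proj2 (@integrable12ltyP _ _ T (measurableTypeR R) R P lambda _ mfE)).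
  apply: (@le_lt_trans _ _ (\int[P]_t 1%E)%E); last first.
    rewrite integral_cst// mul1e -ge0_fin_numE//.
    exact: (fin_num_measure P _ measurableT).
  apply: ge0_le_integral => //.
  - by move=> t _; apply: integral_ge0.
  - have mfa : measurable_fun [set: T * measurableTypeR R] (abse \o (EFin \o f)).
      exact: measurableT_comp.
    exact: (@measurable_fun_fubini_tonelli_F _ _ T (measurableTypeR R) R lambda _ mfa (fun=> abse_ge0 _)).
  - move=> t _; rewrite -(@integral_normal_pdf R 0 1) gaussianE; apply: ge0_le_integral => //.
    + by apply/measurable_EFinP; apply: measurableT_comp => //; exact: mfx.
    + by apply/measurable_EFinP; exact: measurable_gaussian.
    + by move=> x _; exact: fB.
have Fub := Fubini iprod.
transitivity (fine (\int[P]_t \int[lambda]_x (EFin \o f) (t, x))%E).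
  rewrite /Ex; congr fine; apply: eq_integral => t _.
  rewrite (_ : (\int[lambda]_x (EFin \o f) (t, x))%E =
    (Rintegral lambda setT (fun x => f (t, x)))%:E); last first.
    by rewrite /Rintegral fineK//; exact: integrable_fin_num (ifx t).
  congr EFin; rewrite -mulrA -gaussian_mixture// -RintegralZl//.
    by apply: eq_Rintegral => x _; rewrite /f/= mulrA.
  apply: (@integrable_mul_gaussian _ _ 1).
    exact: measurable_cos_affine.
  by move=> x; have := cos_max (q * W t * x + B t); have := sqr_ge0 x; lra.
rewrite Fub /Rintegral; congr fine; apply: eq_integral => x _.
rewrite (_ : (\int[P]_t (EFin \o f) (t, x))%E = (Ex P (fun t => f (t, x)))%:E); last first.
  by rewrite /Ex fineK//; exact: integrable_fin_num (ift x).
congr EFin; rewrite /f/= mulrC -ExZ.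
  by congr (Ex P _); apply/funext => t; rewrite [RHS]mulrC (mulrAC q).
apply: (@Intg_bounded _ _ _ _ _ 1) => [|t]; last by rewrite normrM mulr_ile1// cos_max.
apply: measurable_funM => //; apply: (measurableT_comp measurable_cosine).
by apply: measurable_funD => //; exact: measurable_funM.
Qed.

Lemma gaussian_mixture_cvg (G W B : nat -> T -> R) (s v psi : R) : 0 <= s -> 0 <= v ->
  (forall n, measurable_fun setT (G n)) -> (forall n, measurable_fun setT (W n)) ->
  (forall n, measurable_fun setT (B n)) -> (forall n t, `|G n t| <= 1) ->
  (forall x, (fun n => Ex P (fun t => G n t * cos (x * W n t + B n t))) @ \oo -->
     psi * expR (- (x ^+ 2 * v / 2))) ->
  (fun n => Ex P (fun t => G n t * expR (- (s * W n t ^+ 2)) * cos (B n t))) @ \oo -->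
    psi * (Num.sqrt (1 + 2 * (s * v)))^-1.
Proof.
move=> s0 v0 mG mW mB G1 H.
have sv0 : 0 < 1 + 2 * (s * v) by rewrite ltr_wpDr// !mulr_ge0.
under eq_fun do rewrite Ex_gaussian_mixture//.
rewrite -integral_gaussian_tilt// -RintegralZl//; last exact: integrable_gaussian_tilt.
have mE n (x : R) : `|Ex P (fun t => G n t * cos (Num.sqrt (2 * s) * x * W n t + B n t))| <= 1.
  apply: Ex_norm_cst => [|t]; last by rewrite normrM mulr_ile1// cos_max.
  apply: measurable_funM => //; apply: (measurableT_comp measurable_cosine).
  by apply: measurable_funD => //; exact: measurable_funM.
have cE (x : R) : (fun n => Ex P (fun t => G n t * cos (Num.sqrt (2 * s) * x * W n t + B n t)))
    @ \oo --> psi * expR (- (s * v * x ^+ 2)).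
  have := H (Num.sqrt (2 * s) * x); rewrite exprMn sqr_sqrtr ?mulr_ge0//.
  by rewrite (_ : 2 * s * x ^+ 2 * v / 2 = s * v * x ^+ 2); last by field.
have mEn n : measurable_fun setT (fun x : R => Ex P (fun t => G n t * cos (Num.sqrt (2 * s) * x * W n t + B n t))).
  (* Tonelli's theorem yields measurability of partial integrals of nonnegative functions, hence the
     shift by 1 below. *)
  pose h (z : T * R) : R := G n z.1 * cos (Num.sqrt (2 * s) * z.2 * W n z.1 + B n z.1).
  have mh : measurable_fun setT (fun z => (h z + 1)%:E).
    have m1 (f : T -> R) : measurable_fun setT f -> measurable_fun setT (fun z : T * R => f z.1).
      by move=> mf; exact: (measurableT_comp mf measurable_fst).
    apply/measurable_EFinP; apply: measurable_funD => //; apply: measurable_funM; first exact: m1.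
    apply: (measurableT_comp measurable_cosine); apply: measurable_funD; last exact: m1.
    apply: measurable_funM; last exact: m1.
    by apply: measurable_funM => //; exact: measurable_snd.
  have h1 z : `|h z| <= 1 by rewrite normrM mulr_ile1// cos_max.
  have Ih x : Intg P (fun t => h (t, x)).
    apply: (@Intg_bounded _ _ _ _ _ 1) => //; rewrite /h/=.
    apply: measurable_funM => //; apply: (measurableT_comp measurable_cosine).
    by apply: measurable_funD => //; exact: measurable_funM.
  rewrite (_ : (fun x => _) = fun x => fine (\int[P]_t (h (t, x) + 1)%:E) - 1); last first.
    apply/funext => x; rewrite (_ : fine _ = Ex P (fun t => h (t, x) + 1))//.
    by rewrite ExD ?(Ex_cst _ 1) ?addrK//; exact: Intg_cst.
  apply: measurable_funB => //; apply: measurableT_comp => //.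
  apply: (@measurable_fun_fubini_tonelli_G _ _ T R R P (fun z => (h z + 1)%:E) mh).
  by move=> z; have := h1 z; rewrite lee_fin ler_norml => /andP[]; lra.
apply: (@Rintegral_dominated R _ _ lambda
  (fun n x => Ex P (fun t => G n t * cos (Num.sqrt (2 * s) * x * W n t + B n t)) * gaussian x)
  (fun x => psi * (expR (- (s * v * x ^+ 2)) * gaussian x)) gaussian).
- by move=> n; apply: measurable_funM; [exact: mEn|exact: measurable_gaussian].
- apply: measurable_funM => //; apply: measurable_funM; last exact: measurable_gaussian.
  apply: measurableT_comp => //; by apply: measurableT_comp => //; apply: measurable_funM.
- exact: integrable_gaussian.
- by move=> x; rewrite mulrA; apply: cvgMr_tmp; exact: cE.
- move=> n x; rewrite normrM [`|gaussian _|]ger0_norm ?gaussian_ge0// ler_piMl ?gaussian_ge0//.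
Qed.

End gaussian_mixture.

(** * Laplace transforms of squared norms and the tail bounds they give *)

Section laplace_transform.
Context {R : realType} {dT : measure_display} {T : measurableType dT}.
Variable P : probability T R.

Lemma Ex_laplace_cvg (q : nat) (W : nat -> nat -> T -> R) (s : R) : 0 <= s ->
  (forall a n, measurable_fun setT (W a n)) ->
  (forall tau : nat -> R, (fun n => Ex P (fun t => cos (\sum_(0 <= a < q) tau a * W a n t)))
     @ \oo --> expR (- (\sum_(0 <= a < q) tau a ^+ 2 / 2))) ->
  (fun n => Ex P (fun t => expR (- (s * \sum_(0 <= a < q) W a n t ^+ 2)))) @ \oo -->
    (Num.sqrt (1 + 2 * s))^-1 ^+ q.
Proof.
move=> s0 mW H; set r := (Num.sqrt _)^-1.
have mWs p : forall n, measurable_fun setT (fun t => expR (- (s * \sum_(0 <= a < p) W a n t ^+ 2))).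
  move=> n; apply: measurableT_comp => //; apply: measurableT_comp => //.
  apply: measurable_funM => //; apply: measurable_sum => a; exact: measurable_funX.
(* The first [p] coordinates appear as e^(-s x^2), the others still in the cosine; p = 0 is the
   hypothesis and p = q the conclusion. *)
have claim p : (p <= q)%N -> forall tau : nat -> R,
    (fun n => Ex P (fun t => expR (- (s * \sum_(0 <= a < p) W a n t ^+ 2)) * cos (\sum_(p <= a < q) tau a * W a n t)))
     @ \oo --> r ^+ p * expR (- (\sum_(p <= a < q) tau a ^+ 2 / 2)).
  elim: p => [_|p IH pq] tau.
    rewrite expr0 mul1r; have := H tau; apply: cvg_trans; apply: near_eq_cvg; apply: nearW => n.
    by congr (Ex P _); apply/funext => t; rewrite big_nil mulr0 oppr0 expR0 mul1r.
  have {IH} IH := IH (ltnW pq).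
  rewrite (_ : r ^+ p.+1 * _ = (r ^+ p * expR (- (\sum_(p.+1 <= a < q) tau a ^+ 2 / 2))) * (Num.sqrt (1 + 2 * (s * 1)))^-1); last first.
    by rewrite mulr1 exprS -/r; ring.
  rewrite (_ : (fun n => _) = fun n => Ex P (fun t => expR (- (s * \sum_(0 <= a < p) W a n t ^+ 2)) *
      expR (- (s * W p n t ^+ 2)) * cos (\sum_(p.+1 <= a < q) tau a * W a n t))); last first.
    apply/funext => n; congr (Ex P _); apply/funext => t.
    by rewrite -expRD big_nat_recr//= mulrDr opprD.
  apply: gaussian_mixture_cvg => //.
  - by move=> n; apply: measurable_sum => a; exact: measurable_funM.
  - move=> n t; rewrite ger0_norm ?expR_ge0// expR_le1 oppr_le0 mulr_ge0// sumr_ge0// => a _.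
    exact: sqr_ge0.
  (* The frequency of coordinate [p] becomes the mixing variable [x]. *)
  move=> x; have := IH (fun a => if a == p then x else tau a).
  rewrite big_ltn// eqxx (_ : \sum_(p.+1 <= _ < _) _ = \sum_(p.+1 <= a < q) tau a ^+ 2 / 2); last first.
    by apply: eq_big_nat => a /andP[pa _]; rewrite gtn_eqF.
  set Sq := \sum_(p.+1 <= _ < q) _.
  have -> : r ^+ p * expR (- (x ^+ 2 / 2 + Sq)) = r ^+ p * expR (- Sq) * expR (- (x ^+ 2 * 1 / 2)).
    by rewrite opprD expRD mulr1; ring.
  apply: cvg_trans; apply: near_eq_cvg; apply: nearW => n.
  congr (Ex P _); apply/funext => t; congr (_ * cos _); rewrite big_ltn// eqxx; congr (_ + _).
  by apply: eq_big_nat => a /andP[pa _]; rewrite gtn_eqF.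
have := claim q (leqnn q) (fun=> 0); rewrite big_geq// oppr0 expR0 mulr1.
apply: cvg_trans; apply: near_eq_cvg; apply: nearW => n.
by congr (Ex P _); apply/funext => t; rewrite [in cos _]big_geq// cos0 mulr1.
Qed.

Lemma Ex_expN_sqr_cvg (W : nat -> T -> R) (s v : R) : 0 <= s -> 0 <= v ->
  (forall n, measurable_fun setT (W n)) ->
  (forall u : R, (fun n => Ex P (fun t => cos (u * W n t))) @ \oo --> expR (- (u ^+ 2 * v / 2))) ->
  (fun n => Ex P (fun t => expR (- (s * W n t ^+ 2)))) @ \oo --> (Num.sqrt (1 + 2 * (s * v)))^-1.
Proof.
move=> s0 v0 mW H.
have := @gaussian_mixture_cvg _ _ _ P (fun _ _ => 1) W (fun _ _ => 0) s v 1 s0 v0.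
rewrite mul1r => K; apply: cvg_trans (K _ _ _ _ _) => //.
- by apply: near_eq_cvg; apply: nearW => n; congr (Ex P _); apply/funext => t; rewrite cos0 mulr1 mul1r.
- by move=> n t; rewrite normr1.
- move=> x; rewrite mul1r; apply: cvg_trans (H x).
  by apply: near_eq_cvg; apply: nearW => n; congr (Ex P _); apply/funext => t; rewrite addr0 mul1r.
Qed.

(** Markov's inequality for 1 - e^(-W^2/K^2), which is at least 1/2 where |W| >= K because e^(-1) <=
    1/2. *)
Lemma prob_norm_ge_laplace (W : T -> R) (K : R) : 0 < K -> measurable_fun setT W ->
  fine (P [set t | K <= `|W t|]) <= 2 * (1 - Ex P (fun t => expR (- ((K ^+ 2)^-1 * W t ^+ 2)))).
Proof.
move=> K0 mW.
have K20 : 0 < K ^+ 2 by rewrite exprn_gt0.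
have me : measurable_fun setT (fun t => expR (- ((K ^+ 2)^-1 * W t ^+ 2))).
  apply: measurableT_comp => //; apply: measurableT_comp => //.
  by apply: measurable_funM => //; exact: measurable_funX.
have e1 t : 0 <= (K ^+ 2)^-1 * W t ^+ 2 by rewrite mulr_ge0 ?sqr_ge0// invr_ge0 ltW.
have Ie : Intg P (fun t => expR (- ((K ^+ 2)^-1 * W t ^+ 2))).
  by apply: (@Intg_bounded _ _ _ P _ 1 me) => t; rewrite ger0_norm ?expR_ge0// expR_le1 oppr_le0.
have E : 1 - Ex P (fun t => expR (- ((K ^+ 2)^-1 * W t ^+ 2))) =
    Ex P (fun t => 1 - expR (- ((K ^+ 2)^-1 * W t ^+ 2))).
  by rewrite ExB// ?(Ex_cst _ 1)//; exact: Intg_cst.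
have I1 : Intg P (fun t => 1 - expR (- ((K ^+ 2)^-1 * W t ^+ 2))) by apply: IntgB => //; exact: Intg_cst.
have h : (0 : R) < 2^-1 by [].
have := Ex_markov I1 h _; rewrite -E invrK mulrC => M.
apply: le_trans (M _); last by move=> t; rewrite subr_ge0 expR_le1 oppr_le0.
have mI (c : R) (f : T -> R) : measurable_fun setT f -> measurable [set t | c <= f t].
  move=> mf; rewrite [X in measurable X](_ : _ = setT `&` f @^-1` `[c, +oo[).
    by apply: mf; [exact: measurableT|exact: measurable_itv].
  by rewrite setTI; apply/seteqP; split => t /=; rewrite in_itv/= andbT.
have mA : measurable [set t | K <= `|W t|] by apply: mI; exact: measurableT_comp.
have mB := mI (2^-1) _ (Intg_measurable I1).
apply: fine_le; [exact: (fin_num_measure P)|exact: (fin_num_measure P)|].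
apply: le_measure; rewrite ?inE// => t /= KW.
have : 1 <= (K ^+ 2)^-1 * W t ^+ 2.
  by rewrite mulrC ler_pdivlMr// mul1r -[leRHS]real_normK ?num_real// lerXn2r ?nnegrE// ltW.
move: (_ * _) => z z1.
suff : expR (- z) <= 2^-1 by lra.
rewrite expRN lef_pV2 ?posrE ?expR_gt0//; apply: le_trans (expR_ge1Dx z); lra.
Qed.

End laplace_transform.

(** * Convergence in probability and asymptotic linearity *)

Section with_high_probability.
Context {R : realType} {dT : measure_display} {T : measurableType dT}.
Variable P : probability T R.

(* Convergence along this filter on [nat * T] is convergence in probability. *)
Definition whp : set_system (nat * T) := [set A | forall eta : R, 0 < eta ->
  \forall n \near \oo, exists B : set T,
    [/\ measurable B, (P B <= eta%:E)%E & forall t, ~ B t -> A (n, t)]].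

Global Instance whp_filter : ProperFilter whp.
Proof.
split.
  move=> /(_ (2^-1)) [|N _ /(_ N (leqnn _)) [B [mB PB H]]]; first by [].
  have BT : B = setT by apply/seteqP; split => // t _; apply: contrapT => /H.
  by move: PB; rewrite BT probability_setT lee_fin; lra.
split.
- move=> e e0; apply: nearW => n; exists set0; split => //.
  by rewrite measure0 lee_fin ltW.
- move=> A A' HA HA' e e0; have e2 : 0 < e / 2 by rewrite divr_gt0.
  have := HA _ e2; have := HA' _ e2; apply: filterS2 => n [B [mB PB H]] [B' [mB' PB' H']].
  exists (B `|` B'); split; first exact: measurableU.
    apply: (@le_trans _ _ (P B + P B')%E); first exact: measureU2.
    by rewrite [e in e%:E]splitr EFinD leeD.
  by move=> t /= /not_orP[nB nB']; split; [exact: H'|exact: H].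
- move=> A A' AA' HA e e0; have := HA e e0; apply: filterS => n [B [mB PB H]].
  by exists B; split => // t nB; apply: AA'; exact: H.
Qed.


Lemma whp_seq (A : set nat) : (\forall n \near \oo, A n) -> whp [set z | A z.1].
Proof.
move=> HA e e0; apply: filterS HA => n An; exists set0; split => //.
by rewrite measure0 lee_fin ltW.
Qed.

Lemma whp_cvg_seq (u : nat -> R) (l : R) : u @ \oo --> l -> (fun z => u z.1) @ whp --> l.
Proof. by move=> ul A /ul HA; exact: (whp_seq HA). Qed.

Lemma whp_cvg_ext (f g : nat * T -> R) (l : R) :
  (forall z, f z = g z) -> f @ whp --> l -> g @ whp --> l.
Proof. by move=> /funext ->. Qed.

Lemma whp_cvg_near (f g : nat * T -> R) (l : R) :
  (\forall z \near whp, f z = g z) -> f @ whp --> l -> g @ whp --> l.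
Proof. by move=> fg; apply: cvg_trans; exact: near_eq_cvg. Qed.

Lemma whp_filterS (A B : nat * T -> Prop) :
  (forall z, A z -> B z) -> (\forall z \near whp, A z) -> \forall z \near whp, B z.
Proof. exact: filterS. Qed.

(** Boundedness in probability, stated through the only consequence the calculus below draws from
    it: the product with an o_P(1) is o_P(1). The usual form enters by [tight_of_bound]. *)
Definition tight (L : nat * T -> R) := forall V : nat * T -> R,
  V @ whp --> 0 -> (fun z => L z * V z) @ whp --> 0.

Lemma tight_of_bound (L : nat -> T -> R) : (forall n, measurable_fun setT (L n)) ->
  (forall eta : R, 0 < eta -> exists2 K : R, 0 < K &
    \forall n \near \oo, (fine (P [set t | K <= `|L n t|]) <= eta)) ->
  tight (fun z => L z.1 z.2).
Proof.
move=> mL H V V0; apply/cvgr0Pnorm_le => e e0 eta eta0.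
have eta2 : 0 < eta / 2 by rewrite divr_gt0.
have [K K0 HK] := H _ eta2.
have eK : 0 < e / K by rewrite divr_gt0.
have /cvgr0Pnorm_le/(_ _ eK)/(_ _ eta2) HV := V0.
apply: filterS2 HK HV => n HK [B [mB PB HB]].
have mA : measurable [set t | K <= `|L n t|].
  rewrite [X in measurable X](_ : _ = setT `&` (fun t => `|L n t|) @^-1` `[K, +oo[).
    have : measurable_fun setT (fun t => `|L n t|) by exact: measurableT_comp.
    by apply; [exact: measurableT|exact: measurable_itv].
  by rewrite setTI; apply/seteqP; split => t /=; rewrite in_itv/= andbT.
exists ([set t | K <= `|L n t|] `|` B); split; first exact: measurableU.
  apply: (@le_trans _ _ (P [set t | (K <= `|L n t|)%R] + P B)%E); first exact: measureU2.
  rewrite [eta in eta%:E]splitr EFinD leeD//.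
  by rewrite -[X in (X <= _)%E]fineK ?lee_fin//; exact: (fin_num_measure P).
move=> t /= /not_orP[/negP nK nB]; have := HB t nB => /= HVt.
rewrite normrM; rewrite -ltNge in nK.
rewrite [leRHS](_ : _ = K * (e / K)); last by field; rewrite lt0r_neq0.
by apply: ler_pM => //; exact: ltW.
Qed.

Lemma tightD L L' : tight L -> tight L' -> tight (fun z => L z + L' z).
Proof.
move=> tL tL' V V0.
have H : (fun z => L z * V z + L' z * V z) @ whp --> (0 + 0 : R).
  by apply: cvgD; [exact: tL|exact: tL'].
by rewrite addr0 in H; apply: whp_cvg_ext H => z; rewrite mulrDl.
Qed.

Lemma tightM_cvg (L Y : nat * T -> R) (y : R) : tight L -> Y @ whp --> y -> tight (fun z => L z * Y z).
Proof.
move=> tL Yy V V0; have := tL (fun z => Y z * V z) _.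
have YV : (fun z => Y z * V z) @ whp --> 0 by rewrite -(mulr0 y); exact: cvgM.
by move=> /(_ YV); under eq_fun do rewrite mulrA.
Qed.

Lemma tightZ L (c : R) : tight L -> tight (fun z => c * L z).
Proof.
move=> tL V V0; have H : (fun z => c * (L z * V z)) @ whp --> (c * 0).
  by apply: cvgMl_tmp; exact: tL.
by rewrite mulr0 in H; apply: whp_cvg_ext H => z; rewrite mulrA.
Qed.

Lemma tight_cst (c : R) : tight (fun=> c).
Proof. by move=> V V0; rewrite -(mulr0 c); apply: cvgMl_tmp. Qed.

Lemma tight_sum (I : Type) (r : seq I) (L : I -> nat * T -> R) :
  (forall i, tight (L i)) -> tight (fun z => \sum_(i <- r) L i z).
Proof.
move=> tL; elim: r => [|i r IH].
  by under eq_fun do rewrite big_nil; exact: tight_cst.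
by under eq_fun do rewrite big_cons; exact: tightD.
Qed.

(** The Gaussian limit of variance 0: the Laplace transform of W^2 at e^(-2) (here [e] is the
    tolerance) tends to 1, and [prob_norm_ge_laplace] with K = e bounds the tail. *)
Lemma laplace_cvg0 (W : nat -> T -> R) : (forall n, measurable_fun setT (W n)) ->
  (forall u : R, (fun n => Ex P (fun t => cos (u * W n t))) @ \oo --> (1 : R)) ->
  (fun z => W z.1 z.2) @ whp --> 0.
Proof.
move=> mW H; apply/cvgr0Pnorm_le => e e0 eta eta0.
have s0 : 0 <= (e ^+ 2)^-1 by rewrite invr_ge0 sqr_ge0.
have H' u : (fun n => Ex P (fun t => cos (u * W n t))) @ \oo --> expR (- (u ^+ 2 * 0 / 2)).
  by rewrite mulr0 mul0r oppr0 expR0.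
have := @Ex_expN_sqr_cvg _ _ _ P W _ 0 s0 (lexx 0) mW H'.
rewrite !mulr0 addr0 sqrtr1 invr1 => /cvgrPdist_le/(_ (eta / 2)).
rewrite divr_gt0// => /(_ isT); apply: filterS => n Hn.
have mA : measurable [set t | e <= `|W n t|].
  rewrite [X in measurable X](_ : _ = setT `&` (fun t => `|W n t|) @^-1` `[e, +oo[).
    have : measurable_fun setT (fun t => `|W n t|) by exact: measurableT_comp.
    by apply; [exact: measurableT|exact: measurable_itv].
  by rewrite setTI; apply/seteqP; split => t /=; rewrite in_itv/= andbT.
exists [set t | e <= `|W n t|]; split => //.
  rewrite -[X in (X <= _)%E]fineK; last exact: (fin_num_measure P).
  rewrite lee_fin; apply: le_trans (prob_norm_ge_laplace P e0 (mW n)) _.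
  by have := le_trans (ler_norm _) Hn; lra.
by move=> t /= /negP; rewrite -ltNge => /ltW.
Qed.

Lemma laplace_tight (W : nat -> T -> R) (v : R) : 0 <= v -> (forall n, measurable_fun setT (W n)) ->
  (forall u : R, (fun n => Ex P (fun t => cos (u * W n t))) @ \oo --> expR (- (u ^+ 2 * v / 2))) ->
  tight (fun z => W z.1 z.2).
Proof.
move=> v0 mW H; apply: tight_of_bound => // eta eta0.
(* Makes 2 s v <= eta/4, so the limiting transform is at least 1 - eta/4. With K = s^(-1/2) and a
   further eta/4 for convergence, the tail is at most 2 (eta/4 + eta/4). *)
pose s := eta / (8 * (v + 1)).
have s0 : 0 < s by rewrite divr_gt0// mulr_gt0// ltr_wpDl.
have sv : 2 * (s * v) <= eta / 4.
  rewrite /s (_ : 2 * _ = eta / 4 * (v / (v + 1))); last by field; lra.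
  by rewrite ler_piMr ?divr_ge0 ?(ltW eta0)// ler_pdivrMr; lra.
pose K := Num.sqrt (s^-1).
have K0 : 0 < K by rewrite sqrtr_gt0 invr_gt0.
have KE : (K ^+ 2)^-1 = s by rewrite sqr_sqrtr ?invrK// invr_ge0 ltW.
exists K => //.
have := Ex_expN_sqr_cvg (ltW s0) v0 mW H; move=> /cvgrPdist_le/(_ (eta / 4)).
rewrite divr_gt0// => /(_ isT); apply: filterS => n Hn.
apply: le_trans (prob_norm_ge_laplace P K0 (mW n)) _; rewrite KE.
have sv1 : 1 <= 1 + 2 * (s * v) by rewrite lerDl; apply: mulr_ge0 => //; apply: mulr_ge0 => //; exact: ltW.
have low : 1 - eta / 4 <= (Num.sqrt (1 + 2 * (s * v)))^-1.
  have h1 : Num.sqrt (1 + 2 * (s * v)) <= 1 + 2 * (s * v).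
    rewrite -[leRHS]sqr_sqrtr; last by lra.
    by rewrite expr2 ler_peMr ?sqrtr_ge0// -[leLHS]sqrtr1 ler_wsqrtr.
  have h2 : 0 < Num.sqrt (1 + 2 * (s * v)) by rewrite sqrtr_gt0; lra.
  apply: le_trans (_ : (1 + 2 * (s * v))^-1 <= _); last by rewrite lef_pV2 ?posrE//; lra.
  have h3 : (1 + 2 * (s * v)) * (1 + 2 * (s * v))^-1 = 1 by rewrite mulfV//; lra.
  have h4 : (1 + 2 * (s * v))^-1 <= 1 by rewrite invf_le1; lra.
  have h5 : 0 <= (1 + 2 * (s * v))^-1 by rewrite invr_ge0; lra.
  by nra.
by have := le_trans (ler_norm _) Hn; lra.
Qed.

End with_high_probability.

Section asymptotic_linearity.
Context {R : realType} {dT : measure_display} {T : measurableType dT}.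
Variable P : probability T R.
Variable s : nat -> R.
Hypothesis s_inv0 : (fun n => (s n)^-1) @ \oo --> 0.
Hypothesis s_neq0 : \forall n \near \oo, s n != 0.
Local Notation whp := (whp P).
Local Notation tight := (tight P).
Implicit Types Y Z L : nat * T -> R.

(* [Y] estimates [y] with linear part [L]: s (Y - y) = L + o_P(1) and L = O_P(1). *)
Definition asy_linear Y (y : R) L :=
  tight L /\ (fun z => s z.1 * (Y z - y) - L z) @ whp --> 0.

Lemma asy_linear_cvg Y y L : asy_linear Y y L -> Y @ whp --> y.
Proof.
move=> [tL H].
have s0 : (fun z : nat * T => (s z.1)^-1) @ whp --> 0.
  exact: (@whp_cvg_seq _ _ _ P _ _ s_inv0).
have K : (fun z => (s z.1)^-1 * (s z.1 * (Y z - y) - L z) + L z * (s z.1)^-1 + y) @ whp --> (0 * 0 + 0 + y : R).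
  apply: cvgD; last exact: cvg_cst.
  by apply: cvgD; [exact: cvgM|exact: tL].
rewrite mul0r !add0r in K; apply: whp_cvg_near K.
apply: whp_filterS (whp_seq P s_neq0) => z /= sz.
by rewrite mulrBr mulrA mulVf// mul1r [L z * _]mulrC !subrK.
Qed.

Lemma asy_linear_near Y Y' y L : (\forall z \near whp, Y z = Y' z) ->
  asy_linear Y y L -> asy_linear Y' y L.
Proof.
move=> YY' [tL H]; split => //; apply: whp_cvg_near H.
by apply: whp_filterS YY' => z ->.
Qed.

Lemma asy_linear_ext Y Y' y y' L L' : (forall z, Y z = Y' z) -> y = y' -> (forall z, L z = L' z) ->
  asy_linear Y y L -> asy_linear Y' y' L'.
Proof. by move=> /funext -> -> /funext ->. Qed.

Lemma asy_linear_cst (y : R) : asy_linear (fun=> y) y (fun=> 0).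
Proof.
split; first exact: tight_cst.
by apply: (whp_cvg_ext (f := fun=> 0)) => [z|]; [rewrite subrr mulr0 subr0|exact: cvg_cst].
Qed.

Lemma asy_linearD Y y L Z z L' : asy_linear Y y L -> asy_linear Z z L' ->
  asy_linear (fun t => Y t + Z t) (y + z) (fun t => L t + L' t).
Proof.
move=> [tL H] [tL' H']; split; first exact: tightD.
have K : (fun t => (s t.1 * (Y t - y) - L t) + (s t.1 * (Z t - z) - L' t)) @ whp --> (0 + 0 : R).
  exact: cvgD.
rewrite addr0 in K; apply: whp_cvg_ext K => t; ring.
Qed.

Lemma asy_linearM Y y L Z z L' : asy_linear Y y L -> asy_linear Z z L' ->
  asy_linear (fun t => Y t * Z t) (y * z) (fun t => L t * z + y * L' t).
Proof.
move=> AY AZ; have Zz := asy_linear_cvg AZ; case: AY AZ => [tL H] [tL' H']; split.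
  apply: tightD; last exact: tightZ.
  exact: (tightM_cvg tL (cvg_cst z)).
(* Only the middle term pairs a linear part with a vanishing factor; this is where tightness is
   used. *)
have K : (fun t => (s t.1 * (Y t - y) - L t) * Z t + L t * (Z t - z) + y * (s t.1 * (Z t - z) - L' t))
    @ whp --> (0 * z + 0 + y * 0 : R).
  apply: cvgD; last by apply: cvgMl_tmp.
  apply: cvgD; first exact: cvgM.
  apply: tL; rewrite -(subrr z); apply: cvgB => //; exact: cvg_cst.
rewrite mul0r mulr0 !addr0 in K; apply: whp_cvg_ext K => t; ring.
Qed.

Lemma asy_linearZ (c : R) Y y L : asy_linear Y y L ->
  asy_linear (fun t => c * Y t) (c * y) (fun t => c * L t).
Proof.
move=> AY; apply: (asy_linear_ext _ _ _ (asy_linearM (asy_linear_cst c) AY)) => // z.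
by rewrite mul0r add0r.
Qed.

Lemma asy_linearN Y y L : asy_linear Y y L ->
  asy_linear (fun t => - Y t) (- y) (fun t => - L t).
Proof.
by move=> AY; apply: (asy_linear_ext _ _ _ (asy_linearZ (-1) AY)) => *; rewrite mulN1r.
Qed.

Lemma asy_linearB Y y L Z z L' : asy_linear Y y L -> asy_linear Z z L' ->
  asy_linear (fun t => Y t - Z t) (y - z) (fun t => L t - L' t).
Proof. by move=> AY AZ; apply: asy_linearD => //; exact: asy_linearN. Qed.

Lemma asy_linear_sum (I : Type) (r : seq I) (Y : I -> nat * T -> R) (y : I -> R) (L : I -> nat * T -> R) :
  (forall i, asy_linear (Y i) (y i) (L i)) ->
  asy_linear (fun t => \sum_(i <- r) Y i t) (\sum_(i <- r) y i) (fun t => \sum_(i <- r) L i t).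
Proof.
move=> A; elim: r => [|i r IH].
  by apply: (asy_linear_ext _ _ _ (asy_linear_cst 0)) => *; rewrite big_nil.
by apply: (asy_linear_ext _ _ _ (asy_linearD (A i) IH)) => *; rewrite big_cons.
Qed.

(** The delta method, from differentiability at the single point [y]: the difference quotient [phi],
    completed by g' at y, is continuous there, so phi(Y) tends to g' in probability. *)
Lemma asy_linear_comp (g : R -> R) (y g' : R) Y L : is_derive y 1 g g' ->
  asy_linear Y y L -> asy_linear (fun t => g (Y t)) (g y) (fun t => g' * L t).
Proof.
move=> [dg Eg] AY; have Yy := asy_linear_cvg AY; case: AY => [tL H]; split; first exact: tightZ.
pose phi x := if x == y then g' else (g x - g y) / (x - y).
have phiE x : g x - g y = phi x * (x - y).
  rewrite /phi; case: eqVneq => [->|xy]; first by rewrite !subrr mulr0.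
  by rewrite divfK// subr_eq0.
have cphi : phi x @[x --> y] --> g'.
  move: dg => /cvg_ex [l dl].
  have lg' : l = g' by rewrite -Eg; exact/esym/cvg_lim.
  rewrite lg' in dl.
  apply/cvgrPdist_lt => e e0; move/cvgrPdist_lt : dl => /(_ e e0).
  rewrite near_withinE => /nbhs_ballP[d /= d0 Hd]; apply/nbhs_ballP; exists d => // x /= yx.
  rewrite /phi; case: eqVneq => [_|xy]; first by rewrite subrr normr0.
  have := Hd (x - y); rewrite /ball/= sub0r normrN => /(_ _ _).
  rewrite distrC => /(_ yx); rewrite subr_eq0 => /(_ xy).
  by rewrite /GRing.scale/= mulr1 subrK [_ / _]mulrC.
have phiY : (fun t => phi (Y t)) @ whp --> g' by exact: (cvg_comp _ _ Yy cphi).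
have K : (fun t => phi (Y t) * (s t.1 * (Y t - y) - L t) + L t * (phi (Y t) - g'))
    @ whp --> (g' * 0 + 0 : R).
  apply: cvgD; first exact: cvgM.
  apply: tL; rewrite -(subrr g'); apply: cvgB => //; exact: cvg_cst.
rewrite mulr0 addr0 in K; apply: whp_cvg_ext K => t.
by rewrite phiE; ring.
Qed.

End asymptotic_linearity.

(** * Convergence and linearisation of determinants and inverses *)

Section matrix_asymptotics.
Context {R : realType} {dT : measure_display} {T : measurableType dT}.
Variable P : probability T R.
Local Notation whp := (whp P).

Lemma cvg_sum_whp (I : Type) (r : seq I) (Q : pred I) (F : I -> nat * T -> R) (l : I -> R) :
  (forall i, F i @ whp --> l i) ->
  (fun z => \sum_(i <- r | Q i) F i z) @ whp --> \sum_(i <- r | Q i) l i.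
Proof. by move=> H; apply: cvg_big => //; exact: add_continuous. Qed.

Lemma cvg_prod_whp (I : Type) (r : seq I) (Q : pred I) (F : I -> nat * T -> R) (l : I -> R) :
  (forall i, F i @ whp --> l i) ->
  (fun z => \prod_(i <- r | Q i) F i z) @ whp --> \prod_(i <- r | Q i) l i.
Proof.
move=> H; elim: r => [|i r IH].
  rewrite big_nil; apply: (whp_cvg_ext (f := fun=> 1)); first by move=> z; rewrite big_nil.
  exact: cvg_cst.
rewrite big_cons; case: ifP => Qi; last first.
  by apply: whp_cvg_ext IH => z; rewrite big_cons Qi.
have K : (fun z => F i z * \prod_(j <- r | Q j) F j z) @ whp --> l i * \prod_(j <- r | Q j) l j.
  exact: cvgM.
by apply: whp_cvg_ext K => z; rewrite big_cons Qi.
Qed.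

Definition mx_cvg {m n : nat} (M : nat * T -> 'M[R]_(m, n)) (A : 'M[R]_(m, n)) :=
  forall i j, (fun z => M z i j) @ whp --> A i j.

Lemma mx_cvg_mul m n p (M : nat * T -> 'M[R]_(m, n)) (N : nat * T -> 'M[R]_(n, p)) A B :
  mx_cvg M A -> mx_cvg N B -> mx_cvg (fun z => M z *m N z) (A *m B).
Proof.
move=> MA NB i j; have K : (fun z => \sum_k M z i k * N z k j) @ whp --> \sum_k A i k * B k j.
  by apply: cvg_sum_whp => k; apply: cvgM; [exact: MA|exact: NB].
by rewrite mxE; apply: whp_cvg_ext K => z; rewrite mxE.
Qed.

Lemma mx_cvg_cst m n (A : 'M[R]_(m, n)) : mx_cvg (fun=> A) A.
Proof. by move=> i j; exact: cvg_cst. Qed.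

Lemma mx_cvg_tr m n (M : nat * T -> 'M[R]_(m, n)) A :
  mx_cvg M A -> mx_cvg (fun z => (M z)^T) A^T.
Proof. by move=> MA i j; rewrite mxE; apply: whp_cvg_ext (MA j i) => z; rewrite mxE. Qed.

Lemma mx_cvgD m n (M N : nat * T -> 'M[R]_(m, n)) A B :
  mx_cvg M A -> mx_cvg N B -> mx_cvg (fun z => M z + N z) (A + B).
Proof.
move=> MA NB i j; have K : (fun z => M z i j + N z i j) @ whp --> A i j + B i j.
  by apply: cvgD; [exact: MA|exact: NB].
by rewrite mxE; apply: whp_cvg_ext K => z; rewrite mxE.
Qed.

Lemma mx_cvgZ m n (c : nat * T -> R) (l : R) (M : nat * T -> 'M[R]_(m, n)) A :
  c @ whp --> l -> mx_cvg M A -> mx_cvg (fun z => c z *: M z) (l *: A).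
Proof.
move=> cl MA i j; have K : (fun z => c z * M z i j) @ whp --> l * A i j.
  by apply: cvgM => //; exact: MA.
by rewrite mxE; apply: whp_cvg_ext K => z; rewrite mxE.
Qed.

Lemma cvg_det n (M : nat * T -> 'M[R]_n) A :
  mx_cvg M A -> (fun z => \det (M z)) @ whp --> \det A.
Proof.
move=> MA; rewrite /determinant; apply: cvg_sum_whp => p.
by apply: cvgMl_tmp; apply: cvg_prod_whp => i; exact: MA.
Qed.

Lemma cvg_cofactor n (M : nat * T -> 'M[R]_n) A i j :
  mx_cvg M A -> (fun z => cofactor (M z) i j) @ whp --> cofactor A i j.
Proof.
move=> MA; rewrite /cofactor; apply: cvgMl_tmp; apply: cvg_det => k l.
by rewrite !mxE; apply: whp_cvg_ext (MA _ _) => z; rewrite !mxE.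
Qed.

Lemma near_unitmx n (M : nat * T -> 'M[R]_n) A :
  mx_cvg M A -> A \in unitmx -> \forall z \near whp, M z \in unitmx.
Proof.
move=> MA; rewrite unitmxE unitfE => dA.
apply: whp_filterS (cvgr_neq0 _ (cvg_det MA) dA) => z.
by rewrite unitmxE unitfE.
Qed.

Lemma mx_cvg_inv n (M : nat * T -> 'M[R]_n) A :
  mx_cvg M A -> A \in unitmx -> mx_cvg (fun z => invmx (M z)) (invmx A).
Proof.
move=> MA uA i j.
have H : (fun z => (\det (M z))^-1 * cofactor (M z) j i) @ whp --> (\det A)^-1 * cofactor A j i.
  apply: cvgM; last exact: cvg_cofactor.
  by apply: cvgV; [rewrite -unitfE -unitmxE|exact: cvg_det].
have -> : invmx A i j = (\det A)^-1 * cofactor A j i by rewrite /invmx uA !mxE.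
(* [invmx] returns a singular matrix unchanged, so the cofactor formula holds only where [M z] is
   invertible, an event of probability tending to 1. *)
apply: whp_cvg_near H.
by apply: whp_filterS (near_unitmx MA uA) => z uM; rewrite /invmx uM !mxE.
Qed.

Variable s : nat -> R.
Hypothesis s_inv0 : (fun n => (s n)^-1) @ \oo --> 0.
Hypothesis s_neq0 : \forall n \near \oo, s n != 0.
Local Notation asy_linear := (asy_linear P s).

Section square.
Variables (n : nat) (M : nat * T -> 'M[R]_n) (A : 'M[R]_n) (L : nat * T -> 'M[R]_n).
Hypothesis AM : forall i j, asy_linear (fun z => M z i j) (A i j) (fun z => L z i j).

Lemma asy_linear_mx_cvg : mx_cvg M A.
Proof. by move=> i j; exact: (asy_linear_cvg s_inv0 s_neq0 (AM i j)). Qed.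

(* Telescoping over the rows: [mix k] has its first [k] rows from [A], the others from [M]. *)
Lemma asy_linear_det : asy_linear (fun z => \det (M z)) (\det A)
  (fun z => \sum_i \sum_j cofactor A i j * L z i j).
Proof.
pose mix (k : nat) z : 'M[R]_n := \matrix_(i, j) if (i < k)%N then A i j else M z i j.
have mix_cvg k : mx_cvg (mix k) A.
  move=> i j; case E : (i < k)%N.
    by apply: (whp_cvg_ext (f := fun=> A i j)) => [z|]; [rewrite mxE E|exact: cvg_cst].
  have K := asy_linear_mx_cvg; apply: whp_cvg_ext (K i j) => z; by rewrite mxE E.
have step z (i : 'I_n) : \det (mix i z) - \det (mix i.+1 z) =
    \sum_j (M z i j - A i j) * cofactor (mix i z) i j.
  rewrite (expand_det_row _ i) [\det (mix i.+1 z)](expand_det_row _ i) -sumrB.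
  apply: eq_bigr => j _; rewrite mulrBl !mxE ltnn ltnSn; congr (_ - _ * _).
  (* The minors delete row i, the only row in which the two matrices differ. *)
  rewrite /cofactor; congr (_ * \det _); apply/matrixP => k l; rewrite !mxE.
  by have := neq_lift i k; rewrite -val_eqE/= ltnS [(_ <= i)%N]leq_eqVlt eq_sym => /negbTE ->.
have tele z : \det (M z) - \det A = \sum_i \sum_j (M z i j - A i j) * cofactor (mix i z) i j.
  rewrite -(eq_bigr _ (fun i _ => step z i)).
  rewrite -(big_mkord xpredT (fun i => \det (mix i z) - \det (mix i.+1 z))).
  rewrite (eq_bigr (fun i : nat => - (\det (mix i.+1 z) - \det (mix i z)))); last by move=> i _; rewrite opprB.
  rewrite sumrN (telescope_sumr (fun i => \det (mix i z)) (leq0n n)) opprB.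
  congr (_ - _); congr (determinant _).
    by apply/matrixP => i j; rewrite mxE.
  by apply/matrixP => i j; rewrite mxE ltn_ord.
split.
  by apply: tight_sum => i; apply: tight_sum => j; apply: tightZ; have [] := AM i j.
have K : (fun z => \sum_i \sum_j ((s z.1 * (M z i j - A i j) - L z i j) * cofactor (mix i z) i j
    + L z i j * (cofactor (mix i z) i j - cofactor A i j))) @ whp --> (\sum_(i < n) \sum_(j < n) (0 * cofactor A i j + 0) : R).
  apply: cvg_sum_whp => i; apply: cvg_sum_whp => j; have [tL H] := AM i j; apply: cvgD.
    by apply: cvgM => //; exact: cvg_cofactor.
  apply: tL; rewrite -(subrr (cofactor A i j)); apply: cvgB; [exact: cvg_cofactor|exact: cvg_cst].
rewrite big1 in K; last by move=> i _; rewrite big1// => j _; rewrite mul0r addr0.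
apply: whp_cvg_ext K => z; rewrite tele mulr_sumr -sumrB; apply: eq_bigr => i _.
by rewrite mulr_sumr -sumrB; apply: eq_bigr => j _; ring.
Qed.

(** Rests on M^-1 - A^-1 = - M^-1 (M - A) A^-1, valid where M is invertible; replacing the remaining
    M^-1 by its limit costs o_P(1) by tightness. *)
Lemma asy_linear_invmx a b : A \in unitmx ->
  asy_linear (fun z => invmx (M z) a b) (invmx A a b) (fun z => - (invmx A *m L z *m invmx A) a b).
Proof.
move=> uA; have Mc := asy_linear_mx_cvg; have Mi := mx_cvg_inv Mc uA.
have mulE (B C D : 'M[R]_n) : (B *m C *m D) a b = \sum_l \sum_k C k l * (B a k * D l b).
  by rewrite !mxE; apply: eq_bigr => l _; rewrite mxE mulr_suml; apply: eq_bigr => k _; ring.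
pose L' z := - \sum_l \sum_k (invmx A a k * invmx A l b) * L z k l.
apply: (asy_linear_ext (L := L')) => // [z|].
  by rewrite mulE /L'; congr (- _); apply: eq_bigr => l _; apply: eq_bigr => k _; rewrite mulrC.
split.
  apply: (_ : tight P (fun z => - _)) => V V0.
  have tS : tight P (fun z => \sum_l \sum_k (invmx A a k * invmx A l b) * L z k l).
    by apply: tight_sum => l; apply: tight_sum => k; apply: tightZ; have [] := AM k l.
  have H := tightZ (-1) tS V0; apply: whp_cvg_ext H => z; rewrite /L'; ring.
have K : (fun z => \sum_l \sum_k - ((s z.1 * (M z k l - A k l) - L z k l) * (invmx (M z) a k * invmx A l b)
    + L z k l * (invmx (M z) a k * invmx A l b - invmx A a k * invmx A l b))) @ whp
    --> (\sum_(l < n) \sum_(k < n) - (0 * (invmx A a k * invmx A l b) + 0) : R).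
  apply: cvg_sum_whp => l; apply: cvg_sum_whp => k; have [tL H] := AM k l; apply: cvgN.
  have c1 : (fun z => invmx (M z) a k * invmx A l b) @ whp --> invmx A a k * invmx A l b.
    by apply: cvgMr_tmp; exact: Mi.
  apply: cvgD; first exact: cvgM.
  by apply: tL; rewrite -(subrr (invmx A a k * invmx A l b)); apply: cvgB => //; exact: cvg_cst.
rewrite big1 in K; last by move=> l _; rewrite big1// => k _; rewrite mul0r addr0 oppr0.
apply: whp_cvg_near K; apply: whp_filterS (near_unitmx Mc uA) => z uM /=.
have -> : invmx (M z) a b - invmx A a b = - (invmx (M z) *m (M z - A) *m invmx A) a b.
  rewrite mulmxBr mulVmx// mulmxBl mul1mx -mulmxA mulmxV// mulmx1 !mxE; ring.
rewrite mulE /L' -sumrN mulr_sumr -sumrN -sumrB; apply: eq_bigr => l _.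
rewrite -sumrN mulr_sumr -sumrN -sumrB; apply: eq_bigr => k _.
by rewrite !mxE; ring.
Qed.

End square.
End matrix_asymptotics.

(** * Vectorised matrices *)

Section vectorisation.
Context {R : realType} {d : nat}.
Implicit Types (B C : 'M[R]_d) (x w : 'cV[R]_d) (u : 'rV[R]_d).

Lemma vec_index_bij : bijective (fun q : 'I_(d * d) => (vrow q, vcol q)).
Proof.
apply: inj_card_bij; last by rewrite card_prod !card_ord.
move=> q q' [e1 e2]; apply: val_inj => /=.
by rewrite (divn_eq q d) (divn_eq q' d) e1 e2.
Qed.

Lemma sum_vec_index (F : 'I_d -> 'I_d -> R) :
  \sum_q F (vrow q) (vcol q) = \sum_i \sum_j F i j.
Proof.
rewrite pair_big/= (reindex (fun q : 'I_(d * d) => (vrow q, vcol q)))//=.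
by apply: onW_bij; exact: vec_index_bij.
Qed.

Lemma vecmx_dot B C : ((vecmx B)^T *m vecmx C) 0 0 = \sum_i \sum_j B i j * C i j.
Proof.
rewrite -(sum_vec_index (fun i j => B i j * C i j)) mxE.
by apply: eq_bigr => q _; rewrite !mxE.
Qed.

Lemma vecmx1_dot C : ((vecmx (1%:M : 'M[R]_d))^T *m vecmx C) 0 0 = \tr C.
Proof.
rewrite vecmx_dot; apply: eq_bigr => i _.
rewrite (bigD1 i)//= big1 ?addr0 => [|j ji]; first by rewrite mxE eqxx mul1r.
by rewrite mxE eq_sym (negbTE ji) mul0r.
Qed.

Lemma kron_row_dot u C : (kron_row u u *m vecmx C) 0 0 = (u *m C *m u^T) 0 0.
Proof.
transitivity (\sum_i \sum_j u 0 i * C i j * u 0 j).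
  rewrite -(sum_vec_index (fun i j => u 0 i * C i j * u 0 j)) mxE.
  by apply: eq_bigr => q _; rewrite !mxE; ring.
rewrite exchange_big mxE; apply: eq_bigr => j _.
by rewrite !mxE mulr_suml.
Qed.

(** [Dtilde x] is minus the Jacobian of the map from x to vec(x x^T); the three cases of its
    definition are those of the product rule. *)
Lemma Dtilde_mul x w q :
  (Dtilde x *m w) q 0 = - (x (vrow q) 0 * w (vcol q) 0) - x (vcol q) 0 * w (vrow q) 0.
Proof.
rewrite mxE; set a := vcol q; set r := vrow q.
have pick i (f : 'I_d -> R) : \sum_s (s == i)%:R * f s = f i.
  rewrite (bigD1 i)//= eqxx mul1r big1 ?addr0// => s si.
  by rewrite (negbTE si) mul0r.
transitivity (\sum_s ((s == a)%:R * (- (x r 0 * w s 0)) + (s == r)%:R * (- (x a 0 * w s 0)))).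
  apply: eq_bigr => s _; rewrite mxE /= -/a -/r.
  have [ar|ar] := eqVneq a r.
    by rewrite -ar [a == s]eq_sym; have [->|sa] := eqVneq s a; rewrite ?eqxx /=; ring.
  rewrite [r == s]eq_sym.
  have [->|sa] := eqVneq s a; first by rewrite (negbTE ar)/=; ring.
  by have [_|_] := eqVneq s r; rewrite /=; ring.
by rewrite big_split/= !pick.
Qed.

(** If [w] and [C] are the linear parts of the first and second moments, then [S] is that of the
    covariance E XX^T - x x^T. It collapses the two blocks of [Amat] into one functional of the
    covariance. *)
Lemma vecmx_cov_linear (x w : 'cV[R]_d) (C S : 'M[R]_d) :
  (forall a b, S a b = C a b - x a 0 * w b 0 - x b 0 * w a 0) ->
  Dtilde x *m w + vecmx C = vecmx S.
Proof.
by move=> H; apply/colP => q; rewrite mxE Dtilde_mul !mxE H; ring.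
Qed.

End vectorisation.

Lemma is_derive_inv {R : realType} (x : R) : x != 0 ->
  is_derive x 1 (fun y : R => y^-1) (- x ^- 2).
Proof.
move=> x0; have := @is_deriveV R id x 1 1 x0 (is_derive_id _ _).
by rewrite /GRing.scale/= mulr1.
Qed.

Lemma is_derive_inv_sqr {R : realType} (x : R) : x != 0 ->
  is_derive x 1 (fun y : R => (y ^+ 2)^-1) (- 2 * x ^- 3).
Proof.
move=> x0.
have dX : is_derive x 1 (fun y : R => y ^+ 2) (2 * x).
  by apply: is_derive_eq; rewrite /GRing.scale/=; ring.
have x2 : x ^+ 2 != 0 by rewrite expf_neq0.
apply: (is_derive_eq (@is_deriveV R (fun y => y ^+ 2) x (2 * x) 1 x2 dX)).
by rewrite /GRing.scale/=; field.
Qed.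

(** * Delta method for the four coefficients of variation *)

Section mcv_linearisation.
Context {R : realType} {dT : measure_display} {T : measurableType dT}.
Variable P : probability T R.
Variable s : nat -> R.
Hypothesis s_inv0 : (fun n => (s n)^-1) @ \oo --> 0.
Hypothesis s_neq0 : \forall n \near \oo, s n != 0.
Local Notation asy_linear := (asy_linear P s).

Definition mx_asy_linear {m n} (M : nat * T -> 'M[R]_(m, n)) (A : 'M[R]_(m, n))
  (L : nat * T -> 'M[R]_(m, n)) :=
  forall i j, asy_linear (fun z => M z i j) (A i j) (fun z => L z i j).

Lemma mx_asy_linear_mul m n p (M : nat * T -> 'M[R]_(m, n)) A L
    (N : nat * T -> 'M[R]_(n, p)) B K :
  mx_asy_linear M A L -> mx_asy_linear N B K ->
  mx_asy_linear (fun z => M z *m N z) (A *m B) (fun z => L z *m B + A *m K z).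
Proof.
move=> HM HN i j.
have H : asy_linear (fun z => \sum_k M z i k * N z k j) (\sum_k A i k * B k j)
    (fun z => \sum_k (L z i k * B k j + A i k * K z k j)).
  by apply: asy_linear_sum => k; apply: (asy_linearM s_inv0 s_neq0).
apply: (asy_linear_ext _ _ _ H) => [z||z]; rewrite ?mxE// big_split/=.
by congr (_ + _); rewrite mxE.
Qed.

Lemma mx_asy_linear_tr m n (M : nat * T -> 'M[R]_(m, n)) A L :
  mx_asy_linear M A L -> mx_asy_linear (fun z => (M z)^T) A^T (fun z => (L z)^T).
Proof. by move=> HM i j; apply: (asy_linear_ext _ _ _ (HM j i)) => *; rewrite mxE. Qed.

Lemma asy_linear_dotv n (u w : nat * T -> 'cV[R]_n) u0 w0 Lu Lw :
  mx_asy_linear u u0 Lu -> mx_asy_linear w w0 Lw ->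
  asy_linear (fun z => dotv (u z) (w z)) (dotv u0 w0) (fun z => dotv (Lu z) w0 + dotv u0 (Lw z)).
Proof.
move=> Hu Hw; have := mx_asy_linear_mul (mx_asy_linear_tr Hu) Hw.
by move=> /(_ 0 0); apply: asy_linear_ext => // z; rewrite mxE.
Qed.

Lemma dotvC n (u w : 'cV[R]_n) : dotv u w = dotv w u.
Proof. by rewrite /dotv !mxE; apply: eq_bigr => i _; rewrite !mxE mulrC. Qed.

(** The outer derivative: [Amat] is the gradient of an inner quantity g, and C is g^(1/(2d)) for RR,
    g^(1/2) for VV and AZ, g^(-1/2) for VN. The derivative is written in terms of c = C; for RR it
    is c^(1-2d)/(2d). *)
Definition mcv_scale d v (c : R) : R :=
  match v with
  | RR => (2 * d%:R)^-1 * (c / c ^+ (2 * d))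
  | VV | AZ => (2 * c)^-1
  | VN => - (c ^+ 3 / 2)
  end.

Lemma mcv_scale_sqr d v c : (0 < d)%N -> 0 < c -> mcv_scale d v c ^+ 2 = Sfac d v c / 4.
Proof.
move=> d0 c0; have cn : c != 0 by rewrite lt0r_neq0.
have dn : (d%:R : R) != 0 by rewrite pnatr_eq0 -lt0n.
case: v => /=; try by field.
have -> : c ^ ((2 : int) - (4 * d)%:Z) = c ^+ 2 / c ^+ (4 * d) by rewrite expfzDr// exprnN.
have -> : c ^+ (4 * d) = (c ^+ (2 * d)) ^+ 2 by rewrite -exprM mulnAC.
move: (expf_neq0 (2 * d) cn); move: (c ^+ (2 * d)) => e e0.
by field; rewrite e0 dn.
Qed.

(** The sign conditions under which every root, inverse and quotient of the coefficient is
    differentiable; [regular_pop] derives them for the population. *)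
Definition mcv_regular {d} v (mu : 'cV[R]_d) (S : 'M[R]_d) : Prop :=
  [/\ S^T = S, 0 < dotv mu mu &
  match v with
  | RR => 0 < \det S
  | VV => 0 < \tr S
  | VN => S \in unitmx /\ 0 < dotv mu (invmx S *m mu)
  | AZ => 0 < dotv mu (S *m mu)
  end].

Lemma MCV_gt0 d v (mu : 'cV[R]_d) S : mcv_regular v mu S -> 0 < MCV v mu S.
Proof.
move=> [_ m0 H]; case: v H => /= H; rewrite sqrtr_gt0.
- by rewrite divr_gt0// powR_gt0.
- by rewrite divr_gt0.
- by case: H => _ H; rewrite invr_gt0.
- by rewrite divr_gt0// exprn_gt0.
Qed.

Section one_group.
Variables (d : nat) (v : mcv_variant) (mu : 'cV[R]_d) (S : 'M[R]_d).
Variables (muh : nat * T -> 'cV[R]_d) (Sh : nat * T -> 'M[R]_d).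
Variables (Lmu : nat * T -> 'cV[R]_d) (LM : nat * T -> 'M[R]_d).
(** Differential of the covariance as second moment minus mu mu^T, with [LM] and [Lmu] the linear
    parts of the second and first moments. *)
Let LS z : 'M[R]_d := \matrix_(a, b) (LM z a b - mu a 0 * Lmu z b 0 - mu b 0 * Lmu z a 0).
Hypothesis Hmu : mx_asy_linear muh mu Lmu.
Hypothesis HS : mx_asy_linear Sh S LS.

Let LSE z : Dtilde mu *m Lmu z + vecmx (LM z) = vecmx (LS z).
Proof. by apply: vecmx_cov_linear => a b; rewrite mxE. Qed.

Let m2 := dotv mu mu.
Let D z := dotv mu (Lmu z).

Let dotvE (u w : 'cV[R]_d) : (u^T *m w) 0 0 = dotv u w. Proof. by []. Qed.

Let AL_m2 : asy_linear (fun z => dotv (muh z) (muh z)) m2 (fun z => 2 * D z).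
Proof.
apply: (asy_linear_ext _ _ _ (asy_linear_dotv Hmu Hmu)) => // z.
by rewrite dotvC /D; ring.
Qed.

Let scalarE (e : R) (C : 'M[R]_(1, 1)) : (e *: C) 0 0 = e * C 0 0. Proof. by rewrite mxE. Qed.
Let addE (B C : 'M[R]_(1, 1)) : (B + C) 0 0 = B 0 0 + C 0 0. Proof. by rewrite mxE. Qed.
Let oppE (C : 'M[R]_(1, 1)) : (- C) 0 0 = - C 0 0. Proof. by rewrite mxE. Qed.

Lemma asy_linear_VV : mcv_regular VV mu S ->
  asy_linear (fun z => MCV VV (muh z) (Sh z)) (MCV VV mu S)
   (fun z => mcv_scale d VV (MCV VV mu S) * (Amat VV mu S *m col_mx (Lmu z) (vecmx (LM z))) 0 0).
Proof.
move=> reg; have [_ m0 t0] := reg; have c0 := MCV_gt0 reg.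
have m20 : m2 != 0 by rewrite lt0r_neq0.
have ALt : asy_linear (fun z => \tr (Sh z)) (\tr S) (fun z => \tr (LS z)).
  by apply: asy_linear_sum => i; exact: HS.
have dV := is_derive_inv m20.
have ALq := asy_linearM s_inv0 s_neq0 ALt (asy_linear_comp s_inv0 s_neq0 dV AL_m2).
have q0 : 0 < \tr S / m2 by rewrite divr_gt0.
have := asy_linear_comp s_inv0 s_neq0 (is_derive1_sqrt q0) ALq.
apply: asy_linear_ext => // z.
rewrite /mcv_scale /MCV -/m2 /Amat -/m2 mul_row_col mulmxDl -!scalemxAl -mulmxA -addrA -scalerDr -mulmxDr LSE.
rewrite addE !scalarE vecmx1_dot dotvE -/(D z); congr (_ * _).
by field.
Qed.

Lemma asy_linear_AZ : mcv_regular AZ mu S ->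
  asy_linear (fun z => MCV AZ (muh z) (Sh z)) (MCV AZ mu S)
   (fun z => mcv_scale d AZ (MCV AZ mu S) * (Amat AZ mu S *m col_mx (Lmu z) (vecmx (LM z))) 0 0).
Proof.
move=> reg; have [Ssym m0 t0] := reg; have c0 := MCV_gt0 reg.
have m20 : m2 != 0 by rewrite lt0r_neq0.
have ALt := asy_linear_dotv Hmu (mx_asy_linear_mul HS Hmu).
have dV := is_derive_inv_sqr m20.
have ALq := asy_linearM s_inv0 s_neq0 ALt (asy_linear_comp s_inv0 s_neq0 dV AL_m2).
have q0 : 0 < dotv mu (S *m mu) / m2 ^+ 2 by rewrite divr_gt0// exprn_gt0.
have := asy_linear_comp s_inv0 s_neq0 (is_derive1_sqrt q0) ALq.
apply: asy_linear_ext => // z.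
rewrite /mcv_scale /MCV -/m2 /Amat -/m2 mul_row_col !mulmxDl -!scalemxAl -(mulmxA (kron_row _ _) (Dtilde _)) -!addrA -scalerDr -mulmxDr LSE.
rewrite !addE !scalarE kron_row_dot dotvE -/(D z); congr (_ * _).
have e1 : dotv (Lmu z) (S *m mu) = (mu^T *m S *m Lmu z) 0 0.
  by rewrite dotvC /dotv trmx_mul Ssym.
have e2 : dotv mu (LS z *m mu + S *m Lmu z) = (mu^T *m LS z *m mu) 0 0 + (mu^T *m S *m Lmu z) 0 0.
  by rewrite /dotv mulmxDr !mulmxA mxE.
rewrite e1 e2 trmxK; field.
by rewrite lt0r_neq0// lt0r_neq0.
Qed.

Lemma asy_linear_VN : mcv_regular VN mu S ->
  asy_linear (fun z => MCV VN (muh z) (Sh z)) (MCV VN mu S)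
   (fun z => mcv_scale d VN (MCV VN mu S) * (Amat VN mu S *m col_mx (Lmu z) (vecmx (LM z))) 0 0).
Proof.
move=> reg; have [Ssym m0 [uS t0]] := reg; have c0 := MCV_gt0 reg.
have ALi : mx_asy_linear (fun z => invmx (Sh z)) (invmx S) (fun z => - (invmx S *m LS z *m invmx S)).
  move=> a b; apply: (asy_linear_ext _ _ _ (asy_linear_invmx s_inv0 s_neq0 HS a b uS)) => // z.
  by rewrite [RHS]mxE.
have ALt := asy_linear_dotv Hmu (mx_asy_linear_mul ALi Hmu).
set g := dotv mu _ in t0 ALt.
have g0 : g != 0 by rewrite lt0r_neq0.
have dV := is_derive_inv g0.
have q0 : 0 < g^-1 by rewrite invr_gt0.
have := asy_linear_comp s_inv0 s_neq0 (is_derive1_sqrt q0) (asy_linear_comp s_inv0 s_neq0 dV ALt).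
apply: asy_linear_ext => // z.
rewrite /mcv_scale /MCV -/g /Amat mul_row_col mulmxDl !mulNmx -(mulmxA (kron_row _ _) (Dtilde _)) -addrA -opprD -mulmxDr LSE.
rewrite -scalemxAl addE scalarE oppE kron_row_dot.
have isym : (invmx S)^T = invmx S by rewrite trmx_inv Ssym.
set u := mu^T *m invmx S.
have e1 : dotv (Lmu z) (invmx S *m mu) = (u *m Lmu z) 0 0.
  by rewrite dotvC /dotv trmx_mul isym.
have e2 : dotv mu (- (invmx S *m LS z *m invmx S *m mu) + invmx S *m Lmu z) =
   - (u *m LS z *m u^T) 0 0 + (u *m Lmu z) 0 0.
  by rewrite /dotv mulmxDr mulmxN !mulmxA addE oppE /u trmx_mul isym trmxK !mulmxA.
rewrite e1 e2; set w := Num.sqrt g^-1.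
have w0 : 0 < w by rewrite sqrtr_gt0.
have -> : g ^- 2 = w ^+ 4 by rewrite (exprM w 2 2) sqr_sqrtr ?exprVn// ltW.
by field; rewrite lt0r_neq0.
Qed.

Lemma asy_linear_RR : (0 < d)%N -> mcv_regular RR mu S ->
  asy_linear (fun z => MCV RR (muh z) (Sh z)) (MCV RR mu S)
   (fun z => mcv_scale d RR (MCV RR mu S) * (Amat RR mu S *m col_mx (Lmu z) (vecmx (LM z))) 0 0).
Proof.
move=> d0 reg; have [Ssym m0 t0] := reg; have c0 := MCV_gt0 reg.
have m20 : m2 != 0 by rewrite lt0r_neq0.
have dn : (d%:R : R) != 0 by rewrite pnatr_eq0 -lt0n.
have uS : S \in unitmx by rewrite unitmxE unitfE lt0r_neq0.
have isym : (invmx S)^T = invmx S by rewrite trmx_inv Ssym.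
pose tS z := ((vecmx (invmx S))^T *m vecmx (LS z)) 0 0.
have ALd : asy_linear (fun z => \det (Sh z)) (\det S) (fun z => \det S * tS z).
  apply: (asy_linear_ext _ _ _ (asy_linear_det s_inv0 s_neq0 HS)) => // z.
  rewrite /tS vecmx_dot mulr_sumr; apply: eq_bigr => i _; rewrite mulr_sumr; apply: eq_bigr => j _.
  rewrite -isym mxE /invmx uS !mxE mulrA mulrA divff ?mul1r// lt0r_neq0//.
have dV := is_derive_inv m20.
have ALp := asy_linear_comp s_inv0 s_neq0 (is_derive1_powR (d%:R^-1) t0) ALd.
have ALq := asy_linearM s_inv0 s_neq0 ALp (asy_linear_comp s_inv0 s_neq0 dV AL_m2).
have q0 : 0 < powR (\det S) d%:R^-1 / m2 by rewrite divr_gt0// powR_gt0.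
have := asy_linear_comp s_inv0 s_neq0 (is_derive1_sqrt q0) ALq.
apply: asy_linear_ext => // z.
rewrite /mcv_scale /MCV -/m2 /Amat -/m2 mul_row_col mulmxDl -!scalemxAl -mulmxA -addrA -scalerDr -mulmxDr LSE.
rewrite addE !scalarE dotvE -/(D z) -/(tS z).
set e := powR (\det S) d%:R^-1; set c := Num.sqrt (e / m2).
have e0 : 0 < e by rewrite powR_gt0.
have -> : powR (\det S) (d%:R^-1 - 1) = e / \det S.
  by rewrite powRB ?powRr1 ?(ltW t0)//; apply/implyP => _; rewrite lt0r_neq0.
(* Eliminating the real powers in favour of [c], [m2] and the determinant leaves an identity of
   rational functions. *)
have cE : c ^+ 2 = e / m2 by rewrite sqr_sqrtr// ltW.
have ed : e ^+ d = \det S.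
  by rewrite -powR_mulrn ?(ltW e0)// /e -powRrM mulVf// powRr1// ltW.
have cd : c ^+ (2 * d) = \det S / m2 ^+ d by rewrite exprM cE exprMn exprVn ed.
have c0' : c != 0 by rewrite lt0r_neq0// sqrtr_gt0.
have t0' : \det S != 0 by rewrite lt0r_neq0.
rewrite cd (exprS m2 d).
have -> : e = c ^+ 2 * m2 by rewrite cE divfK.
move: (m2 ^+ d) (expf_neq0 d m20) => md md0.
by field; rewrite c0' md0 m20 t0' dn.
Qed.

Lemma asy_linear_MCV : (0 < d)%N -> mcv_regular v mu S ->
  asy_linear (fun z => MCV v (muh z) (Sh z)) (MCV v mu S)
   (fun z => mcv_scale d v (MCV v mu S) * (Amat v mu S *m col_mx (Lmu z) (vecmx (LM z))) 0 0).
Proof.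
by move=> d0; case: v => reg; [exact: asy_linear_RR|exact: asy_linear_VV|exact: asy_linear_VN|exact: asy_linear_AZ].
Qed.

End one_group.
End mcv_linearisation.

(** * Weak convergence to the chi-squared distribution *)

Section bernstein.
Context {R : realType}.
Implicit Types (f g : nat -> R) (u : R).

(* [(bernstein N f).[u]] is the expectation of [f] at a binomial(N, u) variable. *)
Fixpoint bernstein (N : nat) f : {poly R} :=
  if N is N'.+1 then 'X * bernstein N' (fun k => f k.+1) + (1 - 'X) * bernstein N' f
  else (f 0%N)%:P.

Lemma bernsteinS N f u : (bernstein N.+1 f).[u] =
  u * (bernstein N (fun k => f k.+1)).[u] + (1 - u) * (bernstein N f).[u].
Proof. by rewrite /= !hornerE. Qed.

Lemma bernsteinD N f g u :
  (bernstein N (fun k => f k + g k)).[u] = (bernstein N f).[u] + (bernstein N g).[u].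
Proof.
elim: N f g => [|N IH] f g; first by rewrite /= !hornerE.
by rewrite !bernsteinS !IH; ring.
Qed.

Lemma bernsteinZ N f (c : R) u :
  (bernstein N (fun k => c * f k)).[u] = c * (bernstein N f).[u].
Proof.
elim: N f => [|N IH] f; first by rewrite /= !hornerE.
by rewrite !bernsteinS !IH; ring.
Qed.

Lemma bernstein_cst N (c : R) u : (bernstein N (fun=> c)).[u] = c.
Proof. by elim: N => [|N IH]; [rewrite /= !hornerE|rewrite bernsteinS IH; ring]. Qed.

Lemma bernstein_le N f g u : 0 <= u <= 1 -> (forall k, (k <= N)%N -> f k <= g k) ->
  (bernstein N f).[u] <= (bernstein N g).[u].
Proof.
move=> /andP[u0 u1]; elim: N f g => [|N IH] f g fg; first by rewrite /= !hornerE fg.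
rewrite !bernsteinS lerD// ler_wpM2l ?subr_ge0//; apply: IH => k kN; apply: fg => //.
exact: leq_trans kN _.
Qed.

(** Bias squared plus binomial variance. The centre [c] is arbitrary because the induction shifts it
    by 1. *)
Lemma bernstein_variance N (c : R) u :
  (bernstein N (fun k => (k%:R - c) ^+ 2)).[u] = (N%:R * u - c) ^+ 2 + N%:R * u * (1 - u).
Proof.
elim: N c => [|N IH] c; first by rewrite /= !hornerE; ring.
rewrite bernsteinS IH (_ : bernstein N _ = bernstein N (fun k => (k%:R - (c - 1)) ^+ 2)).
  by rewrite IH -natr1; ring.
by congr bernstein; apply/funext => k; rewrite -natr1; congr (_ ^+ 2); ring.
Qed.

(** Chebyshev's argument with z <= eta + z^2/eta in place of a case distinction: the increment of
    [h] is averaged against the binomial law, and the quadratic term is its variance. *)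
Lemma bernstein_lipschitz (h : R -> R) (K : R) : 0 <= K ->
  (forall u v, `|h u - h v| <= K * `|u - v|) ->
  forall e, 0 < e -> exists p : {poly R}, forall u, 0 <= u <= 1 -> `|p.[u] - h u| <= e.
Proof.
move=> K0 hK e e0.
(* K eta <= e/2, and N eta^2 >= 1 keeps the variance term below K eta as well. *)
pose eta := e / (2 * (K + 1)).
have K1 : 0 < K + 1 by rewrite ltr_wpDl.
have eta0 : 0 < eta by rewrite divr_gt0// mulr_gt0.
pose N := (Num.truncn (eta ^- 2)).+1.
have N0 : (0 : R) < N%:R by rewrite ltr0n.
have NE : N%:R * eta ^+ 2 >= 1.
  by rewrite -ler_pdivrMr ?exprn_gt0// div1r ltW// truncnS_gt.
exists (bernstein N (fun k => h (k%:R / N%:R))) => u u01.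
have [u0 u1] := andP u01.
have key : (bernstein N (fun k => `|h (k%:R / N%:R) - h u|)).[u] <= e.
  apply: (@le_trans _ _ (bernstein N (fun k => K * eta + K / (eta * N%:R ^+ 2) * (k%:R - N%:R * u) ^+ 2)).[u]).
    apply: bernstein_le => // k _; apply: le_trans (hK _ _) _.
    rewrite (_ : _ + _ = K * (eta + ((k%:R / N%:R - u) ^+ 2) / eta)); last first.
      by field; rewrite !lt0r_neq0.
    rewrite ler_wpM2l// -[X in _ + X / _]real_normK ?num_real//; move: `|_| (normr_ge0 (k%:R / N%:R - u)) => z z0.
    rewrite -(ler_pM2r eta0) mulrDl divfK ?lt0r_neq0//; have := sqr_ge0 (z - eta); nra.
  rewrite bernsteinD bernstein_cst bernsteinZ bernstein_variance subrr expr0n/= add0r.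
  rewrite (_ : K / _ * _ = K * (u * (1 - u)) / (eta * N%:R)); last by field; rewrite !lt0r_neq0.
  have u4 : u * (1 - u) <= 1 by nra.
  have uu : 0 <= u * (1 - u) by rewrite mulr_ge0 ?subr_ge0.
  have hh : K * (u * (1 - u)) / (eta * N%:R) <= K * eta.
    have eN : 0 < eta * N%:R by exact: mulr_gt0.
    rewrite (ler_pdivrMr _ _ eN) [leRHS](_ : _ = K * (N%:R * eta ^+ 2)); last by ring.
    by rewrite ler_wpM2l//; apply: le_trans u4 _.
  have : K * eta <= e / 2.
    rewrite /eta (_ : K * _ = e / 2 * (K / (K + 1))); last by field; rewrite lt0r_neq0.
    by rewrite ler_piMr ?divr_ge0 ?(ltW e0)// ler_pdivrMr; lra.
  by lra.
set f := fun k : nat => h (k%:R / N%:R).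
set B := (bernstein N (fun k => `|h (k%:R / N%:R) - h u|)).[u] in key.
have up : (bernstein N f).[u] <= h u + B.
  rewrite -[in leRHS](bernstein_cst N (h u) u) /B -bernsteinD; apply: bernstein_le => // k _.
  by have := ler_norm (f k - h u); rewrite /f; lra.
have low : h u - B <= (bernstein N f).[u].
  rewrite -mulN1r -[X in X + _](bernstein_cst N (h u) u) /B -bernsteinZ -bernsteinD; apply: bernstein_le => // k _.
  by have := ler_norm (- (f k - h u)); rewrite normrN /f; lra.
by rewrite ler_norml; apply/andP; split; lra.
Qed.

End bernstein.

Lemma measurable_sqrt {R : realType} : measurable_fun setT (Num.sqrt : R -> R).
Proof. by apply: continuous_measurable_fun; exact: sqrt_continuous. Qed.

(* Inversion is discontinuous at 0, where 0^-1 = 0: it is the limit of [x / (x ^ 2 + 1 / n)]. *)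
Lemma measurable_inv {R : realType} : measurable_fun setT (GRing.inv : R -> R).
Proof.
pose h (n : nat) (x : R) := x / (x ^+ 2 + n.+1%:R^-1).
have pos (n : nat) (x : R) : 0 < x ^+ 2 + n.+1%:R^-1 by rewrite ltr_wpDl ?sqr_ge0// invr_gt0.
apply: (@measurable_fun_cvg _ _ R setT h) => [n|x _].
  apply: continuous_measurable_fun => x; apply: cvgM; first exact: cvg_id.
  apply: cvgV; first by rewrite lt0r_neq0.
  by apply: cvgD; [exact: sqr_continuous|exact: cvg_cst].
have [->|x0] := eqVneq x 0.
  rewrite (_ : h ^~ 0 = cst 0); last by apply/funext => n; rewrite /h mul0r.
  by rewrite invr0; exact: cvg_cst.
have -> : x^-1 = x / (x ^+ 2 + 0) by rewrite addr0; field.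
apply: cvgMl_tmp; apply: cvgV; first by rewrite addr0 expf_neq0.
by apply: cvgD; [exact: cvg_cst|exact: cvg_harmonic].
Qed.

(** * The chi-squared density and its Laplace transform *)

Section chi_squared.
Context {R : realType}.
Local Notation lambda := (@lebesgue_measure R).
Local Notation D := [set t : R | 0 < t].

(** The rescaled push-forward agrees with Lebesgue measure on half-open intervals, which determine
    it. *)
Lemma lebesgue_measure_scale (c : R) (c0 : 0 < c) (A : set R) : measurable A ->
  lambda A = (c%:E * lambda ((fun x : R => (c * x)%R) @^-1` A))%E.
Proof.
move=> mA.
have mc : measurable_fun setT (fun x : measurableTypeR R => (c * x : measurableTypeR R)).
  exact: measurable_funM.
pose m := mscale (NngNum (ltW c0)) (measure_function_pushforward__canonical__measure_function_Measure lambda mc).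
have := @lebesgue_measure_unique R m _ A mA; apply.
move=> _ [[a b] _ <-] /=; rewrite /m /mscale/= /pushforward.
rewrite (_ : (fun x : R => c * x) @^-1` _ = `]a / c, b / c]%classic); last first.
  apply/seteqP; split => x /=; rewrite !in_itv/= ltr_pdivrMr// ler_pdivlMr// [x * c]mulrC//.
rewrite !lebesgue_measure_itv/= !lte_fin ltr_pM2r ?invr_gt0//.
case: ifP => _; last by rewrite mule0.
by rewrite -!EFinB -EFinM -mulrBl mulrCA divff ?mulr1// lt0r_neq0.
Qed.

Lemma integral_scale (c : R) (f : R -> \bar R) : 0 < c -> measurable_fun setT f ->
  (forall x, 0 <= f x)%E ->
  (\int[lambda]_(x in D) f x = c%:E * \int[lambda]_(x in D) f (c * x)%R)%E.
Proof.
move=> c0 mf f0.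
have mc : measurable_fun setT (fun x : measurableTypeR R => (c * x : measurableTypeR R)).
  exact: measurable_funM.
have mD : measurable D.
  rewrite (_ : D = `]0, +oo[%classic); first exact: measurable_itv.
  by apply/seteqP; split => x /=; rewrite in_itv/= andbT.
pose m := mscale (NngNum (ltW c0)) (measure_function_pushforward__canonical__measure_function_Measure lambda mc).
rewrite (eq_measure_integral m) => [|A mA _]; last first.
  by first [exact: (lebesgue_measure_scale c0 mA)|exact/esym/(lebesgue_measure_scale c0 mA)].
rewrite ge0_integral_mscale//; last exact: measurable_funTS.
congr (_ * _)%E; rewrite ge0_integral_pushforward//; last exact: measurable_funTS.
by congr integral; apply/seteqP; split => x /=; rewrite pmulr_rgt0.
Qed.

Lemma measurable_chi2_kernel q : measurable_fun setT (chi2_kernel q : R -> R).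
Proof.
apply: measurable_funM; first exact: measurable_powR.
apply: measurableT_comp => //; apply: measurable_funM => //; exact: measurableT_comp.
Qed.

Lemma chi2_kernel_ge0 q (t : R) : 0 <= chi2_kernel q t.
Proof. by rewrite mulr_ge0 ?powR_ge0 ?expR_ge0. Qed.

Lemma measurable_Rpos : measurable (D : set (measurableTypeR R)).
Proof.
rewrite (_ : D = `]0, +oo[%classic); first exact: measurable_itv.
by apply/seteqP; split => x /=; rewrite in_itv/= andbT.
Qed.

Lemma measurable_invsqrt (A : set (measurableTypeR R)) :
  measurable_fun A (fun t : R => ((Num.sqrt t)^-1)%:E).
Proof.
apply: measurable_funTS; apply/measurable_EFinP.
exact: (measurableT_comp measurable_inv measurable_sqrt).
Qed.

Lemma integral_invsqrt_le (n : nat) :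
  (\int[lambda]_(t in `[(n.+1%:R^-1 : R)%R, 1%R]) ((Num.sqrt t)^-1)%:E <= 2%:E)%E.
Proof.
case: n => [|n].
  by rewrite invr1 set_itv1 integral_set1.
set e : R := n.+2%:R^-1.
have e0 : 0 < e by rewrite invr_gt0.
have e1 : e < 1 by rewrite invf_lt1// ltr1n.
have dF (x : R) : 0 < x -> is_derive x 1 (fun t : R => 2 * Num.sqrt t) (Num.sqrt x)^-1.
  move=> x0; have := is_derive1_sqrt x0 => ?; apply: is_derive_eq.
  by rewrite /GRing.scale/=; field; rewrite lt0r_neq0// sqrtr_gt0.
rewrite (@continuous_FTC2 R (fun t => (Num.sqrt t)^-1) (fun t => 2 * Num.sqrt t))//.
- by rewrite sqrtr1 -EFinB lee_fin; have := sqrtr_ge0 e; lra.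
- apply: continuous_in_subspaceT => x; rewrite inE/= in_itv/= => /andP[ex _].
  apply: cvgV; first by rewrite lt0r_neq0// sqrtr_gt0; exact: lt_le_trans ex.
  exact: sqrt_continuous.
- split => [x||].
  + rewrite in_itv/= => /andP[ex _].
    by have [] := dF x (lt_trans e0 ex).
  + by apply: cvg_at_right_filter; apply: cvgMl_tmp; exact: sqrt_continuous.
  + by apply: cvg_at_left_filter; apply: cvgMl_tmp; exact: sqrt_continuous.
- move=> x; rewrite in_itv/= => /andP[ex _]; rewrite derive1E.
  by have [_ ->] := dF x (lt_trans e0 ex).
Qed.

(** Monotone convergence over [1/(n+1), 1]: the fundamental theorem applies there, away from the
    singularity at 0, with a bound uniform in n. *)
Lemma integral_invsqrt01 : (\int[lambda]_(t in `]0%R, 1%R]) ((Num.sqrt t)^-1)%:E <= 2%:E)%E.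
Proof.
rewrite (_ : `]0, 1]%classic = \bigcup_n `[(n.+1%:R^-1 : R), 1]%classic); last first.
  apply/seteqP; split => x /=.
    rewrite in_itv/= => /andP[x0 x1]; exists (Num.truncn x^-1) => //=.
    rewrite in_itv/= x1 andbT -[leRHS]invrK lef_pV2 ?posrE ?invr_gt0//.
    by rewrite ltW// truncnS_gt.
  move=> [n _ /=]; rewrite !in_itv/= => /andP[nx ->]; rewrite andbT.
  by apply: lt_le_trans nx; rewrite invr_gt0.
have nd : nondecreasing_seq (fun n : nat => `[(n.+1%:R^-1 : R), 1]%classic).
  move=> n m nm; apply/subsetPset => x /=; rewrite !in_itv/= => /andP[nx ->]; rewrite andbT.
  by apply: le_trans nx; rewrite lef_pV2 ?posrE// ler_nat.
have H := @ge0_nondecreasing_set_cvg_integral _ (measurableTypeR R) R (fun n : nat => `[(n.+1%:R^-1 : R), 1]%classic)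
  (fun t : R => ((Num.sqrt t)^-1)%:E) lambda nd (fun n => measurable_itv _)
  (fun n => @measurable_invsqrt _).
have ge0 (i : nat) (x : R) : `[(i.+1%:R^-1 : R), 1]%classic x -> (0 <= ((Num.sqrt x)^-1)%:E)%E.
  by move=> _; rewrite lee_fin invr_ge0 sqrtr_ge0.
have {H}H := H ge0.
rewrite -(cvg_lim _ H)//; apply: lime_le; first exact: cvgP H.
by apply: nearW => n; exact: integral_invsqrt_le.
Qed.

(** The worst case is q = 1, where the exponent q/2 - 1 equals -1/2. *)
Lemma chi2_kernel_le1 q (t : R) : (0 < q)%N -> 0 < t <= 1 -> chi2_kernel q t <= (Num.sqrt t)^-1.
Proof.
move=> q0 /andP[t0 t1].
have -> : (Num.sqrt t)^-1 = powR t (- 2^-1) by rewrite powRN powR12_sqrt// ltW.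
rewrite /chi2_kernel -[leRHS]mulr1; apply: ler_pM; rewrite ?powR_ge0 ?expR_ge0//; last first.
  by rewrite expR_le1; lra.
rewrite /powR (gt_eqF t0) ler_expR.
have : ln t <= 0 by rewrite -ln1 ler_ln ?posrE.
have : (1 : R) <= q%:R by rewrite ler1n.
nra.
Qed.

(** The decay e^(-t/2) is halved: one factor e^(-t/4) absorbs the power, since t^q <= (4q)^q
    e^(t/4), the other is an exponential density of rate 1/4. *)
Lemma chi2_kernel_ge1 q (t : R) : (0 < q)%N -> 1 <= t ->
  chi2_kernel q t <= (4 * q%:R) ^+ q * 4 * exponential_pdf 4^-1 t.
Proof.
move=> q0 t1; have t0 : 0 < t by lra.
have q0' : (0 : R) < q%:R by rewrite ltr0n.
rewrite exponential_pdfE ?(ltW t0)//.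
rewrite (_ : _ * _ * _ = (4 * q%:R) ^+ q * expR (- 4^-1 * t)); last by field.
rewrite /chi2_kernel (_ : - t / 2 = t / 4 * - 1 + - 4^-1 * t); last by field.
rewrite expRD mulrA ler_wpM2r ?expR_ge0// mulrN1 expRN ler_pdivrMr ?expR_gt0//.
apply: (@le_trans _ _ (t ^+ q)).
  rewrite -powR_mulrn ?(ltW t0)// /powR (gt_eqF t0) ler_expR ler_wpM2r ?ln_ge0//.
  by rewrite lerBlDr; lra.
have h : t / (4 * q%:R) <= expR (t / (4 * q%:R)) by have := expR_ge1Dx (t / (4 * q%:R)); lra.
have d0 : 0 <= t / (4 * q%:R) by rewrite divr_ge0 ?mulr_ge0 ?(ltW t0) ?(ltW q0').
have := lerXn2r q _ _ h; rewrite !nnegrE expR_ge0 d0 => /(_ isT isT).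
rewrite -expRM_natl (_ : q%:R * _ = t / 4); last by field; rewrite lt0r_neq0.
rewrite exprMn exprVn ler_pdivrMr ?exprn_gt0 ?mulr_gt0//.
by rewrite mulrC.
Qed.

Lemma chi2_kernel_integrable q : (0 < q)%N -> lambda.-integrable D (EFin \o (chi2_kernel q : R -> R)).
Proof.
move=> q0; apply/integrableP; split.
  by apply: measurable_funTS; apply/measurable_EFinP; exact: measurable_chi2_kernel.
under eq_integral do rewrite /= ger0_norm ?chi2_kernel_ge0//.
have mk (A : set (measurableTypeR R)) : measurable_fun A (fun t : R => (chi2_kernel q t)%:E).
  by apply: measurable_funTS; apply/measurable_EFinP; exact: measurable_chi2_kernel.
rewrite (_ : D = `]0, 1]%classic `|` `]1, +oo[%classic); last first.
  apply/seteqP; split => x /=; rewrite !in_itv/= ?andbT.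
    by move=> x0; case: (leP x 1) => x1; [left; rewrite x0|right].
  by move=> [/andP[]//|x1]; apply: lt_trans x1.
rewrite ge0_integral_setU//=; first last.
- by apply/disj_setPS => x /= []; rewrite !in_itv/= andbT => /andP[_ x1] x2; move: (le_lt_trans x1 x2); rewrite ltxx.
- by move=> x _; rewrite lee_fin chi2_kernel_ge0.
apply: lte_add_pinfty.
  apply: (@le_lt_trans _ _ 2%:E); last exact: ltry.
  apply: le_trans integral_invsqrt01; apply: ge0_le_integral => //.
  - by move=> x _; rewrite lee_fin chi2_kernel_ge0.
  - exact: measurable_invsqrt.
  - by move=> x /=; rewrite in_itv/= => x01; rewrite lee_fin chi2_kernel_le1.
pose c : R := (4 * q%:R) ^+ q * 4.
have c0 : 0 <= c by rewrite mulr_ge0// exprn_ge0// mulr_ge0.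
have r0 : (0 : R) < 4^-1 by [].
have mexp (A : set (measurableTypeR R)) : measurable_fun A (fun t : R => (c * exponential_pdf 4^-1 t)%:E).
  apply: measurable_funTS; apply/measurable_EFinP; apply: measurable_funM => //.
  exact: measurable_exponential_pdf.
apply: (@le_lt_trans _ _ (\int[lambda]_(x in setT) (c * exponential_pdf 4^-1 x)%:E)%E).
  apply: (@le_trans _ _ (\int[lambda]_(x in `]1%R, +oo[) (c * exponential_pdf 4^-1 x)%:E)%E).
    apply: ge0_le_integral => //.
    - by move=> x _; rewrite lee_fin chi2_kernel_ge0.
    - by move=> x /=; rewrite in_itv/= andbT => x1; rewrite lee_fin chi2_kernel_ge1// ltW.
  apply: ge0_subset_integral => // x _.
  by rewrite lee_fin mulr_ge0// exponential_pdf_ge0.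
under eq_integral do rewrite EFinM.
rewrite ge0_integralZl//; last 2 first.
- by apply/measurable_EFinP; exact: measurable_exponential_pdf.
- by move=> x _; rewrite lee_fin exponential_pdf_ge0.
by rewrite integral_exponential_pdf// mule1 ltry.
Qed.

(** The normalising constant 2^(q/2) Gamma(q/2), kept as an integral as in [chi2_cdf]. *)
Definition chi2_mass q : R := Rintegral lambda D (chi2_kernel q).

Lemma chi2_mass_gt0 q : (0 < q)%N -> 0 < chi2_mass q.
Proof.
move=> q0; pose a : R := q%:R / 2 - 1.
(* On ]1, 2] both ln x and x/2 are at most 1, so x^a e^(-x/2) is at least this constant. *)
pose c : R := expR (- `|a| - 1).
have sub : `]1, 2]%classic `<=` D by move=> x /=; rewrite in_itv/= => /andP[x1 _]; lra.
have low x : `]1, 2]%classic x -> c <= chi2_kernel q x.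
  rewrite /= in_itv/= => /andP[x1 x2]; have x0 : 0 < x by lra.
  rewrite /chi2_kernel /powR (gt_eqF x0) -expRD ler_expR -/a.
  have l0 : 0 <= ln x by rewrite ln_ge0// ltW.
  have l1 : ln x <= 1 by have := @le_ln1Dx R (x - 1); rewrite addrCA subrr addr0 => /(_ _); lra.
  have := ler_norm (- a); rewrite normrN => h; have := normr_ge0 a; nra.
have I := chi2_kernel_integrable q0.
rewrite -lte_fin /chi2_mass /Rintegral fineK; last exact: (integrable_fin_num measurable_Rpos I).
apply: (@lt_le_trans _ _ (\int[lambda]_(x in `]1%R, 2%R]) c%:E)%E).
  rewrite integral_cst//= lebesgue_measure_itv/= lte_fin ifT ?ltr1n// -EFinB -EFinM lte_fin.
  by rewrite mulr_gt0 ?expR_gt0//; lra.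
have mk (A : set (measurableTypeR R)) : measurable_fun A (fun t : R => (chi2_kernel q t)%:E).
  by apply: measurable_funTS; apply/measurable_EFinP; exact: measurable_chi2_kernel.
apply: (@le_trans _ _ (\int[lambda]_(x in `]1%R, 2%R]) (chi2_kernel q x)%:E)%E).
  by apply: ge0_le_integral => // x _; rewrite lee_fin expR_ge0.
apply: ge0_subset_integral => //; first exact: measurable_Rpos.
by move=> x _; rewrite lee_fin chi2_kernel_ge0.
Qed.

(** Substituting (1 + 2s) t for t reproduces the kernel with the factor e^(-st); the power of 1 + 2s
    in the kernel and the Jacobian combine to the exponent q/2. *)
Lemma chi2_laplace q (s : R) : (0 < q)%N -> 0 <= s ->
  Rintegral lambda D (fun t => expR (- (s * t)) * chi2_kernel q t) =
  (Num.sqrt (1 + 2 * s))^-1 ^+ q * chi2_mass q.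
Proof.
move=> q0 s0; set c := 1 + 2 * s; have c0 : 0 < c by rewrite /c; lra.
have scale t : 0 < t -> chi2_kernel q (c * t) = powR c (q%:R / 2 - 1) * (expR (- (s * t)) * chi2_kernel q t).
  move=> t0; rewrite /chi2_kernel powRM ?ltW// -mulrA; congr (_ * _).
  by rewrite mulrCA -expRD; congr (_ * expR _); rewrite /c; field.
have mk : measurable_fun setT (fun t : R => (chi2_kernel q t)%:E).
  by apply/measurable_EFinP; exact: measurable_chi2_kernel.
have sq0 : 0 < Num.sqrt c by rewrite sqrtr_gt0.
have E : (\int[lambda]_(t in D) (chi2_kernel q t)%:E = (Num.sqrt c ^+ q)%:E *
   \int[lambda]_(t in D) (expR (- (s * t)) * chi2_kernel q t)%:E)%E.
  rewrite (integral_scale c0 mk); last by move=> x; rewrite lee_fin chi2_kernel_ge0.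
  have -> : (\int[lambda]_(t in D) (chi2_kernel q (c * t)%R)%:E = \int[lambda]_(t in D)
      ((powR c (q%:R / 2 - 1))%:E * (expR (- (s * t)) * chi2_kernel q t)%:E))%E.
    by apply: eq_integral => t; rewrite inE/= => t0; rewrite scale// EFinM.
  rewrite ge0_integralZl//.
  - rewrite muleA -EFinM; congr (_%:E * _)%E.
    rewrite -[X in X * _](powRr1 (ltW c0)) -powRD; last by apply/implyP => _; rewrite lt0r_neq0.
    rewrite (_ : 1 + _ = 2^-1 * q%:R); last by field.
    by rewrite powRrM powR12_sqrt ?(ltW c0)// powR_mulrn// ltW.
  - exact: measurable_Rpos.
  - apply: measurable_funTS; apply/measurable_EFinP; apply: measurable_funM; last exact: measurable_chi2_kernel.
    apply: measurableT_comp => //; apply: measurableT_comp => //; exact: measurable_funM.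
  - by move=> t _; rewrite lee_fin mulr_ge0 ?expR_ge0 ?chi2_kernel_ge0.
  - by rewrite lee_fin powR_ge0.
rewrite /chi2_mass /Rintegral E fineM//.
  by rewrite /= mulrA -exprMn mulVf ?lt0r_neq0// expr1n mul1r.
(* The tilted integral is finite because, by [E], a positive multiple of it is the finite mass. *)
have I := integrable_fin_num measurable_Rpos (chi2_kernel_integrable q0).
have p0 : (0 : R) < Num.sqrt c ^+ q by rewrite exprn_gt0.
rewrite ge0_fin_numE; last by apply: integral_ge0 => t _; rewrite lee_fin mulr_ge0 ?expR_ge0 ?chi2_kernel_ge0.
rewrite ltNge leye_eq; apply/negP => /eqP K; move: I; rewrite /comp E K.
by rewrite mulr_infty/= gtr0_sg// mul1e.
Qed.

End chi_squared.

Lemma dist_leD {R : realType} (a b x d : R) : `|a - b| <= d -> a <= x -> b <= x + d.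
Proof. by rewrite ler_norml => /andP[? ?] ?; lra. Qed.

Lemma dist_geB {R : realType} (a b x d : R) : `|a - b| <= d -> x < a -> x - d <= b.
Proof. by rewrite ler_norml => /andP[? ?] ?; lra. Qed.

(** [F], [Fu], [Fl] are the limiting distribution function at x, x + 2d and x - 2d; [cu], [cl] the
    chi-squared and [eu], [el] the actual expectations of the upper and lower test functions; [p]
    and [pB] the probabilities of S <= x and of the exceptional event. *)
Lemma dist_sandwich {R : realType} (F Fu Fl cu cl eu el p pB e : R) :
  `|F - Fu| <= e / 4 -> `|F - Fl| <= e / 4 -> `|cu - eu| <= e / 4 -> `|cl - el| <= e / 4 ->
  p <= pB + eu -> el <= p + pB -> cu <= Fu -> Fl <= cl -> pB <= e / 4 -> `|F - p| <= e.
Proof.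
rewrite !ler_norml => /andP[? ?] /andP[? ?] /andP[? ?] /andP[? ?] *; apply/andP; split; lra.
Qed.

(** * From Laplace transforms to distribution functions *)

Section chi_squared_limit.
Context {R : realType} {dT : measure_display} {T : measurableType dT}.
Variable P : probability T R.
Local Notation lambda := (@lebesgue_measure R).
Local Notation D := [set t : R | 0 < t].
Variable q : nat.
Hypothesis q0 : (0 < q)%N.

Let lipschitz (h : R -> R) (K : R) := forall u v, `|h u - h v| <= K * `|u - v|.

Let lipschitz_measurable h K : 0 <= K -> lipschitz h K -> measurable_fun setT h.
Proof.
move=> K0 hK; apply: continuous_measurable_fun => x; apply/cvgrPdist_le => e e0.
have K1 : 0 < K + 1 by rewrite ltr_wpDl.
have d0 : 0 < e / (K + 1) by rewrite divr_gt0.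
near=> y; apply: le_trans (hK _ _) _.
have : `|x - y| <= e / (K + 1) by near: y; apply: cvgr_dist_le.
rewrite ler_pdivlMr// => H; have := normr_ge0 (x - y); nra.
Unshelve. all: by end_near. Qed.

Let lipschitz_bounded h K : 0 <= K -> lipschitz h K ->
  forall u, 0 <= u <= 1 -> `|h u| <= `|h 0| + K.
Proof.
move=> K0 hK u /andP[u0 u1]; rewrite -[h u](subrK (h 0)) addrC.
apply: le_trans (ler_normD _ _) _; rewrite lerD2l; apply: le_trans (hK _ _) _.
by rewrite subr0 ger0_norm// ler_piMr.
Qed.

Definition chi2_functional (f : R -> R) : R :=
  Rintegral lambda D (fun t => f t * chi2_kernel q t) / chi2_mass q.

Let integrable_bounded_kernel (f : R -> R) (c : R) : measurable_fun setT f ->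
  (forall t, 0 < t -> `|f t| <= c) ->
  lambda.-integrable D (EFin \o (fun t => f t * chi2_kernel q t)).
Proof.
move=> mf fc; apply: (le_integrable measurable_Rpos _ _ (integrableZl measurable_Rpos c (chi2_kernel_integrable q0))).
  apply: measurable_funTS; apply/measurable_EFinP; apply: measurable_funM => //.
  exact: measurable_chi2_kernel.
move=> t t0; rewrite lee_fin; move: t t0.
suff key (t : R) : 0 < t -> `|f t * chi2_kernel q t| <= `|c * chi2_kernel q t| by [].
move=> t0; rewrite !normrM ler_wpM2r//; apply: le_trans (fc _ t0) _; exact: ler_norm.
Qed.

Lemma chi2_functional_le (f g : R -> R) (c : R) : measurable_fun setT f -> measurable_fun setT g ->
  (forall t, 0 < t -> `|f t| <= c) -> (forall t, 0 < t -> `|g t| <= c) ->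
  (forall t, 0 < t -> f t <= g t) -> chi2_functional f <= chi2_functional g.
Proof.
move=> mf mg fc gc fg; rewrite /chi2_functional ler_pM2r ?invr_gt0 ?chi2_mass_gt0//.
apply: le_Rintegral; [exact: measurable_Rpos|exact: integrable_bounded_kernel fc|exact: integrable_bounded_kernel gc|].
by move=> t t0; rewrite ler_wpM2r ?chi2_kernel_ge0// fg.
Qed.

Lemma chi2_functional_dist (f g : R -> R) (c e : R) : measurable_fun setT f -> measurable_fun setT g ->
  (forall t, 0 < t -> `|f t| <= c) -> (forall t, 0 < t -> `|g t| <= c) ->
  (forall t, 0 < t -> `|f t - g t| <= e) -> `|chi2_functional f - chi2_functional g| <= e.
Proof.
move=> mf mg fc gc fg; have m0 := @chi2_mass_gt0 R q q0.
have If := integrable_bounded_kernel mf fc; have Ig := integrable_bounded_kernel mg gc.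
have mfg : measurable_fun setT (fun t => f t - g t) by exact: measurable_funB.
have Ifg := integrable_bounded_kernel mfg fg.
have E : chi2_functional f - chi2_functional g =
    Rintegral lambda D (fun t => (f t - g t) * chi2_kernel q t) / chi2_mass q.
  rewrite /chi2_functional -mulrBl -RintegralB//; last exact: measurable_Rpos.
  by congr (_ / _); apply: eq_Rintegral => t _; rewrite mulrBl.
rewrite E normrM [X in _ * X]gtr0_norm ?invr_gt0// ler_pdivrMr//.
apply: le_trans (le_normr_Rintegral measurable_Rpos Ifg) _.
rewrite /chi2_mass -RintegralZl//; [|exact: measurable_Rpos|exact: chi2_kernel_integrable].
apply: le_Rintegral; [exact: measurable_Rpos| | |].
- apply: (le_integrable measurable_Rpos _ _ Ifg); last by move=> t _ /=; rewrite normr_id.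
  apply: measurable_funTS; apply/measurable_EFinP; apply: measurableT_comp => //.
  by apply: measurable_funM => //; exact: measurable_chi2_kernel.
- have := integrableZl measurable_Rpos e (chi2_kernel_integrable q0).
  by apply: eq_integrable => //; exact: measurable_Rpos.
- by move=> t t0; rewrite normrM [X in _ * X]ger0_norm ?chi2_kernel_ge0// ler_wpM2r ?chi2_kernel_ge0// fg.
Qed.

Lemma chi2_cdfE (y : R) :
  chi2_cdf q y = Rintegral lambda [set t | 0 < t <= y] (chi2_kernel q) / chi2_mass q.
Proof.
rewrite /chi2_cdf gtn_eqF//; case: leP => // y0.
rewrite (_ : [set t | _] = set0) ?Rintegral_set0 ?mul0r//.
by apply/seteqP; split => t //= /andP[t0 ty]; lra.
Qed.

Let measurable_seg (y : R) : measurable ([set t | 0 < t <= y] : set (measurableTypeR R)).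
Proof.
rewrite (_ : [set t | 0 < t <= y] = `]0, y]%classic); first exact: measurable_itv.
by apply/seteqP; split => t /=; rewrite in_itv.
Qed.

Lemma chi2_cdf_functional (y : R) : chi2_cdf q y = chi2_functional (\1_[set t | 0 < t <= y]).
Proof.
rewrite chi2_cdfE /chi2_functional; congr (_ / _).
have -> : Rintegral lambda [set t | 0 < t <= y] (chi2_kernel q) =
    Rintegral lambda (D `&` [set t | 0 < t <= y]) (chi2_kernel q).
  by congr (Rintegral _ _ _); apply/seteqP; split => t /=; [move=> ty; split => //; case/andP: ty|case].
rewrite Rintegral_mkcondr; apply: eq_Rintegral => t _; rewrite patchE indicE.
by case: (t \in _); rewrite ?mul1r ?mul0r.
Qed.

Variable V : nat -> T -> R.
Hypothesis mV : forall n, measurable_fun setT (V n).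
Hypothesis V0 : forall n t, 0 <= V n t.
Hypothesis laplaceV : forall s : R, 0 <= s ->
  (fun n => Ex P (fun t => expR (- (s * V n t)))) @ \oo --> (Num.sqrt (1 + 2 * s))^-1 ^+ q.

(** Bounded values: moments of [U] are Laplace transforms of [V] at integers, and polynomials are
    uniformly dense on [0, 1]. *)
Let U n t := expR (- V n t).
Let U01 n t : 0 <= U n t <= 1. Proof. by rewrite expR_ge0 expR_le1 oppr_le0 V0. Qed.
Let mU n : measurable_fun setT (U n).
Proof. by apply: measurableT_comp => //; exact: measurableT_comp. Qed.
Let e01 (t : R) : 0 < t -> 0 <= expR (- t) <= 1.
Proof. by move=> t0; rewrite expR_ge0 expR_le1 oppr_le0 ltW. Qed.
Let mexpN : measurable_fun setT (fun t : R => expR (- t)).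
Proof. by apply: measurableT_comp => //; exact: measurableT_comp. Qed.

Let measurable_poly (p : {poly R}) : measurable_fun setT (fun u : R => p.[u]).
Proof. by apply: continuous_measurable_fun; exact: continuous_horner. Qed.

Lemma Ex_poly_chi2_cvg (p : {poly R}) :
  (fun n => Ex P (fun t => p.[U n t])) @ \oo --> chi2_functional (fun t => p.[expR (- t)]).
Proof.
have IU i n : Intg P (fun t => U n t ^+ i).
  apply: (@Intg_bounded _ _ _ P _ 1) => [|t]; first exact: measurable_funX.
  by have /andP[u0 u1] := U01 n t; rewrite ger0_norm ?exprn_ge0// exprn_ile1.
have E1 n : Ex P (fun t => p.[U n t]) = \sum_(i < size p) p`_i * Ex P (fun t => expR (- (i%:R * V n t))).
  rewrite (_ : (fun t => p.[U n t]) = fun t => \sum_(i < size p) p`_i * U n t ^+ i); last first.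
    by apply/funext => t; rewrite horner_coef.
  rewrite Ex_sum => [|i]; last by apply: IntgZ.
  apply: eq_bigr => i _; rewrite ExZ//; congr (_ * Ex P _); apply/funext => t.
  by rewrite /U -expRM_natl mulrN.
have E2 : chi2_functional (fun t => p.[expR (- t)]) =
    \sum_(i < size p) p`_i * (Num.sqrt (1 + 2 * i%:R))^-1 ^+ q.
  rewrite /chi2_functional.
  have step (m : nat) : Rintegral lambda D (fun t => (\sum_(i < m) p`_i * expR (- t) ^+ i) * chi2_kernel q t)
     = \sum_(i < m) p`_i * ((Num.sqrt (1 + 2 * i%:R))^-1 ^+ q * chi2_mass q).
    have Iterm i : lambda.-integrable D (EFin \o (fun t => (p`_i * expR (- t) ^+ i) * chi2_kernel q t)).
      apply: (@integrable_bounded_kernel _ `|p`_i|) => [|t t0].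
        by apply: measurable_funM => //; exact: measurable_funX.
      have /andP[u0 u1] := e01 t0; rewrite normrM ler_piMr//.
      by rewrite ger0_norm ?exprn_ge0// exprn_ile1.
    have Isum : lambda.-integrable D (EFin \o (fun t => (\sum_(i < m) p`_i * expR (- t) ^+ i) * chi2_kernel q t)).
      apply: (@integrable_bounded_kernel _ (\sum_(i < m) `|p`_i|)) => [|t t0].
        by apply: measurable_sum => i; apply: measurable_funM => //; exact: measurable_funX.
      have /andP[u0 u1] := e01 t0; apply: le_trans (ler_norm_sum _ _ _) _; apply: ler_sum => i _.
      by rewrite normrM ler_piMr// ger0_norm ?exprn_ge0// exprn_ile1.
    elim: m Isum => [|m IH] Isum.
      rewrite big_ord0 -[RHS](mul0r (chi2_mass q)) /chi2_mass -RintegralZl//.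
      + by apply: eq_Rintegral => t _; rewrite big_ord0.
      + exact: measurable_Rpos.
      + exact: chi2_kernel_integrable.
    have Isum' : lambda.-integrable D (EFin \o (fun t => (\sum_(i < m) p`_i * expR (- t) ^+ i) * chi2_kernel q t)).
      apply: (@integrable_bounded_kernel _ (\sum_(i < m) `|p`_i|)) => [|t t0].
        by apply: measurable_sum => i; apply: measurable_funM => //; exact: measurable_funX.
      have /andP[u0 u1] := e01 t0; apply: le_trans (ler_norm_sum _ _ _) _; apply: ler_sum => i _.
      by rewrite normrM ler_piMr// ger0_norm ?exprn_ge0// exprn_ile1.
    rewrite big_ord_recr/= -IH// -chi2_laplace// -RintegralZl; [|exact: measurable_Rpos|].
      rewrite -RintegralD//; [|exact: measurable_Rpos|].
        by apply: eq_Rintegral => t _; rewrite big_ord_recr/= mulrDl -expRM_natl mulrN mulrA.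
      apply: eq_integrable (Iterm m) => //; first exact: measurable_Rpos.
      by move=> t _ /=; rewrite -expRM_natl mulrN mulrA.
    apply: (@integrable_bounded_kernel _ 1) => [|t t0].
      apply: measurableT_comp => //; apply: measurableT_comp => //; exact: measurable_funM.
    by rewrite ger0_norm ?expR_ge0// expR_le1 oppr_le0 mulr_ge0// ltW.
  have -> : Rintegral lambda D (fun t => p.[expR (- t)] * chi2_kernel q t) =
    Rintegral lambda D (fun t => (\sum_(i < size p) p`_i * expR (- t) ^+ i) * chi2_kernel q t).
    by apply: eq_Rintegral => t _; rewrite horner_coef.
  rewrite step mulr_suml; apply: eq_bigr => i _.
  by rewrite -mulrA mulfK// lt0r_neq0// chi2_mass_gt0.
rewrite E2; under eq_fun do rewrite E1.
apply: cvg_big => [|i _]; first exact: add_continuous.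
by apply: cvgMl_tmp; exact: laplaceV.
Qed.

Lemma Ex_lipschitz_chi2_cvg (h : R -> R) (K : R) : 0 <= K ->
  (forall u v, `|h u - h v| <= K * `|u - v|) ->
  (fun n => Ex P (fun t => h (U n t))) @ \oo --> chi2_functional (fun t => h (expR (- t))).
Proof.
move=> K0 hK; have mh := lipschitz_measurable K0 hK; have bh := lipschitz_bounded K0 hK.
apply/cvgrPdist_le => e e0; have e3 : 0 < e / 3 by rewrite divr_gt0.
have [p ph] := bernstein_lipschitz K0 hK e3.
move/cvgrPdist_le : (@Ex_poly_chi2_cvg p) => /(_ _ e3); apply: filterS => n Hn.
have bp u : 0 <= u <= 1 -> `|p.[u]| <= `|h 0| + K + e / 3.
  move=> u01; rewrite -[p.[u]](subrK (h u)) addrC; apply: le_trans (ler_normD _ _) _.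
  by apply: lerD; [exact: bh|exact: ph].
have d1 : `|Ex P (fun t => h (U n t)) - Ex P (fun t => p.[U n t])| <= e / 3.
  rewrite -ExB.
  - apply: Ex_norm_cst => [|t]; last by rewrite distrC ph.
    by apply: measurable_funB; exact: measurableT_comp.
  - by apply: (@Intg_bounded _ _ _ P _ (`|h 0| + K)) => [|t]; [exact: measurableT_comp|exact: bh].
  - by apply: (@Intg_bounded _ _ _ P _ (`|h 0| + K + e / 3)) => [|t]; [exact: measurableT_comp|exact: bp].
have d2 : `|chi2_functional (fun t => h (expR (- t))) - chi2_functional (fun t => p.[expR (- t)])| <= e / 3.
  apply: (@chi2_functional_dist _ _ (`|h 0| + K + e / 3)).
  - exact: measurableT_comp.
  - exact: measurableT_comp.
  - by move=> t t0; apply: le_trans (bh _ (e01 t0)) _; lra.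
  - by move=> t t0; exact: bp (e01 t0).
  - by move=> t t0; rewrite distrC; exact: ph (e01 t0).
move: Hn d1 d2.
set a := chi2_functional _; set b := Ex P _; set c := chi2_functional _; set d := Ex P _ => h1 h2 h3.
rewrite (_ : c - d = (c - a) + (a - b) - (d - b)); last by ring.
apply: le_trans (ler_normB _ _) _; have := ler_normD (c - a) (a - b); lra.
Qed.

Variable S : nat -> T -> R.
Hypothesis mS : forall n, measurable_fun setT (S n).
Hypothesis SV : (fun z => S z.1 z.2 - V z.1 z.2) @ whp P --> 0.

Let ramp (a b u : R) := Num.min 1 (Num.max 0 ((u - a) / (b - a))).

Let ramp_lipschitz a b : a < b -> lipschitz (ramp a b) (b - a)^-1.
Proof.
move=> ab u v; have c0 : 0 < (b - a)^-1 by rewrite invr_gt0 subr_gt0.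
rewrite -[X in X * _]gtr0_norm// -normrM.
rewrite (_ : (b - a)^-1 * (u - v) = (u - a) / (b - a) - (v - a) / (b - a)); last by ring.
rewrite /ramp; move: ((u - a) / _) ((v - a) / _) => x y.
have := ler_norm (x - y); have := ler_norm (y - x); rewrite (distrC y).
rewrite !minEle !maxEle; move: (normr_ge0 (x - y)); move: `|x - y| => z.
rewrite ler_norml; case: (leP 0 x) => ?; case: (leP 0 y) => ?; (case: (leP 1 x) => ?; case: (leP 1 y) => ?; rewrite ?ler10) => *; apply/andP; split; lra.
Qed.

Let ramp01 a b u : 0 <= ramp a b u <= 1.
Proof. by rewrite /ramp le_min ler01/= le_max lexx/= ge_min lexx. Qed.

Let ramp1 a b u : a < b -> b <= u -> ramp a b u = 1.
Proof.
move=> ab bu; rewrite /ramp; apply/min_idPl; rewrite le_max; apply/orP; right.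
by rewrite ler_pdivlMr ?subr_gt0// mul1r lerD2r.
Qed.

Let ramp0 a b u : a < b -> u <= a -> ramp a b u = 0.
Proof.
move=> ab ua; rewrite /ramp (max_idPl _) ?(min_idPr _)//.
by rewrite pmulr_lle0 ?invr_gt0 ?subr_gt0// subr_le0.
Qed.

Let measurable_le (f : T -> R) x : measurable_fun setT f -> measurable [set t | f t <= x].
Proof.
move=> mf; rewrite [X in measurable X](_ : _ = setT `&` f @^-1` `]-oo, x]).
  by apply: mf; [exact: measurableT|exact: measurable_itv].
by rewrite setTI; apply/seteqP; split => t /=; rewrite in_itv.
Qed.

Let ramp_cvg a b : a < b ->
  (fun n => Ex P (fun t => ramp a b (U n t))) @ \oo --> chi2_functional (fun t => ramp a b (expR (- t))).
Proof.
move=> ab; apply: Ex_lipschitz_chi2_cvg (ramp_lipschitz ab).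
by rewrite invr_ge0 subr_ge0 ltW.
Qed.

Let mramp a b : a < b -> measurable_fun setT (ramp a b).
Proof. by move=> ab; apply: lipschitz_measurable (ramp_lipschitz ab); rewrite invr_ge0 subr_ge0 ltW. Qed.

Let Intg_indic (A : set T) : measurable A -> Intg P \1_A.
Proof.
move=> mA; apply: (@Intg_bounded _ _ _ P _ 1) => [|t]; first exact: measurable_indic.
by rewrite indicE; case: (_ \in _); rewrite ?normr1 ?normr0.
Qed.

(** As e^(-x) reverses the order, the ramp becomes, in x, a function that decreases from 1 at [y] to
    0 at [y']. *)
Let ramp_test (y y' : R) : y < y' -> exists f : R -> R,
  [/\ measurable_fun setT f, forall u, 0 <= f u <= 1, forall x, x <= y -> f (expR (- x)) = 1,
     forall x, y' <= x -> f (expR (- x)) = 0 &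
     (fun n => Ex P (fun t => f (U n t))) @ \oo --> chi2_functional (fun t => f (expR (- t)))].
Proof.
move=> yy; have ab : expR (- y') < expR (- y) by rewrite ltr_expR ltrN2.
exists (ramp (expR (- y')) (expR (- y))); split.
- exact: mramp.
- by move=> u; exact: ramp01.
- by move=> x xy; rewrite ramp1// ler_expR lerN2.
- by move=> x xy; rewrite ramp0// ler_expR lerN2.
- exact: ramp_cvg.
Qed.

Let chi2_test_le (f : R -> R) (x : R) : measurable_fun setT f -> (forall u, 0 <= f u <= 1) ->
  (forall u, x <= u -> f (expR (- u)) = 0) -> chi2_functional (fun t => f (expR (- t))) <= chi2_cdf q x.
Proof.
move=> mf f01 f0; rewrite chi2_cdf_functional; apply: (@chi2_functional_le _ _ 1).
- exact: measurableT_comp mf mexpN.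
- exact: measurable_indic (measurable_seg _).
- by move=> t _; have /andP[r0 r1] := f01 (expR (- t)); rewrite ger0_norm.
- by move=> t _; rewrite indicE; case: (_ \in _); rewrite ?normr1 ?normr0.
- move=> t t0; rewrite indicE; have [tx|tx] := leP t x; last by rewrite f0 ?(ltW tx).
  by rewrite mem_set/= ?t0 ?tx//; have /andP[] := f01 (expR (- t)).
Qed.

Let chi2_test_ge (f : R -> R) (x : R) : measurable_fun setT f -> (forall u, 0 <= f u <= 1) ->
  (forall u, u <= x -> f (expR (- u)) = 1) -> chi2_cdf q x <= chi2_functional (fun t => f (expR (- t))).
Proof.
move=> mf f01 f1; rewrite chi2_cdf_functional; apply: (@chi2_functional_le _ _ 1).
- exact: measurable_indic (measurable_seg _).
- exact: measurableT_comp mf mexpN.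
- by move=> t _; rewrite indicE; case: (_ \in _); rewrite ?normr1 ?normr0.
- by move=> t _; have /andP[r0 r1] := f01 (expR (- t)); rewrite ger0_norm.
- move=> t t0; rewrite indicE; case: (boolP (t \in _)) => [|_]; last by have /andP[] := f01 (expR (- t)).
  by rewrite inE/= => /andP[_ tx]; rewrite f1.
Qed.

Let Intg_test (f : R -> R) n : measurable_fun setT f -> (forall u, 0 <= f u <= 1) ->
  Intg P (fun t => f (U n t)).
Proof.
move=> mf f01; apply: (@Intg_bounded _ _ _ P _ 1) => [|t]; first exact: measurableT_comp mf (mU n).
by have /andP[r0 r1] := f01 (U n t); rewrite ger0_norm.
Qed.

(* Off the event B, S n and V n differ by at most d, so a test function equal to 1 below x + d
   (0 above x - d) dominates (is dominated by) the indicator of S n <= x. *)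
Let cdf_le_test (f : R -> R) (x d : R) n B : measurable_fun setT f -> (forall u, 0 <= f u <= 1) ->
  (forall u, u <= x + d -> f (expR (- u)) = 1) -> measurable B ->
  (forall t, ~ B t -> `|S n t - V n t| <= d) ->
  fine (P [set t | S n t <= x]) <= fine (P B) + Ex P (fun t => f (U n t)).
Proof.
move=> mf f01 f1 mB HB; have mSx := measurable_le x (mS n).
rewrite -!Ex_indic// -ExD; [|exact: Intg_indic|exact: Intg_test].
apply: Ex_le; [exact: Intg_indic|apply: IntgD; [exact: Intg_indic|exact: Intg_test]|].
move=> t; have /andP[r0 r1] := f01 (U n t).
rewrite !indicE; case: (boolP (t \in B)) => [_|tB].
  by case: (_ \in _); rewrite /= ?lerDl ?addr_ge0.
case: (boolP (t \in _)) => [|_]; last by rewrite add0r.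
rewrite inE/= => Sx; rewrite f1 ?add0r//.
have /HB : ~ B t by rewrite notin_setE in tB.
by move/dist_leD; exact.
Qed.

Let test_le_cdf (f : R -> R) (x d : R) n B : measurable_fun setT f -> (forall u, 0 <= f u <= 1) ->
  (forall u, x - d <= u -> f (expR (- u)) = 0) -> measurable B ->
  (forall t, ~ B t -> `|S n t - V n t| <= d) ->
  Ex P (fun t => f (U n t)) <= fine (P [set t | S n t <= x]) + fine (P B).
Proof.
move=> mf f01 f0 mB HB; have mSx := measurable_le x (mS n).
rewrite -!Ex_indic// -ExD; [|exact: Intg_indic|exact: Intg_indic].
apply: Ex_le; [exact: Intg_test|apply: IntgD; exact: Intg_indic|].
move=> t; have /andP[r0 r1] := f01 (U n t).
rewrite !indicE; case: (boolP (t \in B)) => [_|tB].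
  by case: (_ \in _); rewrite /= ?add0r// (le_trans r1)// lerDl.
case: (boolP (t \in _)) => [_|]; first by rewrite addr0.
rewrite notin_setE/= => /negP; rewrite -ltNge => Sx; rewrite f0 ?addr0//.
have /HB : ~ B t by rewrite notin_setE in tB.
by move/dist_geB; exact.
Qed.

Lemma chi2_cvg_in_distribution : cvg_in_distribution P S (chi2_cdf q).
Proof.
move=> x cF; apply: cvg_EFin; first by apply: nearW => n; exact: fin_num_measure (measurable_le _ (mS n)).
apply/cvgrPdist_le => e e0; have e4 : 0 < e / 4 by rewrite divr_gt0.
(* The tolerance 2d is spent twice: one d on the difference of [S] and [V], one d on the slope of
   the ramp. *)
have [d d0 Fd] : exists2 d : R, 0 < d & forall y, `|x - y| <= 2 * d -> `|chi2_cdf q x - chi2_cdf q y| <= e / 4.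
  move/cvgrPdist_le : cF => /(_ _ e4) /nbhs_ballP[r /= r0 H]; exists (r / 4); first by rewrite divr_gt0.
  by move=> y xy; apply: H; rewrite /ball/=; apply: le_lt_trans xy _; rewrite mulrC -mulrA gtr_pMr// ltr_pdivrMl// mulr1 ltr_nat.
have near_event : \forall n \near \oo, exists B, [/\ measurable B, fine (P B) <= e / 4 &
    forall t, ~ B t -> `|S n t - V n t| <= d].
  move/cvgr0Pnorm_le : SV => /(_ _ d0)/(_ _ e4); apply: filterS => n [B [mB PB H]].
  exists B; split => //; rewrite -lee_fin fineK//; exact: fin_num_measure mB.
have [f1 [mf1 f101 f11 f10 f1c]] : exists f : R -> R, [/\ measurable_fun setT f, forall u, 0 <= f u <= 1,
    forall y, y <= x + d -> f (expR (- y)) = 1, forall y, x + 2 * d <= y -> f (expR (- y)) = 0 &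
    (fun n => Ex P (fun t => f (U n t))) @ \oo --> chi2_functional (fun t => f (expR (- t)))].
  by apply: ramp_test; rewrite ltrD2l -subr_gt0 mulr_natl mulr2n addrK.
have [f2 [mf2 f201 f21 f20 f2c]] : exists f : R -> R, [/\ measurable_fun setT f, forall u, 0 <= f u <= 1,
    forall y, y <= x - 2 * d -> f (expR (- y)) = 1, forall y, x - d <= y -> f (expR (- y)) = 0 &
    (fun n => Ex P (fun t => f (U n t))) @ \oo --> chi2_functional (fun t => f (expR (- t)))].
  by apply: ramp_test; rewrite ltrD2l ltrN2 -subr_gt0 mulr_natl mulr2n addrK.
have Fup := chi2_test_le mf1 f101 f10; have Flow := chi2_test_ge mf2 f201 f21.
have F1 : `|chi2_cdf q x - chi2_cdf q (x + 2 * d)| <= e / 4.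
  by apply: Fd; rewrite opprD addNKr normrN gtr0_norm// mulr_gt0.
have F2 : `|chi2_cdf q x - chi2_cdf q (x - 2 * d)| <= e / 4.
  by apply: Fd; rewrite opprB addrC subrK gtr0_norm// mulr_gt0.
move: f1c f2c => /cvgrPdist_le/(_ _ e4) up /cvgrPdist_le/(_ _ e4) low.
apply: filterS3 near_event up low => n [B [mB PB HB]] up low.
have PU := cdf_le_test mf1 f101 f11 mB HB; have PL := test_le_cdf mf2 f201 f20 mB HB.
exact: dist_sandwich F1 F2 up low PU PL Fup Flow PB.
Qed.

End chi_squared_limit.

(** * Moore-Penrose inverse and measurability of the statistics *)

Section moore_penrose.
Context {R : realType}.
Implicit Types n m p q : nat.

Definition posdef q (G : 'M[R]_q) := forall x : 'rV[R]_q, x != 0 -> 0 < (x *m G *m x^T) 0 0.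

Lemma mulmx_tr_ge0 n (x : 'rV[R]_n) : 0 <= (x *m x^T) 0 0.
Proof. by rewrite mxE sumr_ge0// => i _; rewrite mxE -expr2 sqr_ge0. Qed.

Lemma mulmx_tr_gt0 n (x : 'rV[R]_n) : x != 0 -> 0 < (x *m x^T) 0 0.
Proof.
move=> x0; rewrite lt0r mulmx_tr_ge0 andbT; apply: contra_neq x0 => /eqP.
rewrite mxE psumr_eq0 => [/allP x0|i _]; last by rewrite mxE -expr2 sqr_ge0.
apply/rowP => i; have := x0 i; rewrite mem_index_enum => /(_ isT).
by rewrite mxE -expr2 sqrf_eq0 => /eqP ->; rewrite mxE.
Qed.

Lemma posdef_gram m n (A : 'M[R]_(m, n)) : row_free A -> posdef (A *m A^T).
Proof.
move=> fA x x0; rewrite mulmxA -mulmxA -trmx_mul mulmx_tr_gt0//.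
by apply: contra_neq x0 => xA; apply: (row_free_inj fA); rewrite xA mul0mx.
Qed.

Lemma posdef_unitmx q (G : 'M[R]_q) : posdef G -> G \in unitmx.
Proof.
move=> pG; rewrite -row_free_unit -kermx_eq0; apply/eqP/row_matrixP => i; rewrite row0.
apply/eqP; apply: contraT => /pG; rewrite -row_mul mulmx_ker row0 mul0mx mxE ltxx//.
Qed.

(* Gram-Schmidt, one step of which replaces G by its Schur complement. *)
Lemma posdef_normalize q (G : 'M[R]_q) : G^T = G -> posdef G ->
  exists Q : 'M[R]_q, Q *m G *m Q^T = 1%:M.
Proof.
elim: q G => [|q IH] G sG pG; first by exists 1%:M; apply/matrixP => -[].
pose e0 : 'rV[R]_(1 + q) := row_mx 1%:M 0.
pose G' : 'M[R]_(1 + q) := G.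
pose a := (e0 *m G' *m e0^T) 0 0.
have a0 : 0 < a.
  apply: pG; apply/eqP => e00; have := row_mxKl (1%:M : 'M[R]_1) (0 : 'rV_q).
  rewrite -/e0 e00 => /matrixP/(_ 0 0); rewrite !mxE => /esym/eqP; by rewrite oner_eq0.
have aE : e0 *m G' *m e0^T = a%:M by rewrite [LHS]mx11_scalar.
pose I0 : 'M[R]_(q, 1 + q) := row_mx 0 1%:M.
(* The last q unit vectors made orthogonal to [e0] for the form G. [LI] below shows that they stay
   independent, so the complement is again positive definite. *)
pose L : 'M[R]_(q, 1 + q) := I0 - a^-1 *: (I0 *m G' *m e0^T *m e0).
have Le0 : L *m G' *m e0^T = 0.
  rewrite /L mulmxBl mulmxBl -!scalemxAl -!mulmxA (mulmxA e0) aE !mulmxA mul_mx_scalar.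
  by rewrite scalerA mulVf ?gt_eqF// scale1r subrr.
have eL0 : e0 *m G' *m L^T = 0.
  by apply: trmx_inj; rewrite !trmx_mul trmxK sG mulmxA Le0 trmx0.
have [||Q' Q'1] := IH (L *m G' *m L^T).
- by rewrite !trmx_mul trmxK sG mulmxA.
- move=> x x0; rewrite -!mulmxA -trmx_mul !mulmxA; apply: pG; apply: contra_neq x0 => xL0.
  have e0I : (e0 : 'rV_(1 + q)) *m I0^T = 0 by rewrite tr_row_mx mul_row_col trmx0 mulmx0 mul0mx addr0.
  have II : (I0 *m I0^T) = 1%:M by rewrite tr_row_mx mul_row_col trmx0 mulmx0 add0r trmx1 mulmx1.
  have LI : L *m I0^T = 1%:M by rewrite mulmxBl II -scalemxAl -(mulmxA _ e0) e0I mulmx0 scaler0 subr0.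
  by rewrite -[x]mulmx1 -LI mulmxA xL0 mul0mx.
pose Q : 'M[R]_(1 + q) := col_mx ((Num.sqrt a)^-1 *: e0) (Q' *m L).
suff K : Q *m G' *m Q^T = 1%:M by exists Q.
rewrite /Q mul_col_mx tr_col_mx mul_col_row.
transitivity (block_mx 1%:M 0 0 1%:M : 'M[R]_(1 + q)); last by rewrite -scalar_mx_block.
congr block_mx.
- rewrite -!scalemxAl linearZ/= -scalemxAr aE scalerA -invfM -expr2 sqr_sqrtr ?ltW//.
  by rewrite scale_scalar_mx mulVf// gt_eqF.
- by rewrite trmx_mul -!scalemxAl mulmxA eL0 mul0mx scaler0.
- by rewrite linearZ/= -scalemxAr -!mulmxA (mulmxA L) Le0 mulmx0 scaler0.
- by rewrite trmx_mul -Q'1 !mulmxA.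
Qed.

(** From Q G Q^T = 1 one gets det(Q)^2 det(G) = 1. *)
Lemma posdef_det_gt0 q (G : 'M[R]_q) : G^T = G -> posdef G -> 0 < \det G.
Proof.
move=> sG pG; have [Q Q1] := posdef_normalize sG pG.
have : \det (Q *m G *m Q^T) = 1 by rewrite Q1 det1.
rewrite !det_mulmx det_tr mulrAC -expr2 => H.
have Q0 : \det Q != 0 by apply: contraTneq (ltr01 (R := R)) => Q0; rewrite -H Q0 expr2 !mul0r ltxx.
by rewrite -(pmulr_rgt0 (\det G) (_ : 0 < \det Q ^+ 2)) ?H// exprn_even_gt0.
Qed.

(** Uniqueness of the pseudo-inverse: M Y and M Z are symmetric projections onto the same column
    space, hence equal; likewise Y M and Z M; then Z = Z M Z = Y M Y. *)
Lemma mpinv_eq p (M Y : 'M[R]_p) : M *m Y *m M = M -> Y *m M *m Y = Y ->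
  (M *m Y)^T = M *m Y -> (Y *m M)^T = Y *m M -> mpinv M = Y.
Proof.
move=> Y1 Y2 Y3 Y4; rewrite /mpinv; case: xgetP => [Z _ [Z1 [Z2 [Z3 Z4]]]|/(_ Y)]; last by case.
have MYZ : M *m Y = M *m Z.
  rewrite -{1}Z1 -mulmxA -[LHS]trmxK trmx_mul Y3 Z3 mulmxA Y1; exact: Z3.
have YMZ : Y *m M = Z *m M.
  rewrite -{1}Z1 mulmxA mulmxA -mulmxA -[LHS]trmxK trmx_mul Y4 Z4 -mulmxA (mulmxA M) Y1; exact: Z4.
by rewrite -Z2 -YMZ -mulmxA -MYZ mulmxA.
Qed.

(** With K = B^T B the pseudo-inverse is B K^-1 G^-1 K^-1 B^T, both products being the orthogonal
    projection B K^-1 B^T; the outer B^T and B cancel the two K^-1. *)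
Lemma mpinv_fullrank p q (B : 'M[R]_(p, q)) (G : 'M[R]_q) : G^T = G -> G \in unitmx ->
  B^T *m B \in unitmx -> B^T *m mpinv (B *m G *m B^T) *m B = invmx G.
Proof.
move=> sG uG uK; set K := B^T *m B in uK.
have sK : (invmx K)^T = invmx K by rewrite trmx_inv trmx_mul trmxK.
have sGi : (invmx G)^T = invmx G by rewrite trmx_inv sG.
pose Y := B *m invmx K *m invmx G *m invmx K *m B^T.
have MY : (B *m G *m B^T) *m Y = B *m invmx K *m B^T.
  by rewrite /Y !mulmxA -(mulmxA _ B^T B) mulmxK// mulmxK.
have YM : Y *m (B *m G *m B^T) = B *m invmx K *m B^T.
  by rewrite /Y !mulmxA -(mulmxA _ B^T B) mulmxKV// mulmxKV.
rewrite (@mpinv_eq _ _ Y).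
- by rewrite /Y !mulmxA -(mulmxA _ B^T B) mulmxKV// -/K mulmxV// mul1mx.
- by rewrite MY !mulmxA -(mulmxA _ B^T B) mulmxKV.
- by rewrite YM /Y !mulmxA -(mulmxA _ B^T B) mulmxKV.
- by rewrite MY !trmx_mul trmxK sK mulmxA.
- by rewrite YM !trmx_mul trmxK sK mulmxA.
Qed.

(** Existence, so that the choice in [mpinv] never falls back on its default 0: for a full-rank
    factorisation M = B C take C^T (C C^T)^-1 (B^T B)^-1 B^T. *)
Lemma mpinv_conditions p (M : 'M[R]_p) : [/\ M *m mpinv M *m M = M, mpinv M *m M *m mpinv M = mpinv M,
  (M *m mpinv M)^T = M *m mpinv M & (mpinv M *m M)^T = mpinv M *m M].
Proof.
move: (mulmx_base M) (row_base_free M) (col_base_full M).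
move: (\rank M) (col_base M) (row_base M) => q B C <- fC fB.
have uB : B^T *m B \in unitmx.
  have /posdef_gram/posdef_unitmx : row_free B^T by rewrite /row_free mxrank_tr.
  by rewrite trmxK.
have uC : C *m C^T \in unitmx by exact/posdef_unitmx/posdef_gram.
pose Y := C^T *m invmx (C *m C^T) *m invmx (B^T *m B) *m B^T.
have MY : B *m C *m Y = B *m invmx (B^T *m B) *m B^T.
  by rewrite /Y !mulmxA -(mulmxA _ C C^T) mulmxK.
have YM : Y *m (B *m C) = C^T *m invmx (C *m C^T) *m C.
  by rewrite /Y !mulmxA -(mulmxA _ B^T B) mulmxKV.
have sB : (B *m C *m Y)^T = B *m C *m Y by rewrite MY !trmx_mul trmxK trmx_inv trmx_mul trmxK mulmxA.
have sC : (Y *m (B *m C))^T = Y *m (B *m C) by rewrite YM !trmx_mul trmxK trmx_inv trmx_mul trmxK mulmxA.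
have Y1 : B *m C *m Y *m (B *m C) = B *m C by rewrite MY !mulmxA -(mulmxA _ B^T B) mulmxKV.
have Y2 : Y *m (B *m C) *m Y = Y by rewrite YM /Y !mulmxA -(mulmxA _ C C^T) mulmxKV.
by rewrite (@mpinv_eq _ _ Y).
Qed.

(** The regularised pseudo-inverse. For e > 0 it involves only the inverse of a nonsingular matrix,
    hence depends measurably on M. *)
Definition tikhonov p (M : 'M[R]_p) (e : R) : 'M[R]_p := invmx (M^T *m M + e%:M) *m M^T.

Lemma posdef_tikhonov p (M : 'M[R]_p) (e : R) : 0 < e -> posdef (M^T *m M + e%:M).
Proof.
move=> e0 x x0; rewrite mulmxDr mulmxDl mxE mulmxA -mulmxA ltr_wpDl//.
  by have := mulmx_tr_ge0 (x *m M^T); rewrite trmx_mul trmxK.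
by rewrite mul_mx_scalar -scalemxAl mxE mulr_gt0// mulmx_tr_gt0.
Qed.

(** The matrix e (M^T M + e)^-1 is a contraction: the image u of w satisfies |u|^2 <= <w, u>, and
    expanding |u - w|^2 >= 0 gives |u| <= |w|. *)
Lemma tikhonov_shrink p (M : 'M[R]_p) (e : R) (w : 'rV[R]_p) i : 0 < e ->
  ((e *: (w *m invmx (M^T *m M + e%:M))) 0 i) ^+ 2 <= (w *m w^T) 0 0.
Proof.
move=> e0; set G := M^T *m M + e%:M; set u := e *: _.
have uG : G \in unitmx by apply/posdef_unitmx/posdef_tikhonov.
have uGe : u *m G = e *: w by rewrite /u -scalemxAl mulmxKV.
clearbody u.
have H : (u *m u^T) 0 0 <= (w *m u^T) 0 0.
  have uMM : 0 <= (u *m M^T *m M *m u^T) 0 0.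
    by have := mulmx_tr_ge0 (u *m M^T); rewrite trmx_mul trmxK mulmxA.
  have addE (A B : 'M[R]_1) : (A + B) 0 0 = A 0 0 + B 0 0 by rewrite mxE.
  have scaleE (A : 'M[R]_1) : (e *: A) 0 0 = e * A 0 0 by rewrite mxE.
  have : (u *m G *m u^T) 0 0 = (e *: (w *m u^T)) 0 0 by rewrite uGe scalemxAl.
  rewrite /G mulmxDr mulmxDl mul_mx_scalar mulmxA addE -scalemxAl !scaleE => H.
  by rewrite -(ler_pM2l e0) -H lerDr.
apply: (@le_trans _ _ ((u *m u^T) 0 0)).
  rewrite [leRHS]mxE (bigD1 i)//= mxE -expr2 lerDl sumr_ge0// => j _.
  by rewrite mxE -expr2 sqr_ge0.
have := mulmx_tr_ge0 (u - w).
rewrite linearB/= mulmxBl !mulmxBr !mxE.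
have -> : \sum_j u 0 j * w^T j 0 = \sum_j w 0 j * u^T j 0 by apply: eq_bigr => j _; rewrite !mxE mulrC.
by move: H; rewrite !mxE; lra.
Qed.

(* With Z = Y^T Y Y^T for Y = mpinv M one has Y^T = Z M^T M, hence
   Y^T - (tikhonov M e)^T = e Z - e (e Z (M^T M + e)^-1). *)
Lemma tikhonov_cvg p (M : 'M[R]_p) i j :
  (fun n => tikhonov M n.+1%:R^-1 i j) @ \oo --> mpinv M i j.
Proof.
have [Y1 Y2 Y3 Y4] := mpinv_conditions M; set Y := mpinv M in Y1 Y2 Y3 Y4 *.
pose Z := Y^T *m Y *m Y^T.
have MY : M^T *m M *m Y = M^T by rewrite -mulmxA -Y3 -trmx_mul Y1.
have MY' : Y^T *m (M^T *m M) = M by apply: trmx_inj; rewrite !trmx_mul !trmxK MY.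
have YZ : Y^T = Z *m (M^T *m M).
  by rewrite /Z -mulmxA MY' -mulmxA -Y4 -trmx_mul Y2.
have key (e : R) : 0 < e -> `|Y i j - tikhonov M e i j| <=
    e * (`|Z j i| + Num.sqrt ((row j Z *m (row j Z)^T) 0 0)).
  move=> e0; set G := M^T *m M + e%:M.
  have uG : G \in unitmx by apply/posdef_unitmx/posdef_tikhonov.
  have sG : G^T = G by rewrite /G linearD/= trmx_mul trmxK tr_scalar_mx.
  have E : Y^T - (tikhonov M e)^T = e *: Z - e *: (e *: (Z *m invmx G)).
    rewrite /tikhonov trmx_mul trmxK trmx_inv sG.
    have -> : M = Y^T *m G - e *: Y^T by rewrite /G mulmxDr MY' mul_mx_scalar addrK.
    rewrite mulmxBl mulmxK// opprB addrC addrNK -scalemxAl [in LHS]YZ.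
    have -> : M^T *m M = G - e%:M by rewrite addrK.
    by rewrite mulmxBr mulmxBl mulmxK// mul_mx_scalar -scalemxAl scalerBr.
  have -> : Y i j - tikhonov M e i j = (Y^T - (tikhonov M e)^T) j i by rewrite !mxE.
  rewrite E -scalerBr mxE normrM gtr0_norm// ler_pM2l// mxE.
  apply: le_trans (ler_normD _ _) _; rewrite lerD2l mxE normrN.
  rewrite -sqrtr_sqr ler_wsqrtr// .
  have -> : (e *: (Z *m invmx G)) j i = (e *: (row j Z *m invmx G)) 0 i by rewrite -row_mul !mxE.
  exact: tikhonov_shrink.
apply/cvgrPdist_le => e e0; set c := `|Z j i| + Num.sqrt ((row j Z *m (row j Z)^T) 0 0) in key.
have c0 : 0 <= c by rewrite addr_ge0// sqrtr_ge0.
near=> n; apply: le_trans (key _ _) _; first by rewrite invr_gt0 ltr0n.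
suff : n.+1%:R^-1 <= e / (c + 1) by rewrite ler_pdivlMr ?ltr_wpDl// mulrDr mulr1; apply: le_trans; rewrite lerDl.
have : `|0 - n.+1%:R^-1| <= e / (c + 1) :> R.
  near: n; move: (@cvg_harmonic R) => /cvgrPdist_le; apply.
  by rewrite divr_gt0// ltr_wpDl.
by rewrite sub0r normrN ger0_norm.
Unshelve. all: by end_near. Qed.

End moore_penrose.

(** * Measurability of the estimators and of the Wald statistics *)

Section measurable_matrices.
Context {R : realType} {dT : measure_display} {T : measurableType dT}.

Definition mx_measurable m n (M : T -> 'M[R]_(m, n)) :=
  forall i j, measurable_fun setT (fun t => M t i j).

Lemma mx_measurable_cst m n (A : 'M[R]_(m, n)) : mx_measurable (fun=> A).
Proof. by []. Qed.

Lemma mx_measurable_mul m n p (M : T -> 'M[R]_(m, n)) (N : T -> 'M[R]_(n, p)) :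
  mx_measurable M -> mx_measurable N -> mx_measurable (fun t => M t *m N t).
Proof.
move=> mM mN i j; rewrite (_ : (fun t => _) = fun t => \sum_k M t i k * N t k j).
  by apply: measurable_sum => k; exact: measurable_funM.
by apply/funext => t; rewrite mxE.
Qed.

Lemma mx_measurableD m n (M N : T -> 'M[R]_(m, n)) :
  mx_measurable M -> mx_measurable N -> mx_measurable (fun t => M t + N t).
Proof.
move=> mM mN i j; under eq_fun do rewrite mxE; exact: measurable_funD.
Qed.

Lemma mx_measurableN m n (M : T -> 'M[R]_(m, n)) :
  mx_measurable M -> mx_measurable (fun t => - M t).
Proof. by move=> mM i j; under eq_fun do rewrite mxE; apply: measurableT_comp. Qed.

Lemma mx_measurableZ m n (c : T -> R) (M : T -> 'M[R]_(m, n)) :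
  measurable_fun setT c -> mx_measurable M -> mx_measurable (fun t => c t *: M t).
Proof. by move=> mc mM i j; under eq_fun do rewrite mxE; exact: measurable_funM. Qed.

Lemma mx_measurable_tr m n (M : T -> 'M[R]_(m, n)) :
  mx_measurable M -> mx_measurable (fun t => (M t)^T).
Proof. by move=> mM i j; under eq_fun do rewrite mxE; exact: mM. Qed.

Lemma mx_measurable_sum m n (I : Type) (r : seq I) (M : I -> T -> 'M[R]_(m, n)) :
  (forall k, mx_measurable (M k)) -> mx_measurable (fun t => \sum_(k <- r) M k t).
Proof.
move=> mM i j; under eq_fun do rewrite summxE.
by apply: measurable_sum => k; exact: mM.
Qed.

Lemma mx_measurable_row_mx m n p (M : T -> 'M[R]_(m, n)) (N : T -> 'M[R]_(m, p)) :
  mx_measurable M -> mx_measurable N -> mx_measurable (fun t => row_mx (M t) (N t)).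
Proof.
move=> mM mN i j; case: (splitP j) => k jk.
  rewrite (_ : (fun t => _) = fun t => M t i k); first exact: mM.
  by apply/funext => t; rewrite (_ : j = lshift p k) ?row_mxEl//; exact: val_inj.
rewrite (_ : (fun t => _) = fun t => N t i k); first exact: mN.
by apply/funext => t; rewrite (_ : j = rshift n k) ?row_mxEr//; exact: val_inj.
Qed.

Lemma mx_measurable_col_mx m n p (M : T -> 'M[R]_(m, p)) (N : T -> 'M[R]_(n, p)) :
  mx_measurable M -> mx_measurable N -> mx_measurable (fun t => col_mx (M t) (N t)).
Proof.
move=> mM mN; rewrite (_ : (fun t => _) = fun t => (row_mx (M t)^T (N t)^T)^T).
  by apply/mx_measurable_tr/mx_measurable_row_mx; exact: mx_measurable_tr.
by apply/funext => t; rewrite tr_row_mx !trmxK.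
Qed.

Lemma measurable_det n (M : T -> 'M[R]_n) : mx_measurable M -> measurable_fun setT (fun t => \det (M t)).
Proof.
move=> mM; have mp (s : 'S_n) : measurable_fun setT (fun t => \prod_i M t i (s i)).
  by apply: (measurable_prod (h := fun i t => M t i (s i)) (s := index_enum 'I_n)) => i _; exact: mM.
rewrite (_ : (fun t => _) = fun t => \sum_(s : 'S_n) (-1) ^+ s * \prod_i M t i (s i)) //.
by apply: measurable_sum => s; apply: measurable_funM.
Qed.

Lemma measurable_trace n (M : T -> 'M[R]_n) : mx_measurable M -> measurable_fun setT (fun t => \tr (M t)).
Proof. by move=> mM; apply: measurable_sum => i; exact: mM. Qed.

Lemma measurable_invr (f : T -> R) : measurable_fun setT f -> measurable_fun setT (fun t => (f t)^-1).
Proof. exact: measurableT_comp measurable_inv. Qed.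

Lemma mx_measurable_inv n (M : T -> 'M[R]_n) : mx_measurable M -> mx_measurable (fun t => invmx (M t)).
Proof.
move=> mM i j; have mdet := measurable_det mM.
(* The first branch is the value that [invmx] assigns to singular matrices. *)
rewrite (_ : (fun t => _) = fun t => if \det (M t) == 0 then M t i j else
    (\det (M t))^-1 * cofactor (M t) j i).
  apply: measurable_fun_ifT; [exact: measurable_fun_eqr|exact: mM|].
  apply: measurable_funM; first exact: measurable_invr.
  apply: measurable_funM => //; apply: measurable_det => a b.
  by under eq_fun do rewrite 2!mxE; exact: mM.
apply/funext => t; rewrite /invmx unitmxE unitfE.
by case: eqP => //= _; rewrite !mxE.
Qed.

(** Rank jumps make the pseudo-inverse discontinuous; it is measurable as the pointwise limit of
    [tikhonov]. *)
Lemma mx_measurable_mpinv n (M : T -> 'M[R]_n) : mx_measurable M -> mx_measurable (fun t => mpinv (M t)).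
Proof.
move=> mM i j; apply: (measurable_fun_cvg (h := fun N t => tikhonov (M t) N.+1%:R^-1 i j)) => [N|t _].
  apply: mx_measurable_mul; last exact: mx_measurable_tr.
  apply/mx_measurable_inv/mx_measurableD => //.
  by apply: mx_measurable_mul => //; exact: mx_measurable_tr.
exact: tikhonov_cvg.
Qed.

Lemma measurable_dotv n (u w : T -> 'cV[R]_n) : mx_measurable u -> mx_measurable w ->
  measurable_fun setT (fun t => dotv (u t) (w t)).
Proof. by move=> mu mw; apply: mx_measurable_mul => //; exact: mx_measurable_tr. Qed.

Lemma mx_measurable_vecmx n (M : T -> 'M[R]_n) : mx_measurable M -> mx_measurable (fun t => vecmx (M t)).
Proof. by move=> mM i j; under eq_fun do rewrite mxE; exact: mM. Qed.

Lemma mx_measurable_kron_row n (u w : T -> 'rV[R]_n) : mx_measurable u -> mx_measurable w ->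
  mx_measurable (fun t => kron_row (u t) (w t)).
Proof. by move=> mu mw i j; under eq_fun do rewrite mxE; exact: measurable_funM. Qed.

Lemma mx_measurable_Dtilde n (u : T -> 'cV[R]_n) : mx_measurable u ->
  mx_measurable (fun t => Dtilde (u t)).
Proof.
move=> mu i j; under eq_fun do rewrite mxE.
apply: measurable_funB; first apply: measurable_funB.
- by apply: measurable_funM => //; apply: measurableT_comp.
- by apply: measurable_funM => //; apply: measurable_funM.
- by apply: measurable_funM.
Qed.

Section plug_in.
Variables (d : nat) (v : mcv_variant) (mu : T -> 'cV[R]_d) (S : T -> 'M[R]_d).
Hypotheses (mmu : mx_measurable mu) (mS : mx_measurable S).

Let mSmu : mx_measurable (fun t => S t *m mu t). Proof. exact: mx_measurable_mul. Qed.
Let mm2 : measurable_fun setT (fun t => dotv (mu t) (mu t)). Proof. exact: measurable_dotv. Qed.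
Let mm2V n : measurable_fun setT (fun t => (dotv (mu t) (mu t) ^+ n)^-1).
Proof. by apply: measurable_invr; exact: measurable_funX. Qed.
Let mSi : mx_measurable (fun t => invmx (S t)). Proof. exact: mx_measurable_inv. Qed.
Let msqrt (f : T -> R) : measurable_fun setT f -> measurable_fun setT (fun t => Num.sqrt (f t)).
Proof. exact: measurableT_comp measurable_sqrt. Qed.

Lemma measurable_MCV : measurable_fun setT (fun t => MCV v (mu t) (S t)).
Proof.
rewrite /MCV; case: v; apply: msqrt.
- apply: measurable_funM; last exact: measurable_invr.
  exact: measurableT_comp (measurable_powR _) (measurable_det mS).
- by apply: measurable_funM; [exact: measurable_trace|exact: measurable_invr].
- apply: measurable_invr; apply: measurable_dotv => //; exact: mx_measurable_mul.
- by apply: measurable_funM => //; exact: measurable_dotv.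
Qed.

Lemma mx_measurable_Amat : mx_measurable (fun t => Amat v (mu t) (S t)).
Proof.
have mmT := mx_measurable_tr mmu; have mD := mx_measurable_Dtilde mmu.
have mdet := measurable_det mS; have mtr := measurable_trace mS.
have mm1 : measurable_fun setT (fun t => (dotv (mu t) (mu t))^-1) by exact: measurable_invr.
have mvT (M : T -> 'M[R]_d) : mx_measurable M -> mx_measurable (fun t => (vecmx (M t))^T).
  by move=> mM; apply: mx_measurable_tr; exact: mx_measurable_vecmx.
have mI := mvT _ (@mx_measurable_cst _ _ (1%:M : 'M[R]_d)).
rewrite /Amat; case: v.
- apply: mx_measurable_row_mx; [apply: mx_measurableD|]; apply: mx_measurableZ.
  + by apply: measurable_funM => //; exact: measurable_funM.
  + exact: mmT.
  + exact: measurable_funM.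
  + by apply: mx_measurable_mul => //; exact: mvT.
  + exact: measurable_funM.
  + exact: mvT.
- apply: mx_measurable_row_mx; [apply: mx_measurableD|]; apply: mx_measurableZ => //.
  + by apply: measurable_funM => //; exact: measurable_funM.
  + exact: mx_measurable_mul.
- have mu' : mx_measurable (fun t => (mu t)^T *m invmx (S t)) by exact: mx_measurable_mul.
  apply: mx_measurable_row_mx; [apply: mx_measurableD|apply: mx_measurableN].
  + exact: mx_measurableZ.
  + by apply/mx_measurableN/mx_measurable_mul => //; exact: mx_measurable_kron_row.
  + exact: mx_measurable_kron_row.
- apply: mx_measurable_row_mx; last by apply: mx_measurableZ => //; exact: mx_measurable_kron_row.
  apply: mx_measurableD; first apply: mx_measurableD; apply: mx_measurableZ => //.
  + by apply: measurable_funM => //; apply: measurable_funM => //; exact: measurable_dotv.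
  + exact: measurable_funM.
  + exact: mx_measurable_mul.
  + by apply: mx_measurable_mul => //; exact: mx_measurable_kron_row.
Qed.

End plug_in.

Lemma measurable_Sfac d v (c : T -> R) : measurable_fun setT c ->
  measurable_fun setT (fun t => Sfac d v (c t)).
Proof.
move=> mc; case: v => /=; last 3 first.
- by apply: measurable_invr; exact: measurable_funX.
- exact: measurable_funX.
- by apply: measurable_invr; exact: measurable_funX.
apply: measurable_funM => //; case: (2 - _)%R => n; first exact: measurable_funX.
by apply: measurable_invr; exact: measurable_funX.
Qed.

Lemma measurable_wald k r (H : 'M[R]_(r, k)) n nn (est : T -> 'cV[R]_k) (sig : 'I_k -> T -> R) :
  mx_measurable est -> (forall i, measurable_fun setT (sig i)) ->
  measurable_fun setT (fun t => wald H n nn (est t) (sig^~ t)).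
Proof.
move=> mest msig; apply: measurable_funM => //.
have mHe : mx_measurable (fun t => H *m est t) by exact: mx_measurable_mul.
apply: mx_measurable_mul => //; apply: mx_measurable_mul; first exact: mx_measurable_tr.
apply: mx_measurable_mpinv; apply: mx_measurable_mul => //; apply: mx_measurable_mul => // i j.
under eq_fun do rewrite 2!mxE -[_ *+ (i == j)]mulr_natr.
by apply: measurable_funM => //; apply: measurable_funM.
Qed.

Section sample.
Variables (k d : nat) (v : mcv_variant) (X : 'I_k -> nat -> T -> d.-tuple R).
Hypothesis mX : forall i j, measurable_fun setT (X i j).

Lemma measurable_obs i j a : measurable_fun setT (fun t => obs X i t j a 0).
Proof. by under eq_fun do rewrite mxE; exact: measurableT_comp (@measurable_tnth _ _ _ a) (mX i j). Qed.

Lemma mx_measurable_smean i n : mx_measurable (fun t => smean n (obs X i t)).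
Proof.
apply: mx_measurableZ => //; apply: mx_measurable_sum => j a b.
by rewrite (ord1 b); exact: measurable_obs.
Qed.

Lemma mx_measurable_scov i n : mx_measurable (fun t => scov n (obs X i t)).
Proof.
apply: mx_measurableZ => //; apply: mx_measurable_sum => j.
have mc : mx_measurable (fun t => obs X i t j - smean n (obs X i t)).
  apply: mx_measurableD; last exact/mx_measurableN/mx_measurable_smean.
  by move=> a b; rewrite (ord1 b); exact: measurable_obs.
by apply: mx_measurable_mul => //; exact: mx_measurable_tr.
Qed.

Lemma measurable_emp n (f : nat -> T -> R) : (forall j, measurable_fun setT (f j)) ->
  measurable_fun setT (fun t => emp n (f^~ t)).
Proof. by move=> mf; apply: measurable_funM => //; apply: measurable_sum => j; exact: mf. Qed.

Lemma mx_measurable_Omega i n : mx_measurable (fun t => Omega n (obs X i t)).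
Proof.
have mo := @measurable_obs i.
have m3 : mx_measurable (fun t => Psi3 n (obs X i t)).
  move=> a b; under eq_fun do rewrite mxE /=.
  apply: measurable_funB; first by apply: measurable_emp => j; do !apply: measurable_funM => //.
  by apply: measurable_funM; apply: measurable_emp => j //; apply: measurable_funM.
have m4 : mx_measurable (fun t => Psi4 n (obs X i t)).
  move=> a b; under eq_fun do rewrite mxE /=.
  apply: measurable_funB; first by apply: measurable_emp => j; do !apply: measurable_funM => //.
  by apply: measurable_funM; apply: measurable_emp => j //; apply: measurable_funM.
apply: mx_measurable_col_mx; apply: mx_measurable_row_mx => //.
- exact: mx_measurable_scov.
- exact: mx_measurable_tr.
Qed.

Lemma measurable_Chat i n : measurable_fun setT (fun t => Chat v n (obs X i t)).
Proof. by apply: measurable_MCV; [exact: mx_measurable_smean|exact: mx_measurable_scov]. Qed.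

Lemma measurable_sig2C i n : measurable_fun setT (fun t => sig2C v n (obs X i t)).
Proof.
have mA : mx_measurable (fun t => Amat v (smean n (obs X i t)) (scov n (obs X i t))).
  by apply: mx_measurable_Amat; [exact: mx_measurable_smean|exact: mx_measurable_scov].
apply: measurable_funM; first by apply: measurable_funM => //; apply/measurable_Sfac/measurable_Chat.
by do !apply: mx_measurable_mul => //; [exact: mx_measurable_Omega|exact: mx_measurable_tr].
Qed.

Lemma measurable_sig2B i n : measurable_fun setT (fun t => sig2B v n (obs X i t)).
Proof.
apply: measurable_funM; last exact: measurable_sig2C.
by apply: measurable_invr; apply: measurable_funX; exact: measurable_Chat.
Qed.

Lemma measurable_S_C r (H : 'M[R]_(r, k)) nn m : measurable_fun setT (S_C v H X nn m).
Proof.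
apply: (@measurable_wald _ _ H _ _ _ (fun i t => sig2C v (nn i m) (obs X i t))) => i.
  by move=> j; under eq_fun do rewrite mxE; exact: measurable_Chat.
exact: measurable_sig2C.
Qed.

Lemma measurable_S_B r (H : 'M[R]_(r, k)) nn m : measurable_fun setT (S_B v H X nn m).
Proof.
apply: (@measurable_wald _ _ H _ _ _ (fun i t => sig2B v (nn i m) (obs X i t))) => i.
  by move=> j; under eq_fun do rewrite mxE; exact/measurable_invr/measurable_Chat.
exact: measurable_sig2B.
Qed.

End sample.
End measurable_matrices.

(** * Limit theorems for one group *)

Lemma Intg_of_sqr {R : realType} {dT} {T : measurableType dT} (P : probability T R) (f : T -> R) :
  measurable_fun setT f -> Intg P (fun t => f t ^+ 2) -> Intg P f.
Proof.
move=> mf If; apply: (Intg_le mf (IntgD (Intg_cst P 1) If)) => t.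
by rewrite /cst/= -(real_normK (num_real (f t))); have := sqr_ge0 (`|f t| - 1); have := normr_ge0 (f t); nra.
Qed.

Lemma Intg_mul_sqr {R : realType} {dT} {T : measurableType dT} (P : probability T R) (f g : T -> R) :
  measurable_fun setT f -> measurable_fun setT g ->
  Intg P (fun t => f t ^+ 2) -> Intg P (fun t => g t ^+ 2) -> Intg P (fun t => f t * g t).
Proof.
move=> mf mg If Ig; apply: (Intg_le (measurable_funM mf mg) (IntgD If Ig)) => t.
rewrite ler_norml /=; have h1 := sqr_ge0 (f t - g t); have h2 := sqr_ge0 (f t + g t).
by have h3 := sqr_ge0 (f t); have h4 := sqr_ge0 (g t); apply/andP; split; nra.
Qed.

Section group_limits.
Context {R : realType} {dT dS : measure_display}
  {T : measurableType dT} {S : measurableType dS} {k : nat}.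
Variables (P : probability T R) (X : 'I_k * nat -> T -> S).
Hypothesis mX : forall p, measurable_fun setT (X p).
Hypothesis indepX : indep_family P X.
Hypothesis identX : forall p B, measurable B ->
  P (X p @^-1` B) = P (X (p.1, 0%N) @^-1` B).
Variables (nn : 'I_k -> nat -> nat) (kappa : 'I_k -> R).
Hypothesis nn_ratio : forall i, (fun m : nat => (nn i m)%:R / m%:R) @ \oo --> kappa i.
Hypothesis kappa_gt0 : forall i, 0 < kappa i.

(** The rate uses the total sample size, so that all groups share one normalisation; the group
    proportions then enter through the variances. *)
Definition root_size (m : nat) : R := Num.sqrt m%:R.

Lemma root_size_neq0 : \forall m \near \oo, root_size m != 0.
Proof. by exists 1%N => // m /= m1; rewrite /root_size sqrtr_eq0 -ltNge ltr0n. Qed.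

Lemma root_size_inv_cvg0 : (fun m => (root_size m)^-1) @ \oo --> 0.
Proof.
apply/cvgr0Pnorm_le => e e0.
have [N] : exists N : nat, (e ^+ 2)^-1 < N%:R by exists (Num.bound (e ^+ 2)^-1); apply: archi_boundP; rewrite invr_ge0 sqr_ge0.
move=> eN; exists N.+1 => // m /= Nm.
have m0 : 0 < m%:R :> R by rewrite ltr0n (leq_ltn_trans _ Nm).
have sm0 : 0 < root_size m by rewrite sqrtr_gt0.
rewrite ger0_norm ?invr_ge0 ?(ltW sm0)// -[e]invrK lef_pV2 ?posrE ?invr_gt0//.
rewrite -[leLHS]ger0_norm ?invr_ge0 ?(ltW e0)// -sqrtr_sqr ler_wsqrtr// exprVn.
by apply: ltW; apply: lt_trans eN _; rewrite ltr_nat.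
Qed.

Lemma size_ratio_inv i : (fun m : nat => m%:R / (nn i m)%:R) @ \oo --> (kappa i)^-1.
Proof.
have K : (fun m : nat => ((nn i m)%:R / m%:R)^-1) @ \oo --> (kappa i)^-1.
  by apply: cvgV; [exact: lt0r_neq0|exact: nn_ratio].
apply: cvg_trans K; by apply: near_eq_cvg; apply: nearW => m; rewrite /= invf_div.
Qed.

Lemma size_gt0 i : \forall m \near \oo, (0 < nn i m)%N.
Proof.
have k0 := lt0r_neq0 (kappa_gt0 i).
apply: filterS (cvgr_neq0 _ (nn_ratio (i := i)) k0) => m.
by rewrite lt0n; apply: contra_neq => ->; rewrite mul0r.
Qed.

Lemma root_over_size i : (fun m => root_size m / (nn i m)%:R) @ \oo --> 0.
Proof.
have K : (fun m => (root_size m)^-1 * (m%:R / (nn i m)%:R)) @ \oo --> 0 * (kappa i)^-1.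
  by apply: cvgM; [exact: root_size_inv_cvg0|exact: size_ratio_inv].
rewrite mul0r in K; apply: cvg_trans K; apply: near_eq_cvg.
apply: filterS root_size_neq0 => m m0.
have <- : root_size m * root_size m = m%:R by rewrite -expr2 sqr_sqrtr.
by rewrite mulrA mulrA mulVf// mul1r.
Qed.

Lemma size_inv_cvg0 i : (fun m => (nn i m)%:R^-1) @ \oo --> (0 : R).
Proof.
have K : (fun m => (root_size m)^-1 * (root_size m / (nn i m)%:R)) @ \oo --> (0 * 0 : R).
  by apply: cvgM; [exact: root_size_inv_cvg0|exact: root_over_size].
rewrite mul0r in K; apply: cvg_trans K; apply: near_eq_cvg.
by apply: filterS root_size_neq0 => m m0; rewrite mulrA mulVf// mul1r.
Qed.

Lemma measurable_emp_array i n (y : S -> R) : measurable_fun setT y ->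
  measurable_fun setT (fun t => emp n (fun j => y (X (i, j) t))).
Proof.
by move=> my; apply: (@measurable_emp _ _ _ n (fun j t => y (X (i, j) t))) => j; exact: measurableT_comp my (mX _).
Qed.

(** Embeds a single group in the array of k groups by giving the others no observations, so that
    one-group limits follow from the array theorems. *)
Let only (i : 'I_k) (U : Type) (u u0 : U) (i' : 'I_k) := if i' == i then u else u0.

Let sum_only i (n : nat) (y : S -> R) (c : R) t :
  \sum_(i' < k) \sum_(j < only i n 0%N i') c * only i y (fun=> 0) i' (X (i', nat_of_ord j) t) =
  \sum_(j < n) c * y (X (i, nat_of_ord j) t).
Proof.
rewrite (bigD1 i)//= /only eqxx [X in _ + X]big1 ?addr0// => i' /negbTE ->.
by rewrite big_ord0.
Qed.

Let cos_LLN_group i (y : S -> R) (c : nat -> R) (b : R) : measurable_fun setT y ->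
  Intg P (fun t => y (X (i, 0%N) t)) -> Ex P (fun t => y (X (i, 0%N) t)) = 0 ->
  c @ \oo --> 0 -> (fun m => (nn i m)%:R * `|c m|) @ \oo --> b ->
  (fun m => Ex P (fun t => cos (\sum_(j < nn i m) c m * y (X (i, nat_of_ord j) t)))) @ \oo --> (1 : R).
Proof.
move=> my Iy Ey c0 Nc.
suff K : (fun m => Ex P (fun t => cos (\sum_(i' < k) \sum_(j < only i (nn i m) 0%N i')
    c m * only i y (fun=> 0) i' (X (i', nat_of_ord j) t)))) @ \oo --> (1 : R).
  apply: cvg_trans K; apply: near_eq_cvg; apply: nearW => m.
  by congr (Ex P _); apply/funext => t; rewrite sum_only.
apply: (@cos_LLN _ _ _ _ _ _ P X mX indepX identX (only i y (fun=> 0))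
  (fun i' m => only i (nn i m) 0%N i') (fun=> c) (only i b 0)) => // i'; first [exact: c0|rewrite /only; case: eqP => [?|_]; try subst i'; try done].
- exact: Intg_cst.
- exact: Ex_cst.
- by under eq_fun do rewrite mul0r; exact: cvg_cst.
Qed.

Let cos_CLT_group i (y : S -> R) (c : nat -> R) (b : R) : measurable_fun setT y ->
  Intg P (fun t => y (X (i, 0%N) t) ^+ 2) -> Ex P (fun t => y (X (i, 0%N) t)) = 0 ->
  c @ \oo --> 0 -> (fun m => (nn i m)%:R * c m ^+ 2) @ \oo --> b ->
  (fun m => Ex P (fun t => cos (\sum_(j < nn i m) c m * y (X (i, nat_of_ord j) t)))) @ \oo -->
    expR (- (b * Ex P (fun t => y (X (i, 0%N) t) ^+ 2) / 2)).
Proof.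
move=> my Iy Ey c0 Nc.
have -> : b * Ex P (fun t => y (X (i, 0%N) t) ^+ 2) / 2 =
    \sum_(i' < k) only i b 0 i' * Ex P (fun t => only i y (fun=> 0) i' (X (i', 0%N) t) ^+ 2) / 2.
  rewrite (bigD1 i)//= /only eqxx [X in _ + X]big1 ?addr0// => i' /negbTE ->.
  by rewrite !mul0r.
suff K : (fun m => Ex P (fun t => cos (\sum_(i' < k) \sum_(j < only i (nn i m) 0%N i')
    c m * only i y (fun=> 0) i' (X (i', nat_of_ord j) t)))) @ \oo --> expR (- (\sum_(i' < k) only i b 0 i' * Ex P (fun t => only i y (fun=> 0) i' (X (i', 0%N) t) ^+ 2) / 2)).
  apply: cvg_trans K; apply: near_eq_cvg; apply: nearW => m.
  by congr (Ex P _); apply/funext => t; rewrite sum_only.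
apply: (@cos_CLT _ _ _ _ _ _ P X mX indepX identX (only i y (fun=> 0))
  (fun i' m => only i (nn i m) 0%N i') (fun=> c) (only i b 0)) => // i'; first [exact: c0|rewrite /only; case: eqP => [?|_]; try subst i'; try done].
- by apply: Intg_of_sqr => //; exact: measurableT_comp my (mX _).
- exact: Intg_cst.
- by under eq_fun do rewrite expr0n; exact: Intg_cst.
- exact: Ex_cst.
- by under eq_fun do rewrite mul0r; exact: cvg_cst.
Qed.

Definition group_mean i (y : S -> R) := Ex P (fun t => y (X (i, 0%N) t)).

(** The normalised sum that serves as linear part; with the rate of the total size, its limiting
    variance is the variance of [y] divided by [kappa i]. *)
Definition group_fluctuation i (y : S -> R) (z : nat * T) :=
  root_size z.1 * emp (nn i z.1) (fun j => y (X (i, j) z.2) - group_mean i y).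

Let centred i (y : S -> R) : Intg P (fun t => y (X (i, 0%N) t)) ->
  Ex P (fun t => y (X (i, 0%N) t) - group_mean i y) = 0.
Proof.
move=> Iy; rewrite (ExB Iy (Intg_cst P (group_mean i y))).
by rewrite [X in _ - X](Ex_cst P) subrr.
Qed.

Let emp_centred i n (y : S -> R) (c : R) t : (0 < n)%N ->
  emp n (fun j => y (X (i, j) t) - c) = emp n (fun j => y (X (i, j) t)) - c.
Proof.
move=> n0; rewrite /emp sumrB mulrBr; congr (_ - _).
by rewrite sumr_const card_ord -[c *+ n]mulr_natl mulrA mulVf ?mul1r// pnatr_eq0 -lt0n.
Qed.

(** Assumes a first moment only, as is needed for the products of four coordinates in [Psi4]. *)
Lemma emp_cvg i (y : S -> R) : measurable_fun setT y -> Intg P (fun t => y (X (i, 0%N) t)) ->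
  (fun z => emp (nn i z.1) (fun j => y (X (i, j) z.2))) @ whp P --> group_mean i y.
Proof.
move=> my Iy; pose y' x := y x - group_mean i y.
have my' : measurable_fun setT y' by exact: measurable_funB.
have K : (fun z => emp (nn i z.1) (fun j => y' (X (i, j) z.2))) @ whp P --> 0.
  apply: (@laplace_cvg0 _ _ _ P (fun m t => emp (nn i m) (fun j => y' (X (i, j) t)))) => [m|u].
    exact: measurable_emp_array.
  have := @cos_LLN_group i y' (fun m => u * (nn i m)%:R^-1) `|u| my' _ (centred Iy).
  rewrite (_ : (fun m => Ex P _) = fun m => Ex P (fun t => cos (u * emp (nn i m) (fun j => y' (X (i, j) t))))); last first.
    by apply/funext => m; congr (Ex P _); apply/funext => t; rewrite /emp mulrA mulr_sumr.
  apply.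
  - by apply: IntgB => //; exact: Intg_cst.
  - by rewrite -(mulr0 u); apply: cvgMl_tmp; exact: size_inv_cvg0.
  - have K : (fun=> `|u|) @ \oo --> `|u| by exact: cvg_cst.
    apply: cvg_trans K; apply: near_eq_cvg; apply: filterS (size_gt0 i) => m m0.
    by rewrite normrM [`|_^-1|]ger0_norm ?invr_ge0// mulrCA mulfV ?mulr1// pnatr_eq0 -lt0n.
have K2 : (fun z => emp (nn i z.1) (fun j => y' (X (i, j) z.2)) + group_mean i y) @ whp P --> 0 + group_mean i y.
  by apply: cvgD => //; exact: cvg_cst.
rewrite add0r in K2; apply: whp_cvg_near K2.
apply: whp_filterS (whp_seq P (size_gt0 i)) => z /= z0.
by rewrite /y' emp_centred// subrK.
Qed.

Lemma measurable_group_fluctuation i y m : measurable_fun setT y ->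
  measurable_fun setT (fun t => group_fluctuation i y (m, t)).
Proof.
move=> my; apply: measurable_funM => //=.
by apply: (@measurable_emp_array i (nn i m) (fun x => y x - group_mean i y)); exact: measurable_funB.
Qed.

Lemma tight_group_fluctuation i (y : S -> R) : measurable_fun setT y ->
  Intg P (fun t => y (X (i, 0%N) t) ^+ 2) -> tight P (group_fluctuation i y).
Proof.
move=> my Iy2; pose y' x := y x - group_mean i y.
have my' : measurable_fun setT y' by exact: measurable_funB.
have mXi := measurableT_comp my (mX (i, 0%N)).
have Iy := Intg_of_sqr mXi Iy2.
have Iy'2 : Intg P (fun t => y' (X (i, 0%N) t) ^+ 2).
  rewrite (_ : (fun t => _) = fun t => y (X (i, 0%N) t) ^+ 2 - 2 * group_mean i y * y (X (i, 0%N) t) + group_mean i y ^+ 2).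
    by apply: IntgD; [apply: IntgB => //; exact: IntgZ|exact: Intg_cst].
  by apply/funext => t; rewrite /y'; ring.
pose v := (kappa i)^-1 * Ex P (fun t => y' (X (i, 0%N) t) ^+ 2).
apply: (@laplace_tight _ _ _ P (fun m t => group_fluctuation i y (m, t)) v).
- by rewrite mulr_ge0 ?invr_ge0 ?(ltW (kappa_gt0 i))// Ex_ge0// => t; exact: sqr_ge0.
- by move=> m; exact: measurable_group_fluctuation.
move=> u; have := @cos_CLT_group i y' (fun m => u * (root_size m / (nn i m)%:R)) (u ^+ 2 * (kappa i)^-1) my' Iy'2 (centred Iy).
rewrite (_ : (fun m => Ex P _) = fun m => Ex P (fun t => cos (u * group_fluctuation i y (m, t)))); last first.
  apply/funext => m; congr (Ex P _); apply/funext => t.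
  rewrite /group_fluctuation /emp !mulr_sumr; congr (cos _); apply: eq_bigr => j _.
  by rewrite /y' /=; ring.
rewrite /v mulrA; apply.
- by rewrite -(mulr0 u); apply: cvgMl_tmp; exact: root_over_size.
- have K : (fun m => u ^+ 2 * (m%:R / (nn i m)%:R)) @ \oo --> u ^+ 2 * (kappa i)^-1.
    by apply: cvgMl_tmp; exact: size_ratio_inv.
  apply: cvg_trans K; apply: near_eq_cvg; apply: filterS (size_gt0 i) => m m0.
  have n0 : (nn i m)%:R != 0 :> R by rewrite pnatr_eq0 -lt0n.
  by rewrite !exprMn sqr_sqrtr//; field.
Qed.

Lemma asy_linear_emp i (y : S -> R) : measurable_fun setT y ->
  Intg P (fun t => y (X (i, 0%N) t) ^+ 2) ->
  asy_linear P root_size (fun z => emp (nn i z.1) (fun j => y (X (i, j) z.2))) (group_mean i y)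
    (group_fluctuation i y).
Proof.
move=> my Iy2; split; first exact: tight_group_fluctuation.
(* The expansion is exact once the group is nonempty; an empty empirical mean is 0 by convention and
   would leave the centring behind. *)
apply: (whp_cvg_near (f := fun=> 0)); last exact: cvg_cst.
apply: whp_filterS (whp_seq P (size_gt0 i)) => z /= z0.
by rewrite /group_fluctuation emp_centred// subrr.
Qed.

Lemma group_fluctuation_sum i (I : finType) (c : I -> R) (y : I -> S -> R) z :
  (forall q, Intg P (fun t => y q (X (i, 0%N) t))) ->
  group_fluctuation i (fun x => \sum_q c q * y q x) z = \sum_q c q * group_fluctuation i (y q) z.
Proof.
move=> Iy; rewrite /group_fluctuation /emp.
have -> : group_mean i (fun x => \sum_q c q * y q x) = \sum_q c q * group_mean i (y q).
  rewrite /group_mean Ex_sum => [|q]; last exact: IntgZ.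
  by apply: eq_bigr => q _; rewrite ExZ.
rewrite mulrA mulr_sumr; under [RHS]eq_bigr do rewrite mulrA mulrA mulr_sumr.
rewrite exchange_big; apply: eq_bigr => j _ /=.
rewrite -sumrB mulr_sumr; apply: eq_bigr => q _; ring.
Qed.

End group_limits.

(** * Continuity of the plug-in variance *)

Section plug_in_continuity.
Context {R : realType} {dT : measure_display} {T : measurableType dT}.
Variable P : probability T R.
Local Notation whp := (whp P).
Local Notation mx_cvg := (mx_cvg P).

Lemma whp_cvgX (n : nat) (c : nat * T -> R) (l : R) : c @ whp --> l -> (fun z => c z ^+ n) @ whp --> l ^+ n.
Proof.
move=> cl; elim: n => [|n IH].
  by apply: (whp_cvg_ext (f := fun=> 1)) => [z|]; [rewrite expr0|exact: cvg_cst].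
have K : (fun z => c z * c z ^+ n) @ whp --> l * l ^+ n by exact: cvgM.
by rewrite exprS; apply: whp_cvg_ext K => z; rewrite exprS.
Qed.

Lemma mx_cvgN m n (M : nat * T -> 'M[R]_(m, n)) A : mx_cvg M A -> mx_cvg (fun z => - M z) (- A).
Proof.
move=> MA i j; have K : (fun z => - M z i j) @ whp --> - A i j by apply: cvgN; exact: MA.
by rewrite mxE; apply: whp_cvg_ext K => z; rewrite mxE.
Qed.

Lemma mx_cvg_row_mx m n p (M : nat * T -> 'M[R]_(m, n)) A (N : nat * T -> 'M[R]_(m, p)) B :
  mx_cvg M A -> mx_cvg N B -> mx_cvg (fun z => row_mx (M z) (N z)) (row_mx A B).
Proof.
move=> MA NB i j; case: (splitP j) => l jl.
  rewrite (_ : j = lshift p l); last exact: val_inj.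
  by rewrite row_mxEl; apply: whp_cvg_ext (MA i l) => z; rewrite row_mxEl.
rewrite (_ : j = rshift n l); last exact: val_inj.
by rewrite row_mxEr; apply: whp_cvg_ext (NB i l) => z; rewrite row_mxEr.
Qed.

Lemma mx_cvg_vecmx n (M : nat * T -> 'M[R]_n) A : mx_cvg M A -> mx_cvg (fun z => vecmx (M z)) (vecmx A).
Proof. by move=> MA i j; rewrite mxE; apply: whp_cvg_ext (MA _ _) => z; rewrite mxE. Qed.

Lemma mx_cvg_kron_row n (u w : nat * T -> 'rV[R]_n) a b : mx_cvg u a -> mx_cvg w b ->
  mx_cvg (fun z => kron_row (u z) (w z)) (kron_row a b).
Proof.
move=> ua wb i j; rewrite mxE.
have K : (fun z => u z 0 (vcol j) * w z 0 (vrow j)) @ whp --> a 0 (vcol j) * b 0 (vrow j).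
  by apply: cvgM; [exact: ua|exact: wb].
by apply: whp_cvg_ext K => z; rewrite mxE.
Qed.

Lemma mx_cvg_Dtilde n (x : nat * T -> 'cV[R]_n) y : mx_cvg x y -> mx_cvg (fun z => Dtilde (x z)) (Dtilde y).
Proof.
move=> xy i j; rewrite mxE; set a := vcol i; set r := vrow i.
have K : (fun z => - (x z r 0) * ((j == a) && (a != r))%:R - 2 * x z j 0 * ((j == r) && (r == a))%:R
     - x z a 0 * ((r == j) && (j != a))%:R) @ whp --> - (y r 0) * ((j == a) && (a != r))%:R
     - 2 * y j 0 * ((j == r) && (r == a))%:R - y a 0 * ((r == j) && (j != a))%:R.
  apply: cvgB; first apply: cvgB; apply: cvgMr_tmp; first by apply: cvgN; exact: xy.
    by apply: cvgMl_tmp; exact: xy.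
  exact: xy.
by apply: whp_cvg_ext K => z; rewrite mxE.
Qed.

Lemma cvg_dotv n (u w : nat * T -> 'cV[R]_n) a b : mx_cvg u a -> mx_cvg w b ->
  (fun z => dotv (u z) (w z)) @ whp --> dotv a b.
Proof. by move=> ua wb; exact: (mx_cvg_mul (mx_cvg_tr ua) wb). Qed.

Lemma cvg_trace n (M : nat * T -> 'M[R]_n) A : mx_cvg M A -> (fun z => \tr (M z)) @ whp --> \tr A.
Proof. by move=> MA; apply: cvg_sum_whp => i; exact: MA. Qed.

Lemma mx_cvg_Amat d v (mu : 'cV[R]_d) (S : 'M[R]_d) muh Sh : mcv_regular v mu S ->
  mx_cvg muh mu -> mx_cvg Sh S -> mx_cvg (fun z => Amat v (muh z) (Sh z)) (Amat v mu S).
Proof.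
move=> [_ m20 reg] hmu hS.
have hm2 := cvg_dotv hmu hmu; have hmuT := mx_cvg_tr hmu; have hD := mx_cvg_Dtilde hmu.
have hm2V n : (fun z => (dotv (muh z) (muh z) ^+ n)^-1) @ whp --> (dotv mu mu ^+ n)^-1.
  by apply: cvgV; [rewrite expf_neq0// lt0r_neq0|exact: whp_cvgX].
have hm2V1 : (fun z => (dotv (muh z) (muh z))^-1) @ whp --> (dotv mu mu)^-1.
  by apply: cvgV => //; rewrite lt0r_neq0.
have hdet := cvg_det hS; have htr := cvg_trace hS.
have hI : mx_cvg (fun=> (vecmx (1%:M : 'M[R]_d))^T) (vecmx (1%:M : 'M[R]_d))^T by exact: mx_cvg_cst.
rewrite /Amat; case: v reg => reg.
- have uS : S \in unitmx by rewrite unitmxE unitfE lt0r_neq0.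
  have hSi := mx_cvg_tr (mx_cvg_vecmx (mx_cvg_inv hS uS)).
  have hq : (fun z => \det (Sh z) / dotv (muh z) (muh z) ^+ d) @ whp --> \det S / dotv mu mu ^+ d by exact: cvgM.
  apply: mx_cvg_row_mx; last by apply: mx_cvgZ; [exact: hq|exact: hSi].
  apply: mx_cvgD; apply: mx_cvgZ => //; last exact: mx_cvg_mul.
  by apply: cvgM => //; exact: cvgMl_tmp.
- apply: mx_cvg_row_mx; last exact: mx_cvgZ.
  apply: mx_cvgD; apply: mx_cvgZ => //; last exact: mx_cvg_mul.
  by apply: cvgM => //; exact: cvgMl_tmp.
- case: reg => uS _; have hu := mx_cvg_mul hmuT (mx_cvg_inv hS uS).
  have hk := mx_cvg_kron_row hu hu.
  apply: mx_cvg_row_mx; last exact: mx_cvgN.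
  apply: mx_cvgD; first by apply: mx_cvgZ => //; exact: cvg_cst.
  by apply: mx_cvgN; exact: mx_cvg_mul.
- have hk := mx_cvg_kron_row hmuT hmuT.
  apply: mx_cvg_row_mx; last exact: mx_cvgZ.
  have hSm := cvg_dotv hmu (mx_cvg_mul hS hmu).
  apply: mx_cvgD; first apply: mx_cvgD; apply: mx_cvgZ => //.
  + by apply: cvgM => //; exact: cvgMl_tmp.
  + exact: cvgMl_tmp.
  + exact: mx_cvg_mul.
  + exact: mx_cvg_mul.
Qed.

Lemma cvg_Sfac d v (c : nat * T -> R) (l : R) : l != 0 -> c @ whp --> l ->
  (fun z => Sfac d v (c z)) @ whp --> Sfac d v l.
Proof.
move=> l0 cl; have cV n : (fun z => (c z ^+ n)^-1) @ whp --> (l ^+ n)^-1.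
  by apply: cvgV; [rewrite expf_neq0|exact: whp_cvgX].
case: v => /=; [|exact: cV|exact: whp_cvgX|exact: cV].
by apply: cvgMl_tmp; case: (2 - _)%R => n; [exact: whp_cvgX|exact: cV].
Qed.

End plug_in_continuity.

(** * The estimators of one group *)

Section group_estimators.
Context {R : realType} {dT : measure_display} {T : measurableType dT} {k d : nat}.
Variables (P : probability T R) (v : mcv_variant) (X : 'I_k -> nat -> T -> d.-tuple R).
Hypothesis mX : forall i j, measurable_fun setT (X i j).
Hypothesis indepX : mutually_independent P X.
Hypothesis identX : forall i j (B : set (d.-tuple R)), measurable B ->
  P (X i j @^-1` B) = P (X i 0%N @^-1` B).
Variables (nn : 'I_k -> nat -> nat) (kappa : 'I_k -> R).
Hypothesis nn_ratio : forall i, (fun m : nat => (nn i m)%:R / m%:R) @ \oo --> kappa i.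
Hypothesis kappa_gt0 : forall i, 0 < kappa i.
Variable i : 'I_k.
Hypothesis fourth_moment : forall a, P.-integrable setT (fun t => (tnth (X i 0%N t) a ^+ 4)%:E).

Definition data (p : 'I_k * nat) : T -> d.-tuple R := X p.1 p.2.
Let mdata p : measurable_fun setT (data p). Proof. exact: mX. Qed.
Let indep_data : indep_family P data. Proof. exact: indepX. Qed.
Let ident_data p B : measurable B -> P (data p @^-1` B) = P (data (p.1, 0%N) @^-1` B).
Proof. exact: identX. Qed.
Local Notation fluct := (group_fluctuation P data nn i).
Local Notation mean := (group_mean P data i).

Definition vec_of_tuple (x : d.-tuple R) : 'cV[R]_d := \col_a tnth x a.

(* The random vector (X, vec(X X^T)), whose covariance matrix is block (Sigma, Psi3^T; Psi3, Psi4). *)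
Definition moments (x : d.-tuple R) : 'cV[R]_(d + d * d) :=
  col_mx (vec_of_tuple x) (vecmx (vec_of_tuple x *m (vec_of_tuple x)^T)).

Lemma moments_lshift x a : moments x (lshift (d * d) a) 0 = tnth x a.
Proof. by rewrite /moments col_mxEu mxE. Qed.

Lemma moments_rshift x q : moments x (rshift d q) 0 = tnth x (vcol q) * tnth x (vrow q).
Proof. by rewrite /moments col_mxEd !mxE big_ord1 !mxE mulrC. Qed.

Let mtnth a : measurable_fun setT (fun x : d.-tuple R => tnth x a).
Proof. exact: measurable_tnth. Qed.
Let mtnthX a : measurable_fun setT (fun t => tnth (X i 0%N t) a).
Proof. exact: measurableT_comp (mtnth a) (mX _ _). Qed.

Let Intg2 a : Intg P (fun t => tnth (X i 0%N t) a ^+ 2).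
Proof.
apply: Intg_of_sqr; first exact: measurable_funX.
by under eq_fun do rewrite -exprM; exact: fourth_moment.
Qed.

Let Intg4 a b : Intg P (fun t => (tnth (X i 0%N t) a * tnth (X i 0%N t) b) ^+ 2).
Proof.
under eq_fun do rewrite exprMn.
by apply: Intg_mul_sqr; [exact: measurable_funX|exact: measurable_funX| |];
  under eq_fun do rewrite -exprM; exact: fourth_moment.
Qed.

Lemma measurable_moments q : measurable_fun setT (fun x => moments x q 0).
Proof.
case: (splitP q) => l ql.
  rewrite (_ : q = lshift (d * d) l); last exact: val_inj.
  under eq_fun do rewrite moments_lshift; exact: mtnth.
rewrite (_ : q = rshift d l); last exact: val_inj.
by under eq_fun do rewrite moments_rshift; exact: measurable_funM.
Qed.

Lemma Intg_moments_sqr q : Intg P (fun t => moments (data (i, 0%N) t) q 0 ^+ 2).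
Proof.
rewrite /data/=; case: (splitP q) => l ql.
  rewrite (_ : q = lshift (d * d) l); last exact: val_inj.
  by under eq_fun do rewrite moments_lshift.
rewrite (_ : q = rshift d l); last exact: val_inj.
by under eq_fun do rewrite moments_rshift.
Qed.

Let mmomX q : measurable_fun setT (fun t => moments (data (i, 0%N) t) q 0).
Proof. exact: measurableT_comp (measurable_moments q) (mX _ _). Qed.

Lemma Intg_moments q : Intg P (fun t => moments (data (i, 0%N) t) q 0).
Proof. by apply: Intg_of_sqr => //; exact: Intg_moments_sqr. Qed.

Lemma Intg_moments_mul q q' : Intg P (fun t => moments (data (i, 0%N) t) q 0 * moments (data (i, 0%N) t) q' 0).
Proof. by apply: Intg_mul_sqr => //; exact: Intg_moments_sqr. Qed.

Let asy_emp q : asy_linear P root_size (fun z => emp (nn i z.1) (fun j => moments (data (i, j) z.2) q 0))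
  (mean (fun x => moments x q 0)) (fluct (fun x => moments x q 0)).
Proof.
apply: (asy_linear_emp mdata indep_data ident_data nn_ratio kappa_gt0); first exact: measurable_moments.
exact: Intg_moments_sqr.
Qed.

Let empE1 n t a : emp n (fun j => moments (data (i, j) t) (lshift (d * d) a) 0) = smean n (obs X i t) a 0.
Proof.
rewrite /smean mxE summxE; congr (_ * _); apply: eq_bigr => j _.
by rewrite moments_lshift mxE.
Qed.

Lemma mx_asy_linear_smean : mx_asy_linear P root_size (fun z => smean (nn i z.1) (obs X i z.2)) (mu_pop P X i)
  (fun z => \col_a fluct (fun x => moments x (lshift (d * d) a) 0) z).
Proof.
move=> a b; rewrite (ord1 b); apply: asy_linear_ext (asy_emp (lshift (d * d) a)) => [z||z].
- exact: empE1.
- by rewrite mxE; congr (Ex P _); apply/funext => t; rewrite moments_lshift.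
- by rewrite mxE.
Qed.

Let pair_index (a b : 'I_d) : exists q : 'I_(d * d), vrow q = a /\ vcol q = b.
Proof. by have [f _ fK] := @vec_index_bij d; exists (f (a, b)); have [-> ->] := fK (a, b). Qed.

Let mom2 a b (x : d.-tuple R) := tnth x a * tnth x b.

Let mom2E a b : exists q, mom2 a b = fun x => moments x q 0.
Proof.
have [q [qa qb]] := pair_index a b; exists (rshift d q).
by apply/funext => x; rewrite moments_rshift qa qb mulrC.
Qed.

Let Intg_tnth a : Intg P (fun t => tnth (X i 0%N t) a).
Proof. exact: Intg_of_sqr. Qed.

Let Intg_mom2 a b : Intg P (fun t => mom2 a b (X i 0%N t)).
Proof. by have [q ->] := mom2E a b; exact: (Intg_moments q). Qed.

Lemma Sigma_popE a b : Sigma_pop P X i a b =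
  mean (mom2 a b) - mu_pop P X i a 0 * mu_pop P X i b 0.
Proof.
rewrite mxE; set m := mu_pop P X i.
have E1 c : Ex P (fun t => tnth (X i 0%N t) c) = m c 0 by rewrite mxE.
rewrite (_ : (fun t => _) = fun t => mom2 a b (X i 0%N t) - m b 0 * tnth (X i 0%N t) a
    - m a 0 * tnth (X i 0%N t) b + m a 0 * m b 0); last by apply/funext => t; rewrite /mom2; ring.
rewrite ExD; [|by apply: IntgB; [apply: IntgB => //; exact: IntgZ|exact: IntgZ]|exact: Intg_cst].
rewrite [X in _ + X](Ex_cst P) ExB; [|by apply: IntgB => //; exact: IntgZ|exact: IntgZ].
rewrite ExB => //; last exact: IntgZ.
by rewrite !ExZ// !E1 /mean /data/=; ring.
Qed.

Let scovE n t a b : (1 < n)%N -> scov n (obs X i t) a b =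
  n%:R / n.-1%:R * (emp n (fun j => mom2 a b (data (i, j) t)) -
    smean n (obs X i t) a 0 * smean n (obs X i t) b 0).
Proof.
move=> n1; have n0 : n%:R != 0 :> R by rewrite pnatr_eq0 -lt0n (ltn_trans _ n1).
have sE c : \sum_(j < n) tnth (X i j t) c = n%:R * smean n (obs X i t) c 0.
  rewrite mxE summxE mulrA mulfV// mul1r; apply: eq_bigr => j _; by rewrite mxE.
rewrite mxE summxE; set ma := smean _ _ a 0; set mb := smean _ _ b 0.
have -> : \sum_(j < n) ((obs X i t j - smean n (obs X i t)) *m (obs X i t j - smean n (obs X i t))^T) a b =
    \sum_(j < n) (mom2 a b (data (i, nat_of_ord j) t) - mb * tnth (X i j t) a - ma * tnth (X i j t) b + ma * mb).
  apply: eq_bigr => j _; have outer (u : 'cV[R]_d) : (u *m u^T) a b = u a 0 * u b 0.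
    by rewrite mxE big_ord1 mxE.
  have subE (w : 'cV[R]_d) c : (obs X i t j - w) c 0 = tnth (X i j t) c - w c 0 by rewrite !mxE.
  by rewrite outer !subE -/ma -/mb /mom2 /data/=; ring.
rewrite big_split/= sumrB sumrB -!mulr_sumr !sE -/ma -/mb sumr_const card_ord -[mb *+ n]mulr_natl /emp.
set s := \sum_(j < n) _; field; rewrite n0 pnatr_eq0 -lt0n -ltnS prednK//.
exact: ltn_trans n1.
Qed.


Let size_gt1 : \forall m \near \oo, (1 < nn i m)%N.
Proof.
have /cvgr0Pnorm_lt/(_ _ ltr01) := size_inv_cvg0 nn_ratio kappa_gt0 i.
apply: filterS2 (size_gt0 nn_ratio kappa_gt0 i) => m m0.
by rewrite ger0_norm ?invr_ge0// invf_lt1 ?ltr0n// ltr1n.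
Qed.

(** The factor n/(n-1) differs from 1 by 1/(n-1), which vanishes even after multiplication by the
    square root of the total size; its linear part is 0. *)
Let asy_linear_bessel : asy_linear P root_size (fun z => (nn i z.1)%:R / (nn i z.1).-1%:R) 1 (fun=> 0).
Proof.
split; first exact: tight_cst.
apply: (@whp_cvg_seq _ _ _ P (fun m => root_size m * ((nn i m)%:R / (nn i m).-1%:R - 1) - 0)).
have V : (fun m => (1 - (nn i m)%:R^-1)^-1) @ \oo --> (1 - 0 : R)^-1.
  apply: cvgV; first by rewrite subr0 oner_eq0.
  by apply: cvgB; [exact: cvg_cst|exact: (size_inv_cvg0 nn_ratio kappa_gt0 i)].
have K : (fun m => root_size m / (nn i m)%:R * (1 - (nn i m)%:R^-1)^-1) @ \oo --> 0 * (1 - 0 : R)^-1.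
  by apply: cvgM => //; exact: (root_over_size nn_ratio kappa_gt0 i).
rewrite mul0r in K; apply: cvg_trans K; apply: near_eq_cvg; apply: filterS size_gt1 => m m1.
have E : (nn i m).-1%:R = (nn i m)%:R - 1 :> R by rewrite -[in RHS](@prednK (nn i m)) ?(ltn_trans _ m1)// mulrSr addrK.
have n0 : (nn i m)%:R != 0 :> R by rewrite pnatr_eq0 -lt0n (ltn_trans _ m1).
have n1 : (nn i m)%:R - 1 != 0 :> R by rewrite -E pnatr_eq0 -lt0n -ltnS prednK// (ltn_trans _ m1).
by rewrite E; field; rewrite n0 n1.
Qed.

Let asy_mom2 a b : asy_linear P root_size (fun z => emp (nn i z.1) (fun j => mom2 a b (data (i, j) z.2)))
  (mean (mom2 a b)) (fluct (mom2 a b)).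
Proof. by have [q ->] := mom2E a b; exact: asy_emp. Qed.

Let asy_linear_smean a : asy_linear P root_size (fun z => smean (nn i z.1) (obs X i z.2) a 0)
  (mu_pop P X i a 0) (fluct (fun x => moments x (lshift (d * d) a) 0)).
Proof. by apply: asy_linear_ext (mx_asy_linear_smean a 0) => // z; rewrite mxE. Qed.

(** The linear part is written with inner matrices so that it matches the form [LS] expected by
    [asy_linear_MCV]. *)
Lemma mx_asy_linear_scov : mx_asy_linear P root_size (fun z => scov (nn i z.1) (obs X i z.2)) (Sigma_pop P X i)
  (fun z => \matrix_(a, b) ((\matrix_(a', b') fluct (mom2 a' b') z) a b
     - mu_pop P X i a 0 * (\col_a' fluct (fun x => moments x (lshift (d * d) a') 0) z) b 0
     - mu_pop P X i b 0 * (\col_a' fluct (fun x => moments x (lshift (d * d) a') 0) z) a 0)).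
Proof.
have sV := root_size_inv_cvg0 (R := R); have s0 := root_size_neq0 (R := R) => a b.
have B := asy_linearB sV s0 (asy_mom2 a b) (asy_linearM sV s0 (asy_linear_smean a) (asy_linear_smean b)).
have K := asy_linearM sV s0 asy_linear_bessel B.
have K' := asy_linear_near (Y' := fun z => scov (nn i z.1) (obs X i z.2) a b) _ K.
apply: asy_linear_ext (K' _) => // [|z|].
- by rewrite mul1r Sigma_popE.
- by rewrite !mxE; ring.
- by apply: whp_filterS (whp_seq P size_gt1) => z /= z1; rewrite scovE.
Qed.

Definition moments_cov : 'M[R]_(d + d * d) := \matrix_(q, q')
  (mean (fun x => moments x q 0 * moments x q' 0) - mean (fun x => moments x q 0) * mean (fun x => moments x q' 0)).

Let emp_moments_cov q q' : (fun z => emp (nn i z.1) (fun j => moments (data (i, j) z.2) q 0 * moments (data (i, j) z.2) q' 0)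
   - emp (nn i z.1) (fun j => moments (data (i, j) z.2) q 0) * emp (nn i z.1) (fun j => moments (data (i, j) z.2) q' 0))
   @ whp P --> moments_cov q q'.
Proof.
have L (y : d.-tuple R -> R) : measurable_fun setT y -> Intg P (fun t => y (data (i, 0%N) t)) ->
   (fun z => emp (nn i z.1) (fun j => y (data (i, j) z.2))) @ whp P --> mean y.
  exact: (emp_cvg mdata indep_data ident_data nn_ratio kappa_gt0).
rewrite mxE; apply: cvgB.
  apply: (L (fun x => moments x q 0 * moments x q' 0)); last exact: Intg_moments_mul.
  by apply: measurable_funM; exact: measurable_moments.
by apply: cvgM; [apply: (L (fun x => moments x q 0))|apply: (L (fun x => moments x q' 0))];
  by [exact: measurable_moments|exact: Intg_moments].
Qed.

Lemma mx_cvg_Omega : mx_cvg P (fun z => Omega (nn i z.1) (obs X i z.2)) moments_cov.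
Proof.
move=> q q'.
have el z c j : moments (data (i, j) z) (lshift (d * d) c) 0 = obs X i z j c 0 by rewrite moments_lshift mxE.
have er z c j : moments (data (i, j) z) (rshift d c) 0 = obs X i z j (vcol c) 0 * obs X i z j (vrow c) 0.
  by rewrite moments_rshift !mxE.
case: (splitP q) => l ql; case: (splitP q') => l' ql'.
- rewrite (_ : q = lshift (d * d) l); last exact: val_inj.
  rewrite (_ : q' = lshift (d * d) l'); last exact: val_inj.
  (* The upper left block of [Omega] is the sample covariance with divisor n - 1; the other three
     blocks use plain empirical means. *)
  have K := asy_linear_cvg (root_size_inv_cvg0 (R := R)) (root_size_neq0 (R := R)) (mx_asy_linear_scov l l').
  have -> : moments_cov (lshift (d * d) l) (lshift (d * d) l') = Sigma_pop P X i l l'.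
    rewrite Sigma_popE mxE /mom2; congr (mean _ - _ * _).
    + by apply/funext => x; rewrite !moments_lshift.
    + by rewrite mxE; congr (Ex P _); apply/funext => t; rewrite moments_lshift.
    + by rewrite mxE; congr (Ex P _); apply/funext => t; rewrite moments_lshift.
  by apply: whp_cvg_ext K => z; rewrite /Omega block_mxEul.
- rewrite (_ : q = lshift (d * d) l); last exact: val_inj.
  rewrite (_ : q' = rshift d l'); last exact: val_inj.
  have K := @emp_moments_cov (lshift (d * d) l) (rshift d l'); apply: whp_cvg_ext K => z; rewrite /Omega block_mxEur mxE mxE /= [X in _ - X]mulrC.
  by congr (emp _ _ - emp _ _ * emp _ _); apply/funext => j; rewrite ?el ?er// mulrC.
- rewrite (_ : q = rshift d l); last exact: val_inj.
  rewrite (_ : q' = lshift (d * d) l'); last exact: val_inj.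
  have K := @emp_moments_cov (rshift d l) (lshift (d * d) l'); apply: whp_cvg_ext K => z; rewrite /Omega block_mxEdl mxE /=.
  by congr (emp _ _ - emp _ _ * emp _ _); apply/funext => j; rewrite ?el ?er.
- rewrite (_ : q = rshift d l); last exact: val_inj.
  rewrite (_ : q' = rshift d l'); last exact: val_inj.
  have K := @emp_moments_cov (rshift d l) (rshift d l'); apply: whp_cvg_ext K => z; rewrite /Omega block_mxEdr mxE /=.
  by congr (emp _ _ - emp _ _ * emp _ _); apply/funext => j; rewrite ?el ?er ?mulrA.
Qed.

Local Notation mu := (mu_pop P X i).
Local Notation Sigma := (Sigma_pop P X i).
Hypothesis d_gt0 : (0 < d)%N.
Hypothesis regular : mcv_regular v mu Sigma.

(* Influence function of the plug-in estimator, up to its mean. *)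
Definition score (x : d.-tuple R) : R :=
  mcv_scale d v (MCV v mu Sigma) * (Amat v mu Sigma *m moments x) 0 0.

Let scoreE : score = fun x => \sum_q (mcv_scale d v (MCV v mu Sigma) * Amat v mu Sigma 0 q) * moments x q 0.
Proof.
by apply/funext => x; rewrite /score mxE mulr_sumr; apply: eq_bigr => q _; rewrite mulrA.
Qed.

Lemma measurable_score : measurable_fun setT score.
Proof.
rewrite scoreE; apply: measurable_sum => q; apply: measurable_funM => //; exact: measurable_moments.
Qed.

Lemma asy_linear_Chat :
  asy_linear P root_size (fun z => Chat v (nn i z.1) (obs X i z.2)) (MCV v mu Sigma) (fluct score).
Proof.
have K := asy_linear_MCV (root_size_inv_cvg0 (R := R)) (root_size_neq0 (R := R))
  mx_asy_linear_smean mx_asy_linear_scov d_gt0 regular.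
apply: asy_linear_ext K => // z; rewrite scoreE group_fluctuation_sum; last exact: Intg_moments.
rewrite mxE mulr_sumr; apply: eq_bigr => q _; rewrite mulrA; congr (_ * _).
case: (splitP q) => l ql.
  by rewrite (_ : q = lshift (d * d) l) ?col_mxEu ?mxE//; exact: val_inj.
rewrite (_ : q = rshift d l) ?col_mxEd ?mxE//; last exact: val_inj.
congr (fluct _ z); apply/funext => x.
by rewrite moments_rshift /mom2 mulrC.
Qed.

Definition score_var : R := Ex P (fun t => (score (X i 0%N t) - mean score) ^+ 2).

Let meanE : mean score = \sum_q (mcv_scale d v (MCV v mu Sigma) * Amat v mu Sigma 0 q) * mean (fun x => moments x q 0).
Proof.
rewrite scoreE /group_mean Ex_sum => [|q]; last by apply: IntgZ; exact: Intg_moments.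
by apply: eq_bigr => q _; rewrite ExZ//; exact: Intg_moments.
Qed.

Lemma Intg_score_sqr : Intg P (fun t => score (X i 0%N t) ^+ 2).
Proof.
rewrite scoreE; under eq_fun do rewrite expr2 mulr_suml.
apply: Intg_sum => q; under eq_fun do rewrite mulr_sumr.
apply: Intg_sum => q'.
set c := _ * Amat _ _ _ _ q; set c' := _ * Amat _ _ _ _ q'.
rewrite (_ : (fun t => _) = fun t => c * c' * (moments (data (i, 0%N) t) q 0 * moments (data (i, 0%N) t) q' 0)).
  by apply: IntgZ; exact: Intg_moments_mul.
by apply/funext => t; rewrite /data/=; ring.
Qed.

(** The variance of a linear functional of [moments] is a quadratic form in [moments_cov], and the
    square of [mcv_scale] is the prefactor in [sig2C]. *)
Lemma score_varE : score_var = Sfac d v (MCV v mu Sigma) / 4 *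
  (Amat v mu Sigma *m moments_cov *m (Amat v mu Sigma)^T) 0 0.
Proof.
rewrite -mcv_scale_sqr ?MCV_gt0// /score_var meanE scoreE.
set s := mcv_scale _ _ _; set A := Amat _ _ _.
pose m q := mean (fun x => moments x q 0).
pose y q t := moments (data (i, 0%N) t) q 0.
have Iy q q' : Intg P (fun t => (y q t - m q) * (y q' t - m q')).
  rewrite (_ : (fun t => _) = fun t => y q t * y q' t - m q' * y q t - m q * y q' t + m q * m q').
    apply: IntgD; last exact: Intg_cst.
    apply: IntgB; last by apply: IntgZ; exact: Intg_moments.
    by apply: IntgB; [exact: Intg_moments_mul|apply: IntgZ; exact: Intg_moments].
  by apply/funext => t; ring.
have covE q q' : Ex P (fun t => (y q t - m q) * (y q' t - m q')) = moments_cov q q'.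
  rewrite (_ : (fun t => _) = fun t => y q t * y q' t - m q' * y q t - m q * y q' t + m q * m q'); last first.
    by apply/funext => t; ring.
  have I1 := Intg_moments q; have I2 := Intg_moments q'; have I3 := Intg_moments_mul q q'.
  have I4 := IntgB I3 (IntgZ (m q') I1).
  rewrite (ExD (IntgB I4 (IntgZ (m q) I2)) (Intg_cst P (m q * m q'))) (ExB I4 (IntgZ (m q) I2)) (ExB I3 (IntgZ (m q') I1)).
  rewrite (ExZ (m q') I1) (ExZ (m q) I2) [X in _ + X](Ex_cst P) mxE /m /group_mean; ring.
rewrite (_ : (fun t => _) = fun t => \sum_q \sum_q' (s * A 0 q * (s * A 0 q')) * ((y q t - m q) * (y q' t - m q'))); last first.
  apply/funext => t; rewrite -sumrB expr2 mulr_suml; apply: eq_bigr => q _.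
  rewrite mulr_sumr; apply: eq_bigr => q' _; rewrite /y /m /data/=; ring.
rewrite Ex_sum => [|q]; last by apply: Intg_sum => q'; exact: IntgZ.
under eq_bigr do (rewrite Ex_sum; last by move=> q'; exact: IntgZ).
rewrite exchange_big [in RHS]mxE mulr_sumr; apply: eq_bigr => q' _ /=.
rewrite mxE [in RHS]mxE mulr_suml mulr_sumr.
by apply: eq_bigr => q _; rewrite ExZ// covE; ring.
Qed.

Lemma sig2C_cvg : (fun z => sig2C v (nn i z.1) (obs X i z.2)) @ whp P --> score_var.
Proof.
have sV := root_size_inv_cvg0 (R := R); have s0 := root_size_neq0 (R := R).
have hC := asy_linear_cvg sV s0 asy_linear_Chat.
have hm : mx_cvg P (fun z => smean (nn i z.1) (obs X i z.2)) mu.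
  by move=> a b; exact: (asy_linear_cvg sV s0 (mx_asy_linear_smean a b)).
have hS : mx_cvg P (fun z => scov (nn i z.1) (obs X i z.2)) Sigma.
  by move=> a b; exact: (asy_linear_cvg sV s0 (mx_asy_linear_scov a b)).
have hA := mx_cvg_Amat regular hm hS.
rewrite score_varE; apply: cvgM.
  by apply: cvgMr_tmp; apply: cvg_Sfac => //; rewrite lt0r_neq0// MCV_gt0.
exact: (mx_cvg_mul (mx_cvg_mul hA mx_cvg_Omega) (mx_cvg_tr hA)).
Qed.

End group_estimators.

(** * Positivity of the population quantities and of the asymptotic variance *)

Section positive_semidefinite.
Context {R : realType} {d : nat}.
Variable S : 'M[R]_d.
Hypothesis symS : S^T = S.
Hypothesis psdS : forall x : 'rV[R]_d, 0 <= (x *m S *m x^T) 0 0.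

(** If x is null for the form, its value at s x + y with y = x S is affine in s with slope 2 |y|^2,
    so it takes negative values unless y = 0. *)
Lemma psd_null (x : 'rV[R]_d) : (x *m S *m x^T) 0 0 = 0 -> x *m S = 0.
Proof.
move=> x0; apply/eqP; apply: contraT => /mulmx_tr_gt0; set y := x *m S => y0.
pose c := (y *m S *m y^T) 0 0; pose q := (y *m y^T) 0 0.
(* Chosen to give the value -1. *)
pose s := - (c + 1) / (2 * q).
have E : ((s *: x + y) *m S *m (s *: x + y)^T) 0 0 = 2 * s * q + c.
  have addE (A B : 'M[R]_1) : (A + B) 0 0 = A 0 0 + B 0 0 by rewrite mxE.
  have scaleE (t : R) (A : 'M[R]_1) : (t *: A) 0 0 = t * A 0 0 by rewrite mxE.
  rewrite linearD linearZ/= mulmxDl mulmxDl !mulmxDr -!scalemxAl -!scalemxAr !addE !scaleE x0 -/c.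
  have -> : (y *m S *m x^T) 0 0 = q.
    by rewrite -mulmxA /q; congr ((y *m _) 0 0); rewrite /y trmx_mul symS.
  by rewrite -/y -/q; ring.
have := psdS (s *: x + y); rewrite E /s.
have -> : 2 * (- (c + 1) / (2 * q)) * q + c = -1 by field; rewrite lt0r_neq0.
by rewrite oppr_ge0 leNgt ltr01.
Qed.

Lemma psd_unitmx_posdef : S \in unitmx -> posdef S.
Proof.
move=> uS x x0; rewrite lt_neqAle psdS andbT eq_sym; apply: contra_neq x0 => /psd_null xS.
by rewrite -(mulmxK uS x) xS mul0mx.
Qed.

(** A zero trace makes every diagonal entry 0, and [psd_null] at the unit vectors then kills every
    row. *)
Lemma psd_trace_gt0 : S != 0 -> 0 < \tr S.
Proof.
have dS a : ((delta_mx 0 a : 'rV[R]_d) *m S *m (delta_mx 0 a : 'rV[R]_d)^T) 0 0 = S a a :> R.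
  by rewrite -rowE trmx_delta -colE !mxE.
have S0 a : 0 <= S a a by rewrite -dS.
move=> SN; rewrite lt0r sumr_ge0 ?andbT//; apply: contra_neq SN => /eqP.
rewrite psumr_eq0// => /allP H; apply/row_matrixP => a; rewrite row0 rowE.
by apply: psd_null; rewrite dS; apply/eqP/H; rewrite mem_index_enum.
Qed.

End positive_semidefinite.

Lemma mcv_scale_neq0 {R : realType} d v (c : R) : (0 < d)%N -> 0 < c -> mcv_scale d v c != 0.
Proof.
move=> d0 c0; have cn := lt0r_neq0 c0.
have dn : (d%:R : R) != 0 by rewrite pnatr_eq0 -lt0n.
by case: v => /=; do ?[apply: mulf_neq0 | rewrite oppr_eq0 | rewrite invr_eq0 | apply: expf_neq0]; rewrite // ?pnatr_eq0 -?lt0n.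
Qed.

Lemma Ex_sqr_eq0 {R : realType} {dT} {T : measurableType dT} (P : probability T R) (f : T -> R) :
  measurable_fun setT f -> Intg P (fun t => f t ^+ 2) -> Ex P (fun t => f t ^+ 2) = 0 ->
  exists N, [/\ measurable N, P N = 0%E & forall t, ~ N t -> f t = 0].
Proof.
move=> mf If E0; pose g t := f t ^+ 2.
have mg : measurable_fun setT (EFin \o g) by apply/measurable_EFinP; exact: measurable_funX.
have [+ _] := ae_eq_integral_abs P measurableT mg.
have -> : (\int[P]_(x in setT) `|(EFin \o g) x| = (Ex P g)%:E)%E.
  rewrite /Ex fineK; last exact: (integrable_fin_num measurableT (f := EFin \o g) If).
  by apply: eq_integral => x _; rewrite /= ger0_norm ?sqr_ge0.
rewrite [Ex P g]E0 => /(_ erefl) [N [mN PN sub]]; exists N; split => // t nN.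
have /contrapT/(_ I) : ~ ~ ([set: T] t -> (EFin \o g) t = cst 0%E t) by move=> /sub.
by move=> /= -[] /eqP; rewrite sqrf_eq0 => /eqP.
Qed.

Section leading_coefficient.
Context {R : realType} {d : nat}.
Variables (mu : 'cV[R]_d) (S : 'M[R]_d).

Let sum_delta (F : 'M[R]_d) a : \sum_i \sum_j F i j * (delta_mx a a : 'M[R]_d) i j = F a a.
Proof.
rewrite (bigD1 a)//= (bigD1 a)//= mxE !eqxx mulr1 big1 => [|j ja]; last by rewrite mxE eqxx (negbTE ja) mulr0.
rewrite addr0 big1 ?addr0// => i ia; rewrite big1// => j _.
by rewrite mxE (negbTE ia) mulr0.
Qed.

Let kron_delta (u : 'rV[R]_d) a : (kron_row u u *m vecmx (delta_mx a a)) 0 0 = u 0 a ^+ 2.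
Proof.
rewrite kron_row_dot -(mul_delta_mx (0 : 'I_1)) mulmxA -mulmxA -colE -rowE.
by rewrite mxE big_ord1 !mxE.
Qed.

Let nonzero_entry (u : 'rV[R]_d) : u != 0 -> exists a, u 0 a != 0.
Proof.
move=> u0; apply: contrapT => H; move/eqP: u0; apply; apply/rowP => a; rewrite mxE.
by apply/eqP; apply: contraT => ua; case: H; exists a.
Qed.

(** This is the coefficient of the squared coordinate a in the score. For RR it is a diagonal entry
    of the positive definite S^-1, for VV a constant, so any a serves; for VN and AZ it is a
    multiple of the squared a-th entry of S^-1 mu or mu, and a is chosen where that entry is
    nonzero. *)
Lemma Amat_leading_coefficient v : mcv_regular v mu S -> (v = RR -> posdef S) ->
  exists a, (rsubmx (Amat v mu S) *m vecmx (delta_mx a a)) 0 0 != 0.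
Proof.
move=> [symS mu0 reg] pS.
have muN : mu^T != 0.
  apply: contraTneq mu0 => H; rewrite /dotv H mul0mx mxE ltxx//.
have m2N : dotv mu mu != 0 by rewrite lt0r_neq0.
have d_gt0 : (0 < d)%N.
  by have [a _] := nonzero_entry muN; exact: leq_ltn_trans (ltn_ord a).
have scaleE (t : R) (A : 'M[R]_1) : (t *: A) 0 0 = t * A 0 0 by rewrite mxE.
case: v reg pS => reg pS; rewrite /Amat row_mxKr.
- exists (Ordinal d_gt0); rewrite -scalemxAl scaleE vecmx_dot sum_delta.
  rewrite mulf_neq0 ?mulf_neq0 ?invr_eq0 ?expf_neq0// ?lt0r_neq0//.
  have pS' := pS erefl; have uS := posdef_unitmx pS'.
  have r0 : row (Ordinal d_gt0) (invmx S) != 0.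
    apply/eqP => H; have := congr1 (fun M => row (Ordinal d_gt0) M 0 (Ordinal d_gt0)) (mulVmx uS).
    by rewrite row_mul H mul0mx !mxE eqxx => /esym/eqP; rewrite oner_eq0.
  have := pS' _ r0; rewrite -row_mul mulVmx// tr_row trmx_inv symS => H.
  rewrite (_ : invmx S _ _ = (row (Ordinal d_gt0) 1%:M *m col (Ordinal d_gt0) (invmx S)) 0 0)//.
  by rewrite -row_mul mul1mx !mxE.
- exists (Ordinal d_gt0); rewrite -scalemxAl scaleE vecmx_dot sum_delta mxE eqxx mulr1.
  by rewrite invr_neq0.
- case: reg => uS reg; have u0 : mu^T *m invmx S != 0.
    by apply: contraTneq reg => H; rewrite /dotv mulmxA H mul0mx mxE ltxx.
  have [a ua] := nonzero_entry u0; exists a.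
  by rewrite mulNmx mxE oppr_eq0 kron_delta expf_neq0.
- have [a ua] := nonzero_entry muN; exists a.
  by rewrite -scalemxAl scaleE kron_delta mulf_neq0 ?invr_neq0 ?expf_neq0.
Qed.

End leading_coefficient.

Section group_regularity.
Context {R : realType} {dT : measure_display} {T : measurableType dT} {k d : nat}.
Variables (P : probability T R) (v : mcv_variant) (X : 'I_k -> nat -> T -> d.-tuple R).
Hypothesis mX : forall i j, measurable_fun setT (X i j).
Variable i : 'I_k.
Hypothesis ass1 : assumption1 P v X i.
Local Notation mu := (mu_pop P X i).
Local Notation Sigma := (Sigma_pop P X i).

Let fourth_moment a : P.-integrable setT (fun t => (tnth (X i 0%N t) a ^+ 4)%:E).
Proof. by case: ass1. Qed.

Let centred a t := tnth (X i 0%N t) a - mu a 0.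

Let mtnthX a : measurable_fun setT (fun t => tnth (X i 0%N t) a).
Proof. exact: measurableT_comp (@measurable_tnth _ _ _ a) (mX _ _). Qed.

Let Intg_centred_sqr a : Intg P (fun t => centred a t ^+ 2).
Proof.
have I2 : Intg P (fun t => tnth (X i 0%N t) a ^+ 2).
  apply: Intg_of_sqr; first exact: measurable_funX.
  by under eq_fun do rewrite -exprM; exact: fourth_moment.
rewrite (_ : (fun t => _) = fun t => tnth (X i 0%N t) a ^+ 2 - 2 * mu a 0 * tnth (X i 0%N t) a + mu a 0 ^+ 2).
  apply: IntgD; last exact: Intg_cst.
  by apply: IntgB => //; apply: IntgZ; exact: Intg_of_sqr.
by apply/funext => t; rewrite /centred; ring.
Qed.

Lemma Sigma_pop_sym : Sigma^T = Sigma.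
Proof.
apply/matrixP => a b; rewrite !mxE; congr (Ex P _); apply/funext => t.
by rewrite mulrC.
Qed.

Lemma Sigma_pop_psd (x : 'rV[R]_d) : 0 <= (x *m Sigma *m x^T) 0 0.
Proof.
have mc a : measurable_fun setT (centred a) by exact: measurable_funB.
have Ic a b : Intg P (fun t => centred a t * centred b t) by apply: Intg_mul_sqr.
rewrite (_ : _ 0 0 = Ex P (fun t => (\sum_a x 0 a * centred a t) ^+ 2)).
  by apply: Ex_ge0 => t; exact: sqr_ge0.
rewrite (_ : (fun t => _) = fun t => \sum_b \sum_a (x 0 a * x 0 b) * (centred a t * centred b t)).
  rewrite Ex_sum => [|b]; last by apply: Intg_sum => a; exact: IntgZ.
  rewrite mxE; apply: eq_bigr => b _; rewrite Ex_sum => [|a]; last exact: IntgZ.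
  rewrite !mxE mulr_suml; apply: eq_bigr => a _; rewrite ExZ// mxE.
  by rewrite [Ex P (fun t => centred a t * centred b t)](_ : _ = Ex P (fun t => (tnth (X i 0%N t) a - mu a 0) * (tnth (X i 0%N t) b - mu b 0)))//; ring.
apply/funext => t; rewrite expr2 mulr_suml exchange_big; apply: eq_bigr => a _ /=.
by rewrite mulr_sumr; apply: eq_bigr => b _; ring.
Qed.

Lemma dim_gt0 : (0 < d)%N.
Proof.
case: ass1 => mu0 _ _; rewrite lt0n; apply: contraNneq mu0 => d0.
by apply/eqP/matrixP => a; have := ltn_ord a; rewrite {2}d0.
Qed.

Let mu_tr0 : mu^T != 0.
Proof. by case: ass1 => mu0 _ _; apply: contra_neq mu0 => H; apply: trmx_inj; rewrite H trmx0. Qed.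

Lemma posdef_Sigma_pop : Sigma \in unitmx -> posdef Sigma.
Proof. exact: psd_unitmx_posdef Sigma_pop_sym Sigma_pop_psd. Qed.

Lemma regular_pop : mcv_regular v mu Sigma.
Proof.
split; first exact: Sigma_pop_sym.
  by have := mulmx_tr_gt0 mu_tr0; rewrite trmxK.
case: ass1 => _ _; case: v => H.
- exact: posdef_det_gt0 Sigma_pop_sym (posdef_Sigma_pop H).
- exact: psd_trace_gt0 Sigma_pop_sym Sigma_pop_psd H.
- split=> //; have u0 : mu^T *m invmx Sigma != 0.
    by apply: contra_neq mu_tr0 => u0; rewrite -(mulmxKV H mu^T) u0 mul0mx.
  have := posdef_Sigma_pop H u0; rewrite mulmxKV// trmx_mul trmxK trmx_inv Sigma_pop_sym.
  by [].
- exact: H.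
Qed.

Hypothesis ass2 : assumption2 P X i.

(* If the score had variance 0, then X would almost surely lie on a quadric with nonzero leading
   coefficient in some coordinate a: given the others, that coordinate would take two values. *)
Lemma score_var_gt0 : 0 < score_var P v X i.
Proof.
rewrite lt0r Ex_ge0 ?andbT => [|t]; last exact: sqr_ge0.
apply/eqP => var0.
have [a lead] := Amat_leading_coefficient regular_pop (fun vRR => posdef_Sigma_pop (ltac:(by case: (ass1); rewrite vRR))).
apply: (@ass2 a).
set A := Amat v mu Sigma in lead; set m := group_mean P (data X) i (score P v X i).
pose s := mcv_scale d v (MCV v mu Sigma).
have s0 : s != 0 by rewrite mcv_scale_neq0 ?dim_gt0// MCV_gt0//; exact: regular_pop.
pose e : 'cV[R]_d := delta_mx a 0.
(* The vector with coordinate a set to 0: x = rest x + x_a e. Expanding the score bilinearly makes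
   it a quadratic polynomial in x_a, with coefficients [al], [be], [ga] that depend on the other
   coordinates only. *)
pose rest (x : d.-tuple R) : 'cV[R]_d := \col_b (tnth x b * (b != a)%:R).
pose lin (u : 'cV[R]_d) := (lsubmx A *m u) 0 0.
pose bil (u w : 'cV[R]_d) := (rsubmx A *m vecmx (u *m w^T)) 0 0.
pose al := s * bil e e.
pose be x := s * (lin e + bil (rest x) e + bil e (rest x)).
pose ga x := s * (lin (rest x) + bil (rest x) (rest x)) - m.
have al0 : al != 0 by rewrite mulf_neq0// /bil trmx_delta mul_delta_mx.
have decomp x : score P v X i x - m = al * tnth x a ^+ 2 + be x * tnth x a + ga x.
  have vE : vec_of_tuple x = rest x + tnth x a *: e.
    apply/colP => b; rewrite !mxE eqxx andbT; case: (eqVneq b a) => [->|ba]; rewrite /=; ring.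
  have addE (B C : 'M[R]_1) : (B + C) 0 0 = B 0 0 + C 0 0 by rewrite mxE.
  have linE u (c : R) w : lin (u + c *: w) = lin u + c * lin w.
    by rewrite /lin mulmxDr -scalemxAr addE [in X in _ + X]mxE.
  have vecE (M N : 'M[R]_d) (c : R) : vecmx (M + c *: N) = vecmx M + c *: vecmx N by apply/colP => q; rewrite !mxE.
  have mulE (M N : 'M[R]_d) (c : R) : (rsubmx A *m vecmx (M + c *: N)) 0 0 =
      (rsubmx A *m vecmx M) 0 0 + c * (rsubmx A *m vecmx N) 0 0.
    by rewrite vecE mulmxDr -scalemxAr addE [in X in _ + X]mxE.
  have bilE : bil (rest x + tnth x a *: e) (rest x + tnth x a *: e) =
      bil (rest x) (rest x) + tnth x a * bil (rest x) e + tnth x a * (bil e (rest x) + tnth x a * bil e e).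
    rewrite {1}/bil linearD linearZ/= mulmxDl -scalemxAl mulE !mulmxDr -!scalemxAr !mulE.
    by rewrite /bil.
  rewrite /score -/A -/s -[A]hsubmxK /moments mul_row_col addE vE.
  by rewrite -/(lin _) -/(bil _ _) linE bilE /al /be /ga; ring.
have mrest : mx_measurable rest.
  move=> b c; under eq_fun do rewrite mxE.
  by apply: measurable_funM => //; exact: measurable_tnth.
have mlin : measurable_fun setT (fun x => lin (rest x)) by apply: mx_measurable_mul.
have mbil (u w : d.-tuple R -> 'cV[R]_d) : mx_measurable u -> mx_measurable w ->
    measurable_fun setT (fun x => bil (u x) (w x)).
  move=> mu_ mw; apply: mx_measurable_mul => //; apply: mx_measurable_vecmx.
  by apply: mx_measurable_mul => //; exact: mx_measurable_tr.
have mbe : measurable_fun setT be.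
  by apply: measurable_funM => //; apply: measurable_funD; [apply: measurable_funD => //|]; exact: mbil.
have mga : measurable_fun setT ga.
  by apply: measurable_funB => //; apply: measurable_funM => //; apply: measurable_funD => //; exact: mbil.
pose disc x := be x ^+ 2 - 4 * al * ga x.
have mdisc : measurable_fun setT (fun x => Num.sqrt (disc x)).
  apply: measurableT_comp measurable_sqrt _; apply: measurable_funB; first exact: measurable_funX.
  exact: measurable_funM.
(* The two roots. Where the discriminant is negative, [Num.sqrt] is 0 and both functions are still
   defined and measurable; on the almost sure event the discriminant is a square. *)
pose f x := (- be x + Num.sqrt (disc x)) / (2 * al).
pose g x := (- be x - Num.sqrt (disc x)) / (2 * al).
have mf : measurable_fun setT f.
  by apply: measurable_funM => //; apply: measurable_funD => //; exact: measurableT_comp.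
have mg : measurable_fun setT g.
  by apply: measurable_funM => //; apply: measurable_funB => //; exact: measurableT_comp.
exists f, g; split => //.
  move=> x y xy; have re : rest x = rest y.
    by apply/colP => b; rewrite !mxE; case: (eqVneq b a) => [_|/xy ->]; rewrite ?mulr0.
  by rewrite /f /g /disc /be /ga re.
have mE : measurable [set t | tnth (X i 0%N t) a = f (X i 0%N t) \/ tnth (X i 0%N t) a = g (X i 0%N t)].
  have m1 (h : d.-tuple R -> R) : measurable_fun setT h -> measurable [set t | tnth (X i 0%N t) a = h (X i 0%N t)].
    move=> mh; have mb : measurable_fun setT (fun t => tnth (X i 0%N t) a == h (X i 0%N t)).
      by apply: measurable_fun_eqr => //; exact: measurableT_comp mh (mX _ _).
    have := mb measurableT [set true] I; rewrite setTI; congr measurable.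
    by apply/seteqP; split => t /= /eqP.
  by apply: measurableU; exact: m1.
have ms : measurable_fun setT (fun t => score P v X i (X i 0%N t)) by exact: measurableT_comp (measurable_score _ _ _ _) (mX _ _).
have msm : measurable_fun setT (fun t => score P v X i (X i 0%N t) - m) by exact: measurable_funB.
have Is2 := Intg_score_sqr v mX fourth_moment.
have Ism : Intg P (fun t => (score P v X i (X i 0%N t) - m) ^+ 2).
  rewrite (_ : (fun t => _) = fun t => score P v X i (X i 0%N t) ^+ 2 - 2 * m * score P v X i (X i 0%N t) + m ^+ 2).
    by apply: IntgD; [apply: IntgB => //; apply: IntgZ; exact: Intg_of_sqr|exact: Intg_cst].
  by apply/funext => t; ring.
have [N [mN PN HN]] := Ex_sqr_eq0 msm Ism var0.
set E := [set t | _] in mE *.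
have EC : P (~` E) = 0%E.
  apply/eqP; rewrite eq_le measure_ge0 andbT -PN le_measure ?inE//; first exact: measurableC.
  move=> t nE; apply: contrapT => /HN; rewrite decomp => quad; apply: nE.
  set x := X i 0%N t in quad *.
  have sq : disc x = (2 * al * tnth x a + be x) ^+ 2.
    rewrite /disc -[RHS](subr0) -(mulr0 (4 * al)) -quad; ring.
  have sr : Num.sqrt (disc x) = `|2 * al * tnth x a + be x| by rewrite sq sqrtr_sqr.
  have a2 : 2 * al != 0 by rewrite mulf_neq0// pnatr_eq0.
  rewrite /E/= -/x /f /g sr; case: (ger0P (2 * al * tnth x a + be x)) => _; [left|right].
    by field.
  by field.
by rewrite -[E]setCK probability_setC ?EC ?sube0//; exact: measurableC.
Qed.

End group_regularity.

(** * Wald statistics *)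

Lemma posdef_conj {R : realType} m n (A : 'M[R]_(m, n)) (S : 'M[R]_n) :
  row_free A -> posdef S -> posdef (A *m S *m A^T).
Proof.
move=> fA pS x x0; rewrite !mulmxA -(mulmxA _ A^T) -trmx_mul; apply: pS.
by apply: contra_neq x0 => xA; apply: (row_free_inj fA); rewrite xA mul0mx.
Qed.

Lemma posdef_diag {R : realType} n (l : 'rV[R]_n) : (forall i, 0 < l 0 i) -> posdef (diag_mx l).
Proof.
move=> l0 x x0; have E : (x *m diag_mx l *m x^T) 0 0 = \sum_i l 0 i * x 0 i ^+ 2.
  by rewrite mxE; apply: eq_bigr => i _; rewrite mul_mx_diag !mxE; ring.
have p i : 0 <= l 0 i * x 0 i ^+ 2 by rewrite mulr_ge0 ?sqr_ge0// ltW.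
rewrite E lt0r sumr_ge0// andbT; apply: contra_neq x0 => /eqP.
rewrite psumr_eq0// => /allP H; apply/rowP => i; have := H i; rewrite mem_index_enum => /(_ isT).
by rewrite mulf_eq0 (gt_eqF (l0 i))/= sqrf_eq0 => /eqP ->; rewrite mxE.
Qed.

Section wald_statistic.
Context {R : realType} {dT dS : measure_display}
  {T : measurableType dT} {S : measurableType dS} {k r : nat}.
Variables (P : probability T R) (X : 'I_k * nat -> T -> S).
Hypothesis mX : forall p, measurable_fun setT (X p).
Hypothesis indepX : indep_family P X.
Hypothesis identX : forall p B, measurable B ->
  P (X p @^-1` B) = P (X (p.1, 0%N) @^-1` B).
Variables (nn : 'I_k -> nat -> nat) (kappa : 'I_k -> R).
Hypothesis nn_ratio : forall i, (fun m : nat => (nn i m)%:R / m%:R) @ \oo --> kappa i.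
Hypothesis kappa_gt0 : forall i, 0 < kappa i.
Variables (y : 'I_k -> S -> R) (H : 'M[R]_(r, k)) (theta : 'cV[R]_k).
Variables (est sig : 'I_k -> nat -> T -> R).
Hypothesis my : forall i, measurable_fun setT (y i).
Hypothesis Iy2 : forall i, Intg P (fun t => y i (X (i, 0%N) t) ^+ 2).
Let var i := Ex P (fun t => (y i (X (i, 0%N) t) - group_mean P X i (y i)) ^+ 2).
Hypothesis var_gt0 : forall i, 0 < var i.
Hypothesis est_asy : forall i, asy_linear P root_size (fun z => est i z.1 z.2) (theta i 0)
  (group_fluctuation P X nn i (y i)).
Hypothesis sig_cvg : forall i, (fun z => sig i z.1 z.2) @ whp P --> var i.

Let W m t := wald H m (nn^~ m) (\col_i est i m t) (fun i => sig i m t).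
Hypothesis mW : forall m, measurable_fun setT (W m).

Variables (q : nat) (B : 'M[R]_(r, q)) (C : 'M[R]_(q, k)).
Hypotheses (HE : H = B *m C) (fullB : row_full B) (freeC : row_free C).

Let uB : B^T *m B \in unitmx.
Proof.
have fB : row_free B^T by rewrite /row_free mxrank_tr.
by have := posdef_unitmx (posdef_gram fB); rewrite trmxK.
Qed.

Let lam : 'rV[R]_k := \row_i ((kappa i)^-1 * var i).
Let G := C *m diag_mx lam *m C^T.
Let pG : posdef G.
Proof.
apply: posdef_conj => //.
by apply: posdef_diag => i; rewrite mxE mulr_gt0// invr_gt0.
Qed.
Let sG : G^T = G. Proof. by rewrite /G !trmx_mul trmxK tr_diag_mx mulmxA. Qed.
Let uG : G \in unitmx. Proof. exact: posdef_unitmx. Qed.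

Let lamn m t : 'rV[R]_k := \row_i (m%:R / (nn i m)%:R * sig i m t).
Let Gn (z : nat * T) := C *m diag_mx (lamn z.1 z.2) *m C^T.
Let Gn_cvg : mx_cvg P Gn G.
Proof.
apply: mx_cvg_mul; last exact: mx_cvg_cst.
apply: mx_cvg_mul; first exact: mx_cvg_cst.
move=> i j; rewrite !mxE.
have K : (fun z : nat * T => (z.1%:R / (nn i z.1)%:R * sig i z.1 z.2) * (i == j)%:R) @ whp P --> ((kappa i)^-1 * var i) * (i == j)%:R.
  apply: cvgMr_tmp; apply: cvgM => //.
  exact: (@whp_cvg_seq _ _ _ P (fun m => m%:R / (nn i m)%:R) _ (size_ratio_inv nn_ratio kappa_gt0 (i := i))).
by rewrite -[_ *+ (i == j)]mulr_natr; apply: whp_cvg_ext K => z; rewrite !mxE mulr_natr.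
Qed.

Let estv (z : nat * T) : 'cV[R]_k := \col_i est i z.1 z.2.

Let sqrt_size m : root_size m ^+ 2 = m%:R :> R. Proof. by rewrite sqr_sqrtr. Qed.

Let wald_quadratic z : Gn z \in unitmx ->
  W z.1 z.2 = z.1%:R * ((C *m estv z)^T *m invmx (Gn z) *m (C *m estv z)) 0 0.
Proof.
move=> uGn; rewrite /W /wald -/(estv z) -/(lamn z.1 z.2); congr (_ * _).
have sGn : (Gn z)^T = Gn z by rewrite /Gn !trmx_mul trmxK tr_diag_mx mulmxA.
rewrite -(mpinv_fullrank sGn uGn uB) [H *m estv z](_ : _ = B *m (C *m estv z)); last by rewrite HE mulmxA.
rewrite (_ : H *m diag_mx _ *m H^T = B *m Gn z *m B^T); first by rewrite trmx_mul !mulmxA.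
by rewrite HE trmx_mul /Gn !mulmxA.
Qed.

Let normalizer : exists Q : 'M[R]_q, Q *m G *m Q^T = 1%:M /\ invmx G = Q^T *m Q.
Proof.
have [Q QG] := posdef_normalize sG pG; exists Q; split => //.
have /mulmx1C : (Q *m G) *m Q^T = 1%:M by [].
by rewrite mulmxA => QQ; rewrite -[RHS](mulmxK uG) QQ mul1mx.
Qed.

Let C_inj : H *m theta = 0 -> C *m theta = 0.
Proof.
by rewrite HE -mulmxA => /(congr1 (mulmx B^T)); rewrite mulmxA mulmx0 => /(congr1 (mulmx (invmx (B^T *m B)))); rewrite mulKmx// mulmx0.
Qed.

Let near_Gn : \forall z \near whp P, Gn z \in unitmx.
Proof. exact: near_unitmx Gn_cvg uG. Qed.

(** W / m converges in probability to the quadratic form of G^-1 at C theta. This limit [dl] is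
    positive because C theta is nonzero, so W eventually exceeds m dl / 2. *)
Lemma wald_cvg_infty : H *m theta != 0 -> cvg_in_prob_infty P W.
Proof.
move=> Ht0 M; have [Q [QG Qi]] := normalizer.
have Ct0 : C *m theta != 0.
  by apply: contra_neq Ht0 => Ct; rewrite HE -mulmxA Ct mulmx0.
pose dl := ((C *m theta)^T *m invmx G *m (C *m theta)) 0 0.
have dl0 : 0 < dl.
  rewrite /dl; move: (C *m theta) Ct0 => w w0.
  rewrite Qi mulmxA -mulmxA -trmx_mul -[X in _ *m X]trmxK; apply: mulmx_tr_gt0.
  apply: contra_neq w0 => /(congr1 trmx); rewrite trmxK trmx0 => QC.
  have uQ : Q \in unitmx by rewrite -mulmxA in QG; have [] := mulmx1_unit QG.
  by rewrite -[LHS](mulKmx uQ) QC mulmx0.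
have hE : mx_cvg P estv theta.
  move=> i j; rewrite (ord1 j); have := asy_linear_cvg (root_size_inv_cvg0 (R := R)) (root_size_neq0 (R := R)) (est_asy i).
  by apply: whp_cvg_ext => z; rewrite mxE.
have hC : mx_cvg P (fun z => C *m estv z) (C *m theta) by apply: mx_cvg_mul => //; exact: mx_cvg_cst.
have K : (fun z => ((C *m estv z)^T *m invmx (Gn z) *m (C *m estv z)) 0 0) @ whp P --> dl.
  exact: (mx_cvg_mul (mx_cvg_mul (mx_cvg_tr hC) (mx_cvg_inv Gn_cvg uG)) hC).
have big : \forall z \near whp P, M < W z.1 z.2.
  have n1 : \forall m \near \oo, 2 * `|M| / dl < m%:R.
    exists (Num.bound (2 * `|M| / dl)) => // m /= mb.
    apply: lt_le_trans (_ : (Num.bound (2 * `|M| / dl))%:R <= _); last by rewrite ler_nat.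
    by apply: archi_boundP; rewrite divr_ge0 ?mulr_ge0// ltW.
  have dl2 : dl / 2 < dl by rewrite ltr_pdivrMr// ltr_pMr// ltr1n.
  have /cvgr_gt/(_ _ dl2) n2 := K.
  apply: filterS3 near_Gn n2 (whp_seq P n1) => z uz z2 /= z1.
  rewrite wald_quadratic//; move: z1; rewrite ltr_pdivrMr// => z1.
  apply: le_lt_trans (ler_norm M) _.
  have h : z.1%:R * (dl / 2) <= z.1%:R * ((C *m estv z)^T *m invmx (Gn z) *m (C *m estv z)) 0 0.
    by rewrite ler_wpM2l// ltW.
  by apply: lt_le_trans h; rewrite mulrA ltr_pdivlMr// mulrC.
have mle m : measurable [set t | W m t <= M].
  rewrite [X in measurable X](_ : _ = setT `&` W m @^-1` `]-oo, M]).
    by apply: mW; [exact: measurableT|exact: measurable_itv].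
  by rewrite setTI; apply/seteqP; split => t /=; rewrite in_itv.
apply: cvg_EFin; first by apply: nearW => m; exact: fin_num_measure (mle m).
apply/cvgr0Pnorm_le => e e0; apply: filterS (big e e0) => m [N [mN PN sub]].
rewrite ger0_norm ?fine_ge0// -lee_fin fineK; last exact: fin_num_measure (mle m).
apply: le_trans PN; apply: le_measure; rewrite ?inE//.
by move=> t /= WM; apply: contrapT => /sub /=; rewrite ltNge WM.
Qed.

Lemma wald_cvg_chi2 : H *m theta = 0 -> cvg_in_distribution P W (chi2_cdf q).
Proof.
move=> /C_inj Ct0; have [q0|q0] := posnP q.
  (* In rank 0 the statistic vanishes identically, and [chi2_cdf 0] is the distribution function of
     the point mass at 0. *)
  have H0 : H = 0 by apply/matrixP => a b; rewrite HE !mxE big1// => c; have := ltn_ord c; rewrite {2}q0.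
  have W0 m t : W m t = 0 by rewrite /W /wald H0 !mul0mx trmx0 !mul0mx mxE mulr0.
  move=> x _; rewrite /chi2_cdf q0 eqxx.
  rewrite (_ : (fun m => _) = fun=> (if 0 <= x then 1 else 0)%:E); first exact: cvg_cst.
  apply/funext => m; case: ifP => x0.
    rewrite (_ : [set t | _] = setT) ?probability_setT//.
    by apply/seteqP; split => t //= _; rewrite W0.
  rewrite (_ : [set t | _] = set0) ?measure0//.
  by apply/seteqP; split => t //=; rewrite W0 x0.
have [Q [QG Qi]] := normalizer.
pose F i m t := group_fluctuation P X nn i (y i) (m, t).
pose A := Q *m C.
(* Rows of Q C extended by 0 to all natural indices, as [Ex_laplace_cvg] numbers the coordinates by
   naturals. *)
pose coef (a : nat) i := if insub a is Some a' then A a' i else 0.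
pose V a m t := \sum_i coef a i * F i m t.
have mV a m : measurable_fun setT (V a m).
  by apply: measurable_sum => i; apply: measurable_funM => //; exact: measurable_group_fluctuation.
have coefE (a : 'I_q) i : coef a i = A a i by rewrite /coef valK.
pose V2 m t := \sum_(0 <= a < q) V a m t ^+ 2.
have lap (s : R) : 0 <= s -> (fun m => Ex P (fun t => expR (- (s * V2 m t)))) @ \oo --> (Num.sqrt (1 + 2 * s))^-1 ^+ q.
  move=> s0; apply: (Ex_laplace_cvg s0 mV) => tau.
  pose tr : 'rV[R]_q := \row_a tau a.
  pose c i := (tr *m A) 0 i.
  pose y' i x := y i x - group_mean P X i (y i).
  have Iy i : Intg P (fun t => y i (X (i, 0%N) t)).
    by apply: Intg_of_sqr => //; exact: measurableT_comp (my i) (mX _).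
  have Iy' i : Intg P (fun t => y' i (X (i, 0%N) t)) by apply: IntgB => //; exact: Intg_cst.
  have Iy'2 i : Intg P (fun t => y' i (X (i, 0%N) t) ^+ 2).
    rewrite (_ : (fun t => _) = fun t => y i (X (i, 0%N) t) ^+ 2 - 2 * group_mean P X i (y i) * y i (X (i, 0%N) t) + group_mean P X i (y i) ^+ 2).
      by apply: IntgD; [apply: IntgB => //; exact: IntgZ|exact: Intg_cst].
    by apply/funext => t; rewrite /y'; ring.
  have E1 m t : \sum_(0 <= a < q) tau a * V a m t =
      \sum_(i < k) \sum_(j < nn i m) (c i * (root_size m / (nn i m)%:R)) * y' i (X (i, nat_of_ord j) t).
    rewrite big_mkord /V; under eq_bigr do rewrite mulr_sumr.
    rewrite exchange_big; apply: eq_bigr => i _ /=.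
    rewrite /F /group_fluctuation /emp -/(y' i) !mulr_sumr.
    under eq_bigr do rewrite mulrA.
    rewrite -mulr_suml (_ : \sum_a _ = c i); last first.
      by rewrite /c mxE; apply: eq_bigr => a _; rewrite coefE [tr 0 a]mxE.
    by rewrite !mulr_sumr; apply: eq_bigr => j _; rewrite /y' /=; ring.
  have E2 : \sum_(0 <= a < q) tau a ^+ 2 / 2 = \sum_(i < k) (c i ^+ 2 * (kappa i)^-1) * Ex P (fun t => y' i (X (i, 0%N) t) ^+ 2) / 2.
    rewrite -!mulr_suml big_mkord; congr (_ / 2).
    (* The limiting variance of the combination with weights tau; it is the squared length of tau
       since Q G Q^T = 1. *)
    transitivity ((tr *m A *m diag_mx lam *m (tr *m A)^T) 0 0).
      rewrite /A trmx_mul trmx_mul !mulmxA -(mulmxA _ C) -(mulmxA _ (C *m _)) -/G.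
      have -> : tr *m Q *m G *m Q^T = tr by rewrite -[RHS]mulmx1 -QG !mulmxA.
      rewrite mxE.
      by apply: eq_bigr => a _; rewrite !mxE expr2.
    rewrite mxE; apply: eq_bigr => i _; rewrite mul_mx_diag /c.
    rewrite [(tr *m A)^T i 0]mxE [X in X * _]mxE [lam 0 i]mxE -/(var i); ring.
  rewrite E2 (_ : (fun m => _) = fun m => Ex P (fun t => cos (\sum_(i < k) \sum_(j < nn i m) (c i * (root_size m / (nn i m)%:R)) * y' i (X (i, nat_of_ord j) t)))); last first.
    by apply/funext => m; congr (Ex P _); apply/funext => t; rewrite E1.
  apply: (@cos_CLT _ _ _ _ _ _ P X mX indepX identX y' nn (fun i m => c i * (root_size m / (nn i m)%:R))) => // i.
  - exact: measurable_funB.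
  - by rewrite (ExB (Iy i) (Intg_cst P _)) [X in _ - X](Ex_cst P) subrr.
  - by rewrite -(mulr0 (c i)); apply: cvgMl_tmp; exact: (root_over_size nn_ratio kappa_gt0 i).
  - have K : (fun m => c i ^+ 2 * (m%:R / (nn i m)%:R)) @ \oo --> c i ^+ 2 * (kappa i)^-1.
      by apply: cvgMl_tmp; exact: size_ratio_inv.
    apply: cvg_trans K; apply: near_eq_cvg; apply: filterS (size_gt0 nn_ratio kappa_gt0 i) => m m0.
    have n0 : (nn i m)%:R != 0 :> R by rewrite pnatr_eq0 -lt0n.
    by rewrite !exprMn sqrt_size; field.
apply: (@chi2_cvg_in_distribution _ _ _ P q q0 V2 _ _ lap W mW).
- by move=> m; apply: measurable_sum => a; exact: measurable_funX.
- by move=> m t; rewrite /V2 big_mkord sumr_ge0// => a _; exact: sqr_ge0.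
pose Fv (z : nat * T) : 'cV[R]_q := C *m \col_i F i z.1 z.2.
pose U (z : nat * T) : 'cV[R]_q := root_size z.1 *: (C *m estv z).
have V2E z : V2 z.1 z.2 = ((Fv z)^T *m invmx G *m Fv z) 0 0.
  rewrite Qi mulmxA -mulmxA -trmx_mul [RHS]mxE /V2 big_mkord; apply: eq_bigr => a _.
  rewrite [_^T _ _]mxE -expr2; congr (_ ^+ 2).
  rewrite (_ : Q *m Fv z = A *m \col_i F i z.1 z.2); last by rewrite /Fv mulmxA.
  by rewrite [RHS]mxE; apply: eq_bigr => i _; rewrite coefE [X in _ = _ * X]mxE.
have WE : \forall z \near whp P, W z.1 z.2 = ((U z)^T *m invmx (Gn z) *m U z) 0 0.
  apply: whp_filterS near_Gn => z uz; rewrite wald_quadratic// /U.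
  have scaleE (c : R) (w : 'cV[R]_q) N : ((c *: w)^T *m N *m (c *: w)) 0 0 = c ^+ 2 * (w^T *m N *m w) 0 0.
    by rewrite [(c *: w)^T]linearZ/= -!scalemxAl -scalemxAr scalerA -expr2 mxE.
  by rewrite scaleE sqrt_size.
have tF a : tight P (fun z => Fv z a 0).
  have K : tight P (fun z => \sum_i C a i * F i z.1 z.2).
    apply: tight_sum => i; apply: tightZ; have [tL _] := est_asy i.
    by apply: (_ : tight P _); move: tL; congr tight; apply/funext => -[].
  by move: K; congr tight; apply/funext => z; rewrite [RHS]mxE; apply: eq_bigr => i _; rewrite mxE.
have UF a : (fun z => U z a 0 - Fv z a 0) @ whp P --> 0.
  have K : (fun z => \sum_i C a i * (root_size z.1 * (est i z.1 z.2 - theta i 0) - F i z.1 z.2)) @ whp P --> (\sum_(i < k) C a i * 0 : R).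
    apply: cvg_sum_whp => i; apply: cvgMl_tmp; have [_ h] := est_asy i.
    by apply: whp_cvg_ext h => -[].
  rewrite big1 in K; last by move=> i _; rewrite mulr0.
  apply: whp_cvg_ext K => z.
  have U0 : U z = root_size z.1 *: (C *m (estv z - theta)) by rewrite mulmxBr Ct0 subr0.
  rewrite U0 mxE [X in _ * X - _]mxE [X in _ - X]mxE mulr_sumr -sumrB; apply: eq_bigr => i _.
  by rewrite !mxE; ring.
have NG := mx_cvg_inv Gn_cvg uG.
(* Expansion of the difference of the two quadratic forms with U = F + (U - F): every term has a
   factor tending to 0 in probability, and the remaining factors are tight or convergent. *)
have K : (fun z => \sum_b \sum_a (Fv z b 0 * ((U z a 0 - Fv z a 0) * invmx (Gn z) a b)
     + (U z a 0 - Fv z a 0) * (U z b 0 - Fv z b 0) * invmx (Gn z) a b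
     + Fv z a 0 * ((U z b 0 - Fv z b 0) * invmx (Gn z) a b)
     + Fv z a 0 * (Fv z b 0 * (invmx (Gn z) a b - invmx G a b)))) @ whp P -->
     (\sum_(b < q) \sum_(a < q) (0 + 0 + 0 + 0) : R).
  apply: cvg_sum_whp => b; apply: cvg_sum_whp => a.
  have p1 a' : (fun z => (U z a' 0 - Fv z a' 0) * invmx (Gn z) a b) @ whp P --> 0.
    by rewrite -(mul0r (invmx G a b)); apply: cvgM => //; exact: NG.
  apply: cvgD; last first.
    apply: (tF a); apply: (tF b); rewrite -(subrr (invmx G a b)); apply: cvgB; [exact: NG|exact: cvg_cst].
  apply: cvgD; last by apply: (tF a).
  apply: cvgD; first by apply: (tF b).
  rewrite -(mul0r (invmx G a b)) -{1}(mul0r 0); apply: cvgM; last exact: NG.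
  exact: cvgM.
rewrite big1 in K; last by move=> b _; rewrite big1// => a _; rewrite !addr0.
apply: whp_cvg_near K; apply: whp_filterS WE => z ->; rewrite V2E.
have quad (u : 'cV[R]_q) (N : 'M[R]_q) : (u^T *m N *m u) 0 0 = \sum_b \sum_a u a 0 * N a b * u b 0.
  rewrite mxE; apply: eq_bigr => b _; rewrite mxE mulr_suml; apply: eq_bigr => a _.
  by rewrite mxE.
rewrite !quad -sumrB; apply: eq_bigr => b _; rewrite -sumrB; apply: eq_bigr => a _.
ring.
Qed.

End wald_statistic.

Lemma group_fluctuationZ {R : realType} {dT dS} {T : measurableType dT} {S : measurableType dS} {k}
    (P : probability T R) (X : 'I_k * nat -> T -> S) nn i (c : R) (y : S -> R) z :
  Intg P (fun t => y (X (i, 0%N) t)) ->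
  group_fluctuation P X nn i (fun x => c * y x) z = c * group_fluctuation P X nn i y z.
Proof.
move=> Iy; have := @group_fluctuation_sum _ _ _ _ _ _ P X nn i 'I_1 (fun=> c) (fun=> y) z (fun=> Iy).
by rewrite big_ord1 => <-; congr (group_fluctuation _ _ _ _ _ _); apply/funext => x; rewrite big_ord1.
Qed.

(** * The tests based on the coefficients and on their inverses *)

Section mcv_tests.
Context {R : realType} {dT : measure_display} {T : measurableType dT} {k d r : nat}.
Variables (P : probability T R) (v : mcv_variant) (H : 'M[R]_(r, k)).
Variables (X : 'I_k -> nat -> T -> d.-tuple R) (nn : 'I_k -> nat -> nat) (kappa : 'I_k -> R).
Hypothesis mX : forall i j, measurable_fun setT (X i j).
Hypothesis indepX : mutually_independent P X.
Hypothesis identX : forall i j (B : set (d.-tuple R)), measurable B ->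
  P (X i j @^-1` B) = P (X i 0%N @^-1` B).
Hypothesis nn_ratio : forall i, (fun m : nat => (nn i m)%:R / m%:R) @ \oo --> kappa i.
Hypothesis kappa_gt0 : forall i, 0 < kappa i.
Hypothesis ass1 : forall i, assumption1 P v X i.
Hypothesis ass2 : forall i, assumption2 P X i.

Local Notation mcv i := (MCV v (mu_pop P X i) (Sigma_pop P X i)).
Let fourth i a : P.-integrable setT (fun t => (tnth (X i 0%N t) a ^+ 4)%:E).
Proof. by case: (ass1 i). Qed.
Let regular i : mcv_regular v (mu_pop P X i) (Sigma_pop P X i). Proof. exact: regular_pop. Qed.
Let mcv_gt0 i : 0 < mcv i. Proof. exact: MCV_gt0. Qed.
Let Is2 i : Intg P (fun t => score P v X i (data X (i, 0%N) t) ^+ 2).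
Proof. exact: (Intg_score_sqr v mX (@fourth i)). Qed.
Let ms i : measurable_fun setT (score P v X i). Proof. exact: measurable_score. Qed.
Let Is i : Intg P (fun t => score P v X i (data X (i, 0%N) t)).
Proof. by apply: Intg_of_sqr => //; exact: measurableT_comp (ms i) (mX _ _). Qed.
Let sV := root_size_inv_cvg0 (R := R).
Let s0 := root_size_neq0 (R := R).
Let asyC i := asy_linear_Chat mX indepX identX nn_ratio kappa_gt0 (@fourth i) (dim_gt0 (ass1 i)) (@regular i).
Let sigC i := sig2C_cvg mX indepX identX nn_ratio kappa_gt0 (@fourth i) (dim_gt0 (ass1 i)) (@regular i).
Let varC i := score_var_gt0 mX (ass1 i) (@ass2 i).

(** Influence function of 1/C, by the derivative -1/C^2; its square accounts for the factor C^(-4)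
    in [sig2B]. *)
Let scoreB i x := - mcv i ^- 2 * score P v X i x.

Let msB i : measurable_fun setT (scoreB i). Proof. exact: measurable_funM. Qed.

Let IsB2 i : Intg P (fun t => scoreB i (data X (i, 0%N) t) ^+ 2).
Proof. by under eq_fun do rewrite exprMn; exact: IntgZ. Qed.

Let varBE i : Ex P (fun t => (scoreB i (data X (i, 0%N) t) - group_mean P (data X) i (scoreB i)) ^+ 2) =
  mcv i ^- 4 * score_var P v X i.
Proof.
have -> : group_mean P (data X) i (scoreB i) = - mcv i ^- 2 * group_mean P (data X) i (score P v X i).
  by rewrite /group_mean ExZ.
set m := group_mean _ _ _ _; pose g t := (score P v X i (X i 0%N t) - m) ^+ 2.
have Ig : Intg P g.
  rewrite (_ : g = fun t => score P v X i (data X (i, 0%N) t) ^+ 2 - 2 * m * score P v X i (data X (i, 0%N) t) + m ^+ 2).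
    by apply: IntgD; [apply: IntgB => //; exact: IntgZ|exact: Intg_cst].
  by apply/funext => t; rewrite /g /data/=; ring.
transitivity (Ex P (fun t => mcv i ^- 4 * g t)); last by rewrite ExZ.
by congr (Ex P _); apply/funext => t; rewrite /scoreB -mulrBr exprMn sqrrN -exprVn -exprM exprVn.
Qed.

Let asyB i : asy_linear P root_size (fun z => (Chat v (nn i z.1) (obs X i z.2))^-1) (mcv i)^-1
  (group_fluctuation P (data X) nn i (scoreB i)).
Proof.
have dV := is_derive_inv (lt0r_neq0 (mcv_gt0 i)).
apply: asy_linear_ext (asy_linear_comp sV s0 dV (@asyC i)) => // z.
exact/esym/group_fluctuationZ.
Qed.

Let sigB i : (fun z => sig2B v (nn i z.1) (obs X i z.2)) @ whp P --> mcv i ^- 4 * score_var P v X i.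
Proof.
apply: cvgM; last exact: sigC.
apply: cvgV; first by rewrite expf_neq0// lt0r_neq0.
exact: whp_cvgX (asy_linear_cvg sV s0 (@asyC i)).
Qed.

Let mdata p : measurable_fun setT (data X p). Proof. exact: mX. Qed.
Let identd p B : measurable B -> P (data X p @^-1` B) = P (data X (p.1, 0%N) @^-1` B).
Proof. exact: identX. Qed.

(** The factorisation passes through dimension [\rank H], which becomes the number of degrees of
    freedom. *)
Let HE : H = col_base H *m row_base H. Proof. by rewrite mulmx_base. Qed.

Lemma S_C_limits (C := \col_i mcv i) :
  (H *m C = 0 -> cvg_in_distribution P (S_C v H X nn) (chi2_cdf (\rank H))) /\
  (H *m C != 0 -> cvg_in_prob_infty P (S_C v H X nn)).
Proof.
have asy i : asy_linear P root_size (fun z => Chat v (nn i z.1) (obs X i z.2)) (C i 0)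
    (group_fluctuation P (data X) nn i (score P v X i)) by rewrite mxE; exact: asyC.
have mS := measurable_S_C v mX H nn.
split => HC.
  exact: (wald_cvg_chi2 mdata indepX identd nn_ratio kappa_gt0 ms Is2 varC asy sigC mS
    HE (col_base_full H) (row_base_free H) HC).
exact: (wald_cvg_infty nn_ratio kappa_gt0 varC asy sigC mS HE (col_base_full H) (row_base_free H) HC).
Qed.

Lemma S_B_limits (B := \col_i (mcv i)^-1) :
  (H *m B = 0 -> cvg_in_distribution P (S_B v H X nn) (chi2_cdf (\rank H))) /\
  (H *m B != 0 -> cvg_in_prob_infty P (S_B v H X nn)).
Proof.
have asy i : asy_linear P root_size (fun z => (Chat v (nn i z.1) (obs X i z.2))^-1) (B i 0)
    (group_fluctuation P (data X) nn i (scoreB i)) by rewrite mxE; exact: asyB.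
have mS := measurable_S_B v mX H nn.
have varB i : 0 < Ex P (fun t => (scoreB i (data X (i, 0%N) t) - group_mean P (data X) i (scoreB i)) ^+ 2).
  by rewrite varBE mulr_gt0// invr_gt0 exprn_gt0.
have sigB' i : (fun z => sig2B v (nn i z.1) (obs X i z.2)) @ whp P -->
    Ex P (fun t => (scoreB i (data X (i, 0%N) t) - group_mean P (data X) i (scoreB i)) ^+ 2).
  by rewrite varBE; exact: sigB.
split => HB.
  exact: (wald_cvg_chi2 mdata indepX identd nn_ratio kappa_gt0 msB IsB2 varB asy sigB' mS
    HE (col_base_full H) (row_base_free H) HB).
exact: (wald_cvg_infty nn_ratio kappa_gt0 varB asy sigB' mS HE (col_base_full H) (row_base_free H) HB).
Qed.

End mcv_tests.

Theorem theorem2 (R : realType) (dT : measure_display) (T : measurableType dT)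
    (P : probability T R) (d k r : nat) (v : mcv_variant) (H : 'M[R]_(r, k))
    (X : 'I_k -> nat -> T -> d.-tuple R) (nn : 'I_k -> nat -> nat)
    (kappa : 'I_k -> R) :
  H *m (const_mx 1 : 'cV[R]_k) = 0 ->
  (forall i j, measurable_fun setT (X i j)) ->
  mutually_independent P X ->
  (forall i j (B : set (d.-tuple R)), measurable B ->
     P (X i j @^-1` B) = P (X i 0%N @^-1` B)) ->
  (forall m, (\sum_(i < k) nn i m)%N = m) ->
  (forall i, (fun m : nat => (nn i m)%:R / m%:R) @ \oo --> kappa i) ->
  (forall i, 0 < kappa i < 1) ->
  (forall i, assumption1 P v X i) ->
  (forall i, assumption2 P X i) ->
  let C := \col_i MCV v (mu_pop P X i) (Sigma_pop P X i) in
  let B := \col_i (C i 0)^-1 in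
  [/\ H *m C = 0 -> cvg_in_distribution P (S_C v H X nn) (chi2_cdf (\rank H)),
      H *m C != 0 -> cvg_in_prob_infty P (S_C v H X nn),
      H *m B = 0 -> cvg_in_distribution P (S_B v H X nn) (chi2_cdf (\rank H)) &
      H *m B != 0 -> cvg_in_prob_infty P (S_B v H X nn)].
Proof.
move=> _ mX indepX identX _ nn_ratio kappa01 ass1 ass2 C B.
have kappa_gt0 i : 0 < kappa i by case/andP: (kappa01 i).
have [C0 CN] := S_C_limits H mX indepX identX nn_ratio kappa_gt0 ass1 ass2.
have [B0 BN] := S_B_limits H mX indepX identX nn_ratio kappa_gt0 ass1 ass2.
have BE : B = \col_i (MCV v (mu_pop P X i) (Sigma_pop P X i))^-1.
  by apply/colP => i; rewrite !mxE.
by rewrite BE; split.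
Qed.
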